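(* Let $m>n\ge1$ be integers and let $T$ be a homeomorphically irreducible tree with exactly $n$ branch vertices. (1) Every tree induced by a $T$-admissible sequence of degree $m$ is $m$-burnable. (2) Let $T_{max}$ be a tree homeomorphic to $T$ with $b(T_{max})=m$ such that $|V(T_{max})|\ge|V(T')|$ for every tree $T'$ homeomorphic to $T$ with $b(T')=m$. Then: (a) $T_{max}$ is a tree induced by some $T$-admissible sequence of degree $m$; (b) if $t=\langle T_1,\dots,T_l\rangle$ is a $T$-admissible sequence such that $T_i=T_\emptyset$ and $T_{i+1}\ne T_\emptyset$ for some $1\le i<l$, then $T_{max}$ is not a tree induced by $t$ of degree $m$; (c) if $t=\langle T_1,\dots,T_l\rangle$ is a $T$-admissible sequence such that $\mathrm{rt}(T_i)$ and $\mathrm{rt}(T_j)$ are adjacent in $T$ for some $1\le i<j\le l$ with $j-i\ne1$, then $T_{max}$ is not a tree induced by $t$ of degree $m$.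
   Context: A sequence $(x_1,\dots,x_m)$ of vertices of a graph $G$ is a burning sequence if $N_{m-1}[x_1]\cup\cdots\cup N_0[x_m]=V(G)$ (where $N_k[v]=\{u:d(u,v)\le k\}$) and $d(x_i,x_j)\ge j-i$ for $i<j$; the burning number $b(G)$ is the least length of a burning sequence and $G$ is $m$-burnable if $b(G)\le m$. A tree is homeomorphically irreducible if it has no vertex of degree two; $V_{br}(T)$ is its set of branch vertices (degree $\ge3$); an arm is a path from a branch vertex to a leaf with no branch vertex in between, an internal path is a path between two branch vertices with no other branch vertex in between. Two trees are homeomorphic if one is obtained from the other by inserting or deleting degree-two vertices on arms and internal paths. A rooted subtree has a designated root $\mathrm{rt}$; $T_\emptyset$ is the empty rooted tree. A $T$-admissible sequence is a finite sequence $t=\langle T_1,\dots,T_l\rangle$ of (possibly empty) rooted subtrees of $T$ whose vertex sets partition $V_{br}(T)$ (empty blocks allowed); its signature is $\mathrm{sig}_t(v)=\mathrm{dist}_T(v,\mathrm{rt}(T_i))+i$ for $v\in V(T_i)$. For an integer $m>\max\{\mathrm{sig}_t(v)\}$, a tree is induced by $t$ of degree $m$ if obtained from $T$ in two stages. Stage 1 (unique tree $T'$): every arm of $T$ at a branch vertex $v$ is extended by $m-\mathrm{sig}_t(v)-1$ new vertices; for adjacent branch vertices $v\in V(T_i)$, $v'\in V(T_j)$, $i\ne j$, the edge joining them is extended by $2m-\mathrm{sig}_t(v)-\mathrm{sig}_t(v')$ new vertices. Stage 2: for each $1\le i\le m$ with $T_i=T_\emptyset$ or $i\ge l+1$, insert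 $2(m-i)+1$ new vertices into some arm or some internal path of $T'$ not of length one (choices arbitrary; repetition allowed). In particular, ''induced by $t$ of degree $m$'' presupposes $m>\max\mathrm{sig}_t$. *)

(* Defs.v *)
From Stdlib Require Import Relation_Operators.
From mathcomp Require Import all_boot.

Set Implicit Arguments.
Unset Strict Implicit.
Unset Printing Implicit Defensive.

Record sgraph := SGraph {
  vertex :> finType;
  adj : rel vertex;
  adj_sym : symmetric adj;
  adj_irr : irreflexive adj }.

Section Graph.
Variable G : sgraph.
Implicit Types (u v x y : G) (p : seq G).

Definition deg v := #|[set u | adj v u]|.
Definition leaf v := deg v == 1.
Definition branch v := 3 <= deg v.
Definition Vbr : {set G} := [set v | branch v].

Definition connected := forall x y, connect (@adj G) x y.
Definition acyclic := forall c : seq G, 3 <= size c -> ~ ucycle (@adj G) c.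
Definition tree := [/\ 0 < #|G|, connected & acyclic].
Definition homeo_irreducible := forall v, deg v <> 2.

(* A shortest path has fewer than #|G| edges, so the search range is
   exhaustive; the value is #|G| when there is no path at all. *)
Definition dist u v :=
  find (fun k => [exists p : k.-tuple G, path (@adj G) u p && (last u p == v)])
       (iota 0 #|G|).

Definition ball k v : {set G} := [set u | dist u v <= k].

(* The term tnth x i is the (i+1)-st vertex of the sequence. *)
Definition burning_seq m (x : m.-tuple G) :=
  \bigcup_(i < m) ball (m - i.+1) (tnth x i) = [set: G] /\
  forall i j : 'I_m, i < j -> j - i <= dist (tnth x i) (tnth x j).

Definition burning_number b :=
  (exists x : b.-tuple G, burning_seq x) /\
  forall k (x : k.-tuple G), burning_seq x -> b <= k.

Definition burnable m := exists2 b, burning_number b & b <= m.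

(* Paths are given by their start x and the sequence p of the following
   vertices, so that the length is size p. *)
Definition simple_path x p := path (@adj G) x p && uniq (x :: p).
Definition interior x p := behead (belast x p).
Definition no_branch_between x p := all (predC branch) (interior x p).

Definition arm x p :=
  [&& simple_path x p, branch x, leaf (last x p) & no_branch_between x p].

Definition internal_path x p :=
  [&& simple_path x p, 0 < size p, branch x, branch (last x p)
    & no_branch_between x p].

Definition edge_of x p u v :=
  ((u, v) \in zip (x :: p) p) || ((v, u) \in zip (x :: p) p).

End Graph.

Definition iso (G H : sgraph) :=
  exists2 f : G -> H, bijective f & forall x y, adj (f x) (f y) = adj x y.

(* The graph obtained from G by inserting k x y new vertices into each edge xy
   (k is meant to be symmetric).  Each edge is oriented by the enumeration of
   the vertices; the new vertices on the edge (x, y) are numbered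
   0, ..., k x y - 1 from x to y. *)
Section Subdivide.
Variables (G : sgraph) (k : G -> G -> nat).

Definition seg (e : G * G) : nat :=
  if adj e.1 e.2 && (enum_rank e.1 < enum_rank e.2) then k e.1 e.2 else 0.

Definition sub_vertex : finType := (G + {e : G * G & 'I_(seg e)})%type.

Definition sub_end (x : G) (s : {e : G * G & 'I_(seg e)}) :=
  (x == (tag s).1) && (tagged s == 0 :> nat) ||
  (x == (tag s).2) && ((tagged s).+1 == seg (tag s)).

Definition sub_adj (a b : sub_vertex) : bool :=
  match a, b with
  | inl x, inl y => [&& adj x y, seg (x, y) == 0 & seg (y, x) == 0]
  | inl x, inr s | inr s, inl x => sub_end x s
  | inr s, inr s' => (tag s == tag s') &&
      (((tagged s).+1 == tagged s' :> nat) ||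
       ((tagged s').+1 == tagged s :> nat))
  end.

Lemma sub_adj_sym : symmetric sub_adj.
Proof.
case=> [x|s] [y|s'] //=; first by rewrite adj_sym [X in _ && X]andbC.
by rewrite eq_sym orbC.
Qed.

Lemma sub_adj_irr : irreflexive sub_adj.
Proof.
by case=> [x|s] /=; rewrite ?adj_irr // orbb gtn_eqF ?andbF.
Qed.

Definition subdivide : sgraph := SGraph sub_adj_sym sub_adj_irr.

End Subdivide.

(* H is obtained from G by inserting vertices on arms and internal paths. *)
Definition insertion (G H : sgraph) :=
  exists k : G -> G -> nat,
    [/\ forall u v, k u v = k v u,
        forall u v, adj u v -> 0 < k u v ->
          exists x p, (arm x p || internal_path x p) && edge_of x p u v
      & iso (subdivide k) H].

Definition homeomorphic : sgraph -> sgraph -> Prop :=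
  clos_refl_sym_trans sgraph insertion.

Record rooted_subtree (T : sgraph) := RootedSubtree {
  verts : {set T};
  rt : T;
  rt_in : rt \in verts;
  verts_connected : forall x y, x \in verts -> y \in verts ->
    connect (fun u v => [&& adj u v, u \in verts & v \in verts]) x y }.

Section Admissible.
Variables (T : sgraph).

(* None is the empty rooted tree. *)
Implicit Type t : seq (option (rooted_subtree T)).

Definition overts (B : option (rooted_subtree T)) : {set T} :=
  if B is Some R then verts R else set0.

(* The block T_i, with i starting from 1; it is None for i > size t. *)
Definition blk t i := nth None (None :: t) i.

Definition admissible t :=
  (forall v, branch v <-> exists i, v \in overts (blk t i)) /\
  (forall i j, i <> j -> [disjoint overts (blk t i) & overts (blk t j)]).

(* The index i >= 1 of the block containing v, when there is one. *)
Definition block_of t (v : T) := (find (fun B => v \in overts B) t).+1.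

Definition sig t (v : T) :=
  if blk t (block_of t v) is Some R then dist v (rt R) + block_of t v else 0.

(* T is homeomorphically irreducible in all uses, so that its arms and
   internal paths are its edges with a leaf and its other edges. *)
Definition stage1_ext t m (x y : T) :=
  if branch x && branch y then
    if block_of t x == block_of t y then 0 else 2 * m - (sig t x + sig t y)
  else if branch x && leaf y then m - sig t x - 1
  else if leaf x && branch y then m - sig t y - 1
  else 0.

Definition stage1 t m : sgraph := subdivide (stage1_ext t m).

(* The second stage inserts 2(m-i)+1 vertices into the edge f i of T'; only
   internal paths, not arms, are required to have length other than one. *)
Definition induced t m (G : sgraph) :=
  let T' := stage1 t m in
  (forall v, branch v -> sig t v < m) /\
  exists f : nat -> T' * T',
    (forall i, 1 <= i <= m -> blk t i = None ->
       exists x p, (arm x p || internal_path x p && (size p != 1)) &&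
                   edge_of x p (f i).1 (f i).2) /\
    iso (subdivide (fun u v : T' =>
           \sum_(1 <= i < m.+1 |
                  ~~ isSome (blk t i) && (f i \in [:: (u, v); (v, u)]))
              (2 * (m - i) + 1)))
        G.

End Admissible.

(* Main.v *)
(** Let G be a tree homeomorphic to T, that is, T with lengths on its edges, and
    let the balls of radius m - i around x_i cover G.  Assign every branch vertex v
    to the ball that reaches farthest beyond it, the one minimising d(v, x_i) + i.
    The vertices assigned to one ball span a subtree of T, which is rooted at the
    branch vertex nearest to x_i, so this is an admissible sequence.  An arm or an
    edge between two blocks is covered by what its ends pass on, at most m - sig
    vertices from each end, and by the balls of empty blocks, at most 2 (m - i) + 1
    vertices each.  A block with b vertices has at least b + 2 half-edges leaving
    it, since all degrees are at least three; so moving x_i away from its root, or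
    lengthening an edge inside the block, loses more than it gains.  Hence G has at
    most as many vertices as the trees induced by the sequence, and it is one of
    them if the numbers are equal.

    By the same bound on the half-edges, an induced tree grows when a block is moved
    to a smaller empty index, or when two blocks with adjacent roots and
    indices differing by at least two are merged.  As m > n, the first operation is
    available whenever some signature is m.  Counting with fewer than m balls gives
    strictly smaller trees, so a largest induced tree has burning number exactly m
    and can be compared with Tmax. *)
From Stdlib Require Import Relation_Operators.
Require Import Defs.
From mathcomp Require Import all_boot.
From mathcomp Require Import zify.

Set Implicit Arguments.
Unset Strict Implicit.
Unset Printing Implicit Defensive.

(** * Distances in trees *)

(** The centres of a cover may lie anywhere in G, and this decides the bookkeeping. Let [del u] be
    the excess of the true cost of u, its distance in G to its centre plus the index, over its
    signature. A centre that moves from its root onto a half-edge leaving the block adds twice its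
    displacement there, relative to the charge by the true cost; vertices inserted inside a block
    are new points, but raise [del] behind them. With [eps] the sum of such displacements and K the
    number of vertices inserted inside blocks, the gain is 2 [eps] + K, while the degree count gives
    a loss of at least 3 [eps] + 2 K. Since [del] varies inside a block, a bare number of half-edges
    does not suffice: the degree count is weighted by [del] and combined with an inequality for each
    parent edge. An induced tree may burn in fewer than m rounds and is then no competitor of Tmax.
    Its shorter cover yields a labelling of larger size; sizes are bounded, so repeating this ends
    at burning number m. Homeomorphism, as an equivalence closure, mixes insertions and deletions.
    It is replaced by an invariant of single steps, and trees are then identified by a covering
    argument. *)

Section Distance.
Variable G : sgraph.
Implicit Types (u v w x : G) (p : seq G).

Lemma adj_neq u v : adj u v -> u != v.
Proof. by apply: contraTneq => ->; rewrite adj_irr. Qed.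

Lemma dist_le_path u p : path (@adj G) u p -> dist u (last u p) <= size p.
Proof.
move=> up; rewrite /dist leqNgt; apply/negP => lt_p.
have lt_N : size p < #|G|.
  by apply: leq_trans lt_p _; rewrite -[X in _ <= X](size_iota 0) find_size.
have := before_find 0 lt_p; rewrite nth_iota // => /negbT/negP[].
by apply/existsP; exists (in_tuple p); rewrite up /=.
Qed.

Hypothesis conG : connected G.

Lemma dist_path u v :
  exists p, [/\ path (@adj G) u p, last u p = v & size p = dist u v].
Proof.
have /connectP[p0 up0 ->] := conG u v.
case/shortenP: up0 => p up Up _.
have lt_p : size p < #|G|.
  by have := max_card (mem (u :: p)); rewrite (card_uniqP Up).
set a := fun k => [exists q : k.-tuple G, path (@adj G) u q && (last u q == last u p)].
have hs : has a (iota 0 #|G|).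
  apply/hasP; exists (size p); first by rewrite mem_iota.
  by apply/existsP; exists (in_tuple p); rewrite up /=.
have := nth_find 0 hs; rewrite nth_iota; last first.
  by move: hs; rewrite has_find size_iota.
case/existsP=> q /andP[uq /eqP lq]; exists q; split => //.
by rewrite size_tuple add0n.
Qed.

Lemma dist_xx u : dist u u = 0.
Proof. by apply/eqP; rewrite -leqn0; apply: (@dist_le_path u [::]). Qed.

Lemma dist_eq0 u v : dist u v = 0 -> u = v.
Proof. by case: (dist_path u v) => p [_ lp <-] /size0nil p0; rewrite -lp p0. Qed.

Lemma dist_sym u v : dist u v = dist v u.
Proof.
suff le (a b : G) : dist a b <= dist b a by apply/eqP; rewrite eqn_leq !le.
case: (dist_path b a) => p [bp lp <-].
have rp : path (@adj G) a (rev (belast b p)).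
  rewrite -lp rev_path; apply: sub_path bp => y z; by rewrite adj_sym.
have := dist_le_path rp; rewrite size_rev size_belast.
suff -> : last a (rev (belast b p)) = b by [].
case: p {bp rp} lp => [|y p] /= lp; first by rewrite lp.
by rewrite rev_cons last_rcons.
Qed.

Lemma dist_triangle u v w : dist u w <= dist u v + dist v w.
Proof.
case: (dist_path u v) => p [up lp <-]; case: (dist_path v w) => q [vq lq <-].
rewrite -size_cat -lq -lp -last_cat; apply: dist_le_path.
by rewrite cat_path up lp.
Qed.

Lemma dist_adj u v : adj u v -> dist u v = 1.
Proof.
move=> uv; apply/eqP; rewrite eqn_leq; apply/andP; split.
  by apply: (@dist_le_path u [:: v]); rewrite /= uv.
by rewrite lt0n; apply: contraTneq (adj_neq uv) => /dist_eq0 ->; rewrite eqxx.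
Qed.

Lemma dist_adj_le u v x : adj u v -> dist u x <= (dist v x).+1.
Proof. by move/dist_adj => uv; have := dist_triangle u v x; rewrite uv. Qed.

Lemma dist_closer u x : u != x ->
  exists v, adj u v /\ dist u x = (dist v x).+1.
Proof.
case: (dist_path u x) => -[/= [_ ->]|v p [/= /andP[uv vp] lp sp _]].
  by rewrite eqxx.
exists v; split => //; apply/eqP; rewrite eqn_leq dist_adj_le //=.
by rewrite -sp ltnS -lp dist_le_path.
Qed.

End Distance.

(** * Distance levels in a tree *)

Section Tree.
Variable G : sgraph.
Implicit Types (u v w x : G) (p : seq G).

(** A walk from u to v without this edge, once shortened, is closed by the edge to a cycle; it has
    at least three vertices because the one-step walk is excluded. *)
Lemma acyclic_bridge u v : acyclic G -> adj u v ->
  ~~ connect (fun a b : G => adj a b && ((a, b) != (u, v)) && ((a, b) != (v, u)))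
      u v.
Proof.
move=> acG uv; apply/negP => /connectP[p0 up0].
case/shortenP: up0 => p up Up _ ev.
apply: (acG (u :: p)).
  case: p up ev {Up} => [|a [|b p]] //= up ev.
    by move: uv; rewrite ev adj_irr.
  by move: up; rewrite ev eqxx /= andbF.
apply/andP; split => //=; rewrite rcons_path -ev adj_sym uv andbT.
by apply: sub_path up => a b /andP[/andP[]].
Qed.

Hypothesis trG : tree G.

Let conG : connected G. Proof. by case: trG. Qed.

(** Descending to x through closer neighbours never leaves the levels below d. It is applied to the
    graph without one edge that has an end at level d. *)
Lemma connect_below (r : rel G) x d :
  (forall a b, adj a b -> dist a x < d -> dist b x < d -> r a b) ->
  forall a, dist a x < d -> connect r a x.
Proof.
move=> hr a; have [e] := ubnP (dist a x); elim: e a => // e IH a le_a lt_d.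
 have [->|/(dist_closer conG)[b [ab dab]]] := eqVneq a x => //.
have lt_b : dist b x < d by lia.
apply: connect_trans (connect1 _) (IH b _ lt_b); last lia.
exact: hr.
Qed.

(** If both ends were on the same level, each could descend to x without the edge uv, which would
    then not be a bridge. *)
Lemma tree_dist_neq u v x : adj u v -> dist u x != dist v x.
Proof.
case: trG => _ _ acG uv; apply/eqP => duv.
have := acyclic_bridge acG uv; set r := (fun _ _ => _) => /negP; apply.
have rsym : connect_sym r.
  by apply: sym_connect_sym => a b; rewrite /r adj_sym ![(b, a) == _]xpair_eqE
    ![(a, b) == _]xpair_eqE -!andbA; congr (_ && _); rewrite andbC ![(b == _) && _]andbC.
have low a : dist a x < dist u x -> connect r a x.
  apply: connect_below => b c bc lb lc; rewrite /r bc /= !xpair_eqE.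
  by apply/andP; split; apply/negP => /andP[/eqP e _]; move: lb; rewrite e; lia.
have unx : u != x.
  apply/eqP => e; move: duv; rewrite e dist_xx => /esym /(dist_eq0 conG) e'.
  by move: uv; rewrite e e' adj_irr.
have vnx : v != x.
  by apply: contraNneq unx => e; apply/eqP/(dist_eq0 conG); rewrite duv e dist_xx.
have nuv := adj_neq uv.
have cx w : (w == u) || (w == v) -> w != x -> connect r w x.
  move=> ew /(dist_closer conG)[a [wa da]].
  have dw : dist w x = dist u x by case/orP: ew => /eqP ->.
  apply: connect_trans (connect1 _) (low a _); last lia.
  rewrite /r wa /= !xpair_eqE.
  by apply/andP; split; apply/negP => /andP[_ /eqP e]; move: da; rewrite e; lia.
apply: connect_trans (cx u _ unx) _; first by rewrite eqxx.
by rewrite rsym cx // eqxx orbT.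
Qed.

Lemma tree_dist_step u v x : adj u v ->
  dist u x = (dist v x).+1 \/ dist v x = (dist u x).+1.
Proof.
move=> uv; have := tree_dist_neq x uv; have := dist_adj_le conG x uv.
by rewrite adj_sym in uv; have := dist_adj_le conG x uv; lia.
Qed.

(** With two closer neighbours, the route from u to w, down to x and back up to v would avoid the
    bridge uv. *)
Lemma tree_closer_uniq u v w x : adj u v -> adj u w ->
  dist v x < dist u x -> dist w x < dist u x -> v = w.
Proof.
case: trG => _ _ acG uv uw lv lw; apply/eqP; apply/negPn/negP => vw.
have := acyclic_bridge acG uv; set r := (fun _ _ => _) => /negP; apply.
have rsym : connect_sym r.
  by apply: sym_connect_sym => a b; rewrite /r adj_sym ![(b, a) == _]xpair_eqE
    ![(a, b) == _]xpair_eqE -!andbA; congr (_ && _); rewrite andbC ![(b == _) && _]andbC.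
have low a : dist a x < dist u x -> connect r a x.
  apply: connect_below => b c bc lb lc; rewrite /r bc /= !xpair_eqE.
  apply/andP; split; apply/negP => /andP[/eqP e /eqP e'].
    by move: lb; rewrite e ltnn.
  by move: lc; rewrite e' ltnn.
have uw' : r u w.
  rewrite /r uw /= !xpair_eqE eqxx /= eq_sym vw /=.
  by apply/negP => /andP[/eqP e _]; move: uv; rewrite e adj_irr.
apply: connect_trans (connect1 uw') _.
by apply: connect_trans (low _ lw) _; rewrite rsym low.
Qed.

(* Outside x every neighbour but one is farther from x, so a walk that never
   turns back and once moves away from x moves away forever. *)
Lemma nonbacktracking_dist (q : nat -> G) L x :
  (forall j, j < L -> adj (q j) (q j.+1)) ->
  (forall j, j.+1 < L -> q j <> q j.+2) ->
  (0 < L -> dist (q 1) x = (dist (q 0) x).+1) ->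
  forall j, j <= L -> dist (q j) x = dist (q 0) x + j.
Proof.
move=> qadj qnb q1 j.
elim/ltn_ind: j => -[|[|j]] IH le_j; first by rewrite addn0.
  by rewrite q1 ?addn1.
have d0 := IH j (leqW (ltnSn j)) (ltnW (ltnW le_j)).
have d1 := IH j.+1 (ltnSn _) (ltnW le_j).
case: (tree_dist_step x (qadj j.+1 le_j)) => [e|->]; last by rewrite d1 !addnS.
case: (qnb j le_j); apply: (@tree_closer_uniq (q j.+1) _ _ x); try lia.
  by rewrite adj_sym qadj //; lia.
exact: qadj.
Qed.

Lemma nonbacktracking_dist0 (q : nat -> G) L :
  (forall j, j < L -> adj (q j) (q j.+1)) ->
  (forall j, j.+1 < L -> q j <> q j.+2) ->
  forall j, j <= L -> dist (q j) (q 0) = j.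
Proof.
move=> qadj qnb j le_j; rewrite (nonbacktracking_dist qadj qnb _ le_j) ?dist_xx //.
by move=> L0; rewrite dist_sym // dist_adj // qadj.
Qed.

End Tree.

(** A vertex of largest [h] on a cycle would have two different lower neighbours. In a tree the
    distance to a root is such a potential, so this is the tool for carrying acyclicity over to
    subdivisions. *)
Lemma acyclic_potential (G : sgraph) (h : G -> nat) :
  (forall u v, adj u v -> h u != h v) ->
  (forall u v w, adj u v -> adj u w -> h v < h u -> h w < h u -> v = w) ->
  acyclic G.
Proof.
move=> hneq huniq c sz cyc.
have [z0 z0c] : exists z0, z0 \in c by case: c sz {cyc} => // a c _; exists a; rewrite mem_head.
case: (@arg_maxnP _ z0 (mem c) h z0c) => z zc zmax.
have [i c' ec] := rot_to zc.
have : ucycle (@adj G) (z :: c') by rewrite -ec rot_ucycle.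
have sz' : 2 <= size c' by have := congr1 size ec; rewrite size_rot /=; lia.
have inc a : a \in c' -> h a <= h z.
  by move=> ac; apply: zmax; rewrite inE -(mem_rot i) ec inE ac orbT.
case: c' sz' inc {ec} => [|a c'] //= sz'.
case: (lastP c') sz' => // s b _ inc; rewrite /ucycle /= !rcons_path last_rcons.
case/andP=> /andP[za] /andP[_ bz] /and3P[_ anc _].
have : a = b.
  apply: (huniq z); rewrite ?za // 1?adj_sym //; rewrite ltn_neqAle.
    by rewrite inc ?mem_head // andbT eq_sym hneq.
  by rewrite inc ?andbT ?hneq // inE mem_rcons mem_head orbT.
by move=> e; move: anc; rewrite e mem_rcons mem_head.
Qed.

(** * Isomorphisms and coverings of trees *)

Section Iso.
Implicit Types G H : sgraph.

Lemma iso_refl G : iso G G.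
Proof. by exists id => //; exists id. Qed.

Lemma iso_sym G H : iso G H -> iso H G.
Proof.
case=> f [g fK gK] fadj; exists g; first by exists f.
by move=> x y; rewrite -fadj !gK.
Qed.

Lemma iso_trans G H K : iso G H -> iso H K -> iso G K.
Proof.
case=> f fb fadj [g gb gadj]; exists (g \o f); first exact: bij_comp.
by move=> x y /=; rewrite gadj fadj.
Qed.

Lemma iso_card G H : iso G H -> #|G| = #|H|.
Proof. by case=> f fb _; exact: bij_eq_card fb. Qed.

Lemma iso_deg G H (f : G -> H) : bijective f ->
  (forall x y, adj (f x) (f y) = adj x y) -> forall x, deg (f x) = deg x.
Proof.
move=> fb fadj x; have [g fK gK] := fb.
rewrite /deg -(card_imset _ (bij_inj fb)); apply: eq_card => y.
rewrite inE; apply/idP/imsetP => [xy|[z]].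
  by exists (g y); rewrite ?gK // inE -fadj gK.
by rewrite inE => xz ->; rewrite fadj.
Qed.

(* A locally bijective homomorphism onto a tree is a covering map, and a tree
   has no nontrivial connected covering. *)
Lemma covering_iso H G (f : H -> G) (a0 : H) :
  connected H -> tree G ->
  (forall a b, adj a b -> adj (f a) (f b)) ->
  (forall a b c, adj a b -> adj a c -> f b = f c -> b = c) ->
  (forall a, deg (f a) = deg a) -> iso H G.
Proof.
move=> conH trG fhom floc fdeg; have [_ conG _] := trG.
have finj : injective f.
  move=> a b fab; have /connectP[p0 ap0 eb] := conH a b.
  move: eb; case/shortenP: ap0 => p ap Up _ eb.
  pose q j := nth a (a :: p) j.
  have qadj j : j < size p -> adj (q j) (q j.+1) by move=> lt; exact/(pathP a).
  (* By local injectivity the image of a path does not turn back, so in the tree G its ends are as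
     far apart as the path is long; equal images force length 0. *)
  have qd := @nonbacktracking_dist0 _ trG (f \o q) (size p) _ _ (size p) (leqnn _).
  have : dist (f (q (size p))) (f (q 0)) = size p.
    apply: qd => j lt; first exact/fhom/qadj.
    move=> /= e; have : q j = q j.+2.
      apply: (floc (q j.+1)) => //; last exact: qadj.
      by rewrite adj_sym qadj // ltnW.
    have lt2 : j.+2 < size (a :: p) by rewrite ltnS.
    have lt0 : j < size (a :: p) by apply: ltn_trans lt2.
    by move/eqP; rewrite (nth_uniq a lt0 lt2 Up); lia.
  rewrite {1 2}/q /= -last_nth -eb fab dist_xx => /esym /size0nil ep.
  by rewrite eb ep.
have fN a : [set f b | b in [set b | adj a b]] = [set c | adj (f a) c].
  apply/eqP; rewrite eqEcard; apply/andP; split.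
    by apply/subsetP => c /imsetP[b]; rewrite !inE => ab ->; exact: fhom.
  by rewrite card_imset //; have := fdeg a; rewrite /deg => ->.
have fsurj c : c \in codom f.
  have /connectP[p + ->] := conG (f a0) c.
  elim: p (a0) => [|b p IH] a /=; first by rewrite codom_f.
  case/andP=> ab; have : b \in [set c | adj (f a) c] by rewrite inE.
  by rewrite -fN => /imsetP[b' _ ->]; exact: IH.
exists f.
  apply: inj_card_bij => //; rewrite -(card_codom finj).
  by apply: subset_leq_card; apply/subsetP => c _.
move=> x y; apply/idP/idP => [xy|]; last exact: fhom.
have : f y \in [set c | adj (f x) c] by rewrite inE.
by rewrite -fN => /imsetP[y' + /finj ->]; rewrite inE.
Qed.

End Iso.

(** * Burning sequences and covers by balls *)

Section Covers.
Variable G : sgraph.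
Implicit Types (u v w z : G) (p : seq G) (x : nat -> G).

(** Burning without the separation of the centres, which [covers_burnable] restores. Indices start
    at 1 to agree with the block indices of an admissible sequence. *)
Definition covers m x := forall z, exists2 i, 1 <= i <= m & dist z (x i) <= m - i.

(** A boolean form, so that a least length can be extracted. *)
Definition is_burning_seq m (s : m.-tuple G) :=
  (\bigcup_(i < m) ball (m - i.+1) (tnth s i) == [set: G]) &&
  [forall i : 'I_m, forall j : 'I_m,
     (i < j) ==> (j - i <= dist (tnth s i) (tnth s j))].

Lemma is_burning_seqP m (s : m.-tuple G) :
  reflect (burning_seq s) (is_burning_seq s).
Proof.
apply: (iffP andP) => -[cov far]; split; try exact/eqP.
  by move=> i j ij; have /forallP/(_ j)/implyP := forallP far i; exact.
by apply/forallP => i; apply/forallP => j; apply/implyP; exact: far.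
Qed.

Lemma burning_seq_burnable m k (s : k.-tuple G) :
  burning_seq s -> k <= m -> burnable G m.
Proof.
move=> bs km.
have ex : exists k, [exists s : k.-tuple G, is_burning_seq s].
  by exists k; apply/existsP; exists s; apply/is_burning_seqP.
case: (ex_minnP ex) => b /existsP[t /is_burning_seqP bt] bmin; exists b.
  split; first by exists t.
  by move=> l u /is_burning_seqP bu; apply: bmin; apply/existsP; exists u.
by apply: leq_trans km; apply: bmin; apply/existsP; exists s; apply/is_burning_seqP.
Qed.

Hypothesis conG : connected G.

Lemma covers_burning_seq m x : covers m x ->
  (forall a b, 1 <= a -> a < b <= m -> b - a <= dist (x a) (x b)) ->
  burning_seq [tuple x i.+1 | i < m].
Proof.
move=> cov far; split.
  apply/eqP; rewrite -subTset; apply/subsetP => z _.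
  have [[|i] /andP[i0 im] dz] := cov z => //.
  apply/bigcupP; exists (Ordinal im) => //.
  by rewrite inE tnth_mktuple.
move=> i j ij; rewrite !tnth_mktuple.
by have := far i.+1 j.+1 isT; rewrite subSS; apply; rewrite !ltnS ij ltn_ord.
Qed.

Lemma burning_seq_covers m (s : m.-tuple G) (z0 : G) :
  burning_seq s -> exists x, covers m x.
Proof.
case=> cov _; exists (fun i => nth z0 s i.-1) => z.
have := in_setT z; rewrite -cov => /bigcupP[i _]; rewrite inE => dz.
exists i.+1; first exact: (ltn_ord i).
by rewrite /= -tnth_nth.
Qed.

(* A centre which is already burned when its turn comes covers nothing new, so
   it may be moved to any vertex that is not yet burned; if there is no such
   vertex, then the sequence can be cut there. *)
Lemma covers_burnable m x : covers m x -> burnable G m.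
Proof.
move=> cov0.
suff step j : j <= m -> burnable G m \/ exists2 y, covers m y &
    forall a b, 1 <= a -> a < b <= j -> b - a <= dist (y a) (y b).
  case: (step m (leqnn m)) => // -[y cov far].
  exact: burning_seq_burnable (covers_burning_seq cov far) (leqnn m).
elim: j => [|j IH] le_j.
  by right; exists x => // a b a1 /andP[ab]; lia.
case: (IH (ltnW le_j)) => [|[y cov far]]; first by left.
pose ok v := [forall a : 'I_j, j - a <= dist (y a.+1) v].
have okP v : reflect (forall a, 1 <= a <= j -> j.+1 - a <= dist (y a) v) (ok v).
  apply: (iffP forallP) => h => [[|a] // /andP[_ aj]|a].
    by have := h (Ordinal aj); rewrite subSS.
  by have := h a.+1; rewrite subSS; apply; rewrite /= ltn_ord.
case: (boolP (ok (y j.+1))) => [/okP oky|/forallPn[a0]].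
  right; exists y => // a b a1 /andP[ab]; rewrite leq_eqVlt ltnS => /orP[/eqP eb|bj].
    by rewrite eb; apply: oky; lia.
  by apply: far => //; rewrite ab.
rewrite -ltnNge => a0near.
case: (pickP ok) => [v /okP okv|nok].
  right; exists (fun i => if i == j.+1 then v else y i) => [z|a b a1 /andP[ab bj]].
    have [i im dz] := cov z; have [ei|ni] := eqVneq i j.+1; last first.
      by exists i => //; rewrite (negbTE ni).
    (* The ball given up, of radius [m - j.+1], lies inside the ball around [y a0.+1]: the two
       centres are less than [j - a0] apart. *)
    exists a0.+1; first by have := ltn_ord a0; lia.
    have := dist_triangle conG z (y j.+1) (y a0.+1).
    rewrite ei in dz; rewrite (dist_sym conG (y j.+1)).
    by have := ltn_ord a0; case: eqP; lia.
  have [ea|_] := eqVneq a j.+1; first by move: ab; rewrite ea; lia.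
  have [->|nb] := eqVneq b j.+1; first by apply: okv; lia.
  by apply: far => //; rewrite ab; lia.
(* No vertex passes [ok], so the first j centres cover G already with the radii of a sequence of
   length j. *)
left; apply: (burning_seq_burnable (k := j)) (ltnW le_j).
apply: (@covers_burning_seq j y _ far) => z.
have /negbT/forallPn[a] := nok z; rewrite -ltnNge => near.
exists a.+1; first by have := ltn_ord a; lia.
by rewrite dist_sym //; lia.
Qed.

End Covers.

(** * Subdivisions *)

Section Subdivision.
Variables (T : sgraph) (k : T -> T -> nat).
Hypothesis ksym : forall x y, k x y = k y x.
Implicit Types (x y z u v w : T) (e : T * T).

Local Notation H := (subdivide k).

(* The value is the far end of e when j is out of range. *)
Definition segpt e j : H :=
  if insub j is Some i then inr (existT (fun e => 'I_(seg k e)) e i) else inl e.2.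

(* The j-th vertex of the subdivided edge xy counted from x, for j <= k x y + 1;
   both ends are included. *)
Definition pt x y j : H :=
  if enum_rank x < enum_rank y then
    if j is j'.+1 then segpt (x, y) j' else inl x
  else
    if (k x y).+1 - j is j'.+1 then segpt (y, x) j' else inl y.

(** Coordinates of an inserted vertex with the index as a plain number; comparing keys avoids
    equations between dependent pairs. *)
Definition key (a : H) : option (T * T * nat) :=
  if a is inr s then Some (tag s, nat_of_ord (tagged s)) else None.

Lemma segptE e j (lt : j < seg k e) :
  segpt e j = inr (existT (fun e => 'I_(seg k e)) e (Ordinal lt)).
Proof. by rewrite /segpt insubT. Qed.

Lemma segpt_val e (i : 'I_(seg k e)) :
  segpt e i = inr (existT (fun e => 'I_(seg k e)) e i).
Proof. by rewrite /segpt valK. Qed.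

Lemma segpt_out e j : seg k e <= j -> segpt e j = inl e.2.
Proof. by move=> le; rewrite /segpt insubF // ltnNge le. Qed.

Lemma key_segpt e j : j < seg k e -> key (segpt e j) = Some (e, j).
Proof. by move=> lt; rewrite segptE. Qed.

Lemma rank_neq x y : adj x y -> (enum_rank x < enum_rank y) = ~~ (enum_rank y < enum_rank x).
Proof.
move=> /adj_neq xy; rewrite -leqNgt ltn_neqAle.
suff -> : enum_rank x != enum_rank y :> nat by [].
by apply: contra xy => /eqP/val_inj/enum_rank_inj ->.
Qed.

Lemma seg_fwd x y : adj x y -> enum_rank x < enum_rank y -> seg k (x, y) = k x y.
Proof. by rewrite /seg /= => -> ->. Qed.

Lemma pt_fwd x y j : adj x y -> enum_rank x < enum_rank y -> 0 < j <= k x y ->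
  exists2 lt : j.-1 < seg k (x, y), pt x y j = segpt (x, y) j.-1 &
    key (pt x y j) = Some (x, y, j.-1).
Proof.
move=> xy lt /andP[j0 jk]; have lt' : j.-1 < seg k (x, y) by rewrite seg_fwd //; lia.
exists lt'; case: j j0 jk lt' => // j _ jk lt'; rewrite /pt lt //.
by rewrite key_segpt.
Qed.

Lemma pt0 x y : adj x y -> pt x y 0 = inl x.
Proof.
move=> xy; rewrite /pt; case: ifP => // nlt; rewrite segpt_out //.
by rewrite /seg /= adj_sym xy rank_neq 1?adj_sym // nlt ksym.
Qed.

Lemma pt_rev x y j : adj x y -> j <= (k x y).+1 -> pt y x ((k x y).+1 - j) = pt x y j.
Proof.
move=> xy jk; rewrite /pt (rank_neq xy) ksym; case: (enum_rank y < enum_rank x) => //=.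
by rewrite subKn // ksym.
Qed.

Lemma pt_flip x y j : adj x y -> j <= k x y ->
  pt x y j = pt y x (k x y - j).+1 /\ pt x y j.+1 = pt y x (k x y - j).
Proof.
move=> xy jk; rewrite -(@pt_rev x y j) ?(leqW jk) // -(@pt_rev x y j.+1) //.
by rewrite subSS subSn.
Qed.

Lemma pt_end x y : adj x y -> pt x y (k x y).+1 = inl y.
Proof.
move=> xy; rewrite -pt_rev // subnn pt0 //.
by rewrite adj_sym.
Qed.

Lemma key_pt x y j : adj x y -> 0 < j <= k x y ->
  key (pt x y j) = if enum_rank x < enum_rank y then Some (x, y, j.-1)
                   else Some (y, x, k x y - j).
Proof.
move=> xy jk; case: ifP => lt; first by case: (pt_fwd xy lt jk).
rewrite -pt_rev; [|by []|lia].
have yx : adj y x by rewrite adj_sym.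
have lt' : enum_rank y < enum_rank x by rewrite rank_neq // lt.
have jk' : 0 < (k x y).+1 - j <= k y x by rewrite (ksym y); lia.
case: (pt_fwd yx lt' jk') => _ _ ->; congr (Some (_, _)); lia.
Qed.

Lemma pt_neq_inl x y z j : adj x y -> 0 < j <= k x y -> pt x y j <> inl z.
Proof. by move=> xy jk /(congr1 key); rewrite key_pt //; case: ifP. Qed.

Lemma pt_eq x y j x' y' j' : adj x y -> adj x' y' ->
    0 < j <= k x y -> 0 < j' <= k x' y' -> pt x y j = pt x' y' j' ->
  [/\ x' = x, y' = y & j' = j] \/ [/\ x' = y, y' = x & j' = (k x y).+1 - j].
Proof.
move=> xy xy' jk jk' /(congr1 key); rewrite !key_pt //.
case: ifP => l1; case: ifP => l2 [e1 e2 e3].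
- by left; split => //; lia.
- by right; split => //; rewrite e1 e2 ksym; move: e3 jk jk'; rewrite e1 e2 (ksym y'); lia.
- by right; split => //; rewrite e1 e2; move: e3 jk jk'; rewrite e1 e2 (ksym y'); lia.
- by left; split => //; move: e3 jk jk'; rewrite e1 e2; lia.
Qed.

Lemma pt_inj x y j j' : adj x y -> j <= (k x y).+1 -> j' <= (k x y).+1 ->
  pt x y j = pt x y j' -> j = j'.
Proof.
move=> xy; have nxy := adj_neq xy.
wlog le : j j' / j <= j'.
  by move=> hw h1 h2; case: (leqP j j') => le e; [|symmetry]; apply: hw => //; lia.
move=> jk jk'; have [->|j0] := posnP j.
  rewrite pt0 //; have [->|j1] := posnP j' => //.
  move: jk'; rewrite leq_eqVlt => /orP[/eqP ->|jk'].
    by rewrite pt_end // => -[e]; rewrite e eqxx in nxy.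
  by move/esym/pt_neq_inl; case=> //; rewrite j1 -ltnS.
move: jk'; rewrite leq_eqVlt => /orP[/eqP ej|jk'].
  move: jk; rewrite leq_eqVlt => /orP[/eqP ->|jk]; first by rewrite ej.
  by rewrite ej pt_end // => /pt_neq_inl[] //; rewrite j0 -ltnS.
case/(pt_eq xy xy) => [||[_ _ ->]|[e]] //; try lia.
by rewrite e eqxx in nxy.
Qed.

Lemma vertexP (a : H) : (exists x, a = inl x) \/
  exists x y j, [/\ adj x y, 0 < j <= k x y & a = pt x y j].
Proof.
case: a => [x|[[x y] i]]; [by left; exists x|right].
have := ltn_ord i; rewrite {2}/seg /=; case: ifP => [/andP[xy lt] ik|//].
by exists x, y, i.+1; split; rewrite // /pt lt segpt_val.
Qed.

Lemma pt_adj x y j : adj x y -> j <= k x y -> adj (pt x y j) (pt x y j.+1).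
Proof.
wlog lt : x y j / enum_rank x < enum_rank y.
  move=> hw xy jk; have [lt|nlt] := boolP (enum_rank x < enum_rank y); first exact: hw.
  have yx : adj y x by rewrite adj_sym.
  have [-> ->] := pt_flip xy jk; rewrite adj_sym.
  by apply: hw => //; [rewrite rank_neq|rewrite ksym leq_subr].
move=> xy jk; rewrite /pt lt; case: j jk => [|j] jk.
  have [k0|k0] := posnP (k x y).
    have sxy : seg k (x, y) = 0 by rewrite seg_fwd.
    have syx : seg k (y, x) = 0.
      by rewrite /seg /=; rewrite (rank_neq xy) in lt; rewrite (negbTE lt) andbF.
    by rewrite segpt_out ?sxy //= xy sxy syx.
  by rewrite segptE ?seg_fwd // => lt' /=; rewrite /sub_end /= eqxx.
have ltj : j < seg k (x, y) by rewrite seg_fwd.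
move: jk; rewrite leq_eqVlt => /orP[/eqP jk|jk]; last first.
  have ltj' : j.+1 < seg k (x, y) by rewrite seg_fwd.
  by rewrite !segptE /= !eqxx.
rewrite segptE (@segpt_out _ j.+1) ?seg_fwd ?jk //=.
by rewrite /sub_end /= seg_fwd // jk !eqxx orbT.
Qed.

Lemma edgeP (a b : H) : adj a b ->
  exists x y j, [/\ adj x y, j <= k x y, a = pt x y j & b = pt x y j.+1].
Proof.
have sym (c d : H) :
  (exists x y j, [/\ adj x y, j <= k x y, c = pt x y j & d = pt x y j.+1]) ->
  exists x y j, [/\ adj x y, j <= k x y, d = pt x y j & c = pt x y j.+1].
  case=> x [y [j [xy jk -> ->]]]; exists y, x, (k x y - j).
  by have [-> ->] := pt_flip xy jk; rewrite adj_sym (ksym y) leq_subr.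
have half x (s : {e & 'I_(seg k e)}) : sub_end x s ->
  exists x' y j, [/\ adj x' y, j <= k x' y, inl x = pt x' y j & inr s = pt x' y j.+1].
  case: s => [[u v] i]; rewrite /sub_end /=.
  have := ltn_ord i; rewrite {2}/seg /=; case: ifP => [/andP[uv lt] ik|//].
  have vu : adj v u by rewrite adj_sym.
  have -> : inr (existT _ (u, v) i) = pt u v i.+1 :> H.
    by rewrite /pt lt segpt_val.
  case/orP=> /andP[/eqP -> /eqP].
    by move=> ->; exists u, v, 0; rewrite pt0.
  move=> ei; exists v, u, 0; rewrite pt0 //; split => //.
  have {}ei : i.+1 = k u v by rewrite ei seg_fwd.
  by rewrite -pt_rev // ?ei // subSn // subnn.
case: a b => [x|s] [y|s'] /=.
- case/and3P=> xy; rewrite /seg /= xy adj_sym xy !andTb => s1 s2.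
  have k0 : k x y = 0.
    move: s1 s2; rewrite (rank_neq xy).
    by case: (_ < _) => /= /eqP e1 /eqP e2; first rewrite ksym.
  by exists x, y, 0; have := pt_end xy; rewrite k0 pt0.
- exact: half.
- by move/half/sym.
case: s s' => [e i] [e' i'] /=; case/andP => /eqP /= ee.
move: i'; rewrite -{}ee {e'} => i' ii'.
wlog {ii'} eii : i i' / i' = i.+1 :> nat.
  by case/orP: ii' => /eqP e1 hw; [|apply: sym]; apply: hw.
case: e i i' eii => x y i i' eii.
have := ltn_ord i'; rewrite {2}/seg /=; case: ifP => [/andP[xy lt] ik|//].
exists x, y, i.+1; rewrite -eii; split; rewrite ?(ltnW ik) //.
  by rewrite eii /pt lt segpt_val.
by rewrite /pt lt segpt_val.
Qed.

Lemma adj_inl x (b : H) : adj (inl x : H) b -> exists2 y, adj x y & b = pt x y 1.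
Proof.
move=> /edgeP[x' [y [j [xy jk e ->]]]]; case: j => [|j] in jk e *.
  by move: e; rewrite pt0 // => -[->]; exists y.
by case: (@pt_neq_inl x' y x j.+1).
Qed.

Lemma adj_pt x y j (b : H) : adj x y -> 0 < j <= k x y -> adj (pt x y j) b ->
  b = pt x y j.-1 \/ b = pt x y j.+1.
Proof.
move=> xy jk /edgeP[x' [y' [i [xy' ik e ->]]]].
have [i0|i0] := posnP i.
  by case: (@pt_neq_inl x y x' j) => //; rewrite e i0 pt0.
case: (pt_eq xy xy' jk _ e) => [|[-> -> ->]|[ex ey ei]]; first by rewrite i0.
  by right.
left; rewrite ex ey ei -pt_rev; [|by rewrite adj_sym|rewrite (ksym y); lia].
by rewrite (ksym y); congr (pt _ _ _); lia.
Qed.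

Lemma pt1_inj x y y' : adj x y -> adj x y' -> pt x y 1 = pt x y' 1 -> y = y'.
Proof.
move=> xy xy'; have [k0|k0] := posnP (k x y).
  rewrite -[X in pt x y X](congr1 S k0) pt_end //.
  have [k0'|k0'] := posnP (k x y').
    by rewrite -[X in pt x y' X](congr1 S k0') pt_end // => -[].
  by move/esym/pt_neq_inl; case.
have [k0'|k0'] := posnP (k x y').
  by rewrite -[X in pt x y' X](congr1 S k0') pt_end // => /pt_neq_inl[].
case/(pt_eq xy xy') => // -[// e].
by move: xy'; rewrite -e => _; move: xy; rewrite e adj_irr.
Qed.

Lemma deg_inl x : deg (inl x : H) = deg x.
Proof.
rewrite /deg -[RHS](@card_in_imset _ _ (fun y => pt x y 1)); last first.
  by move=> y y'; rewrite !inE => xy xy'; exact: pt1_inj.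
apply: eq_card => b; rewrite inE; apply/idP/imsetP => [/adj_inl[y xy ->]|[y]].
  by exists y; rewrite ?inE.
by rewrite inE => xy ->; rewrite -(pt0 xy) pt_adj.
Qed.

Lemma deg_pt x y j : adj x y -> 0 < j <= k x y -> deg (pt x y j) = 2.
Proof.
move=> xy jk.
have -> : 2 = #|[set pt x y j.-1; pt x y j.+1]|.
  by rewrite cards2; case: eqP => // /pt_inj e; have := e xy; lia.
apply: eq_card => b; rewrite !inE; apply/idP/orP => [/(adj_pt xy jk)[]->|[]/eqP->].
- by left.
- by right.
- by rewrite adj_sym -{2}(@prednK j) ?pt_adj //; lia.
by rewrite pt_adj //; case/andP: jk.
Qed.

Lemma connect_pt x y j : adj x y -> j <= (k x y).+1 -> connect (@adj H) (inl x) (pt x y j).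
Proof.
move=> xy; elim: j => [|j IH] jk; first by rewrite pt0.
by apply: connect_trans (IH (ltnW jk)) (connect1 _); exact: pt_adj.
Qed.

Lemma subdivide_connected : connected T -> connected H.
Proof.
move=> conT; have symH : connect_sym (@adj H).
  by apply: sym_connect_sym => a b; exact: adj_sym.
have inlP x y : connect (@adj H) (inl x) (inl y).
  have /connectP[p + ->] := conT x y; elim: p x => //= z p IH x /andP[xz zp].
  by apply: connect_trans (IH z zp); rewrite -(pt_end xz) connect_pt.
have toinl (a : H) : exists x, connect (@adj H) (inl x) a.
  case: (vertexP a) => [[x ->]|[x [y [j [xy jk ->]]]]]; exists x => //.
  by apply: connect_pt => //; lia.
move=> a b; have [x xa] := toinl a; have [y yb] := toinl b.
by apply: connect_trans yb; apply: connect_trans (inlP x y); rewrite symH.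
Qed.

(* Scaling the potential of T leaves room for the inserted vertices. *)
Lemma subdivide_tree : tree T -> tree H.
Proof.
move=> trT; have [T0 conT _] := trT; have conH := subdivide_connected conT.
have /card_gt0P[r _] := T0.
split => //; first by apply/card_gt0P; exists (inl r).
pose K := (\max_e seg k e).+1.
have ltK x y j : adj x y -> j <= k x y -> j < K.
  move=> xy; wlog lt : x y xy / enum_rank x < enum_rank y.
    move=> hw jk; have yx : adj y x by rewrite adj_sym.
    have [lt|nlt] := boolP (enum_rank x < enum_rank y); first exact: (hw x y).
    by apply: (hw y x); [|rewrite rank_neq|rewrite ksym].
  rewrite -seg_fwd // ltnS => le; apply: leq_trans le _.
  exact: (leq_bigmax (F := seg k) (x, y)).
pose d x := dist x r.
pose h (a : H) := match a with
  | inl x => K * d x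
  | inr s => let e := tag s in
      if d e.1 < d e.2 then K * d e.1 + (tagged s).+1
      else K * d e.2 + (seg k e - tagged s)
  end.
have hpt x y j : adj x y -> d y = (d x).+1 -> j <= k x y -> h (pt x y j) = K * d x + j.
  move=> xy dxy jk; have [->|j0] := posnP j; first by rewrite pt0 //= addn0.
  have yx : adj y x by rewrite adj_sym.
  have jk' : 0 < j <= k x y by rewrite j0.
  have [lt|nlt] := boolP (enum_rank x < enum_rank y).
    have [lt' -> _] := pt_fwd xy lt jk'; rewrite segptE /= dxy ltnSn.
    by rewrite prednK.
  have lt : enum_rank y < enum_rank x by rewrite rank_neq.
  have jk2 : 0 < (k x y).+1 - j <= k y x by rewrite (ksym y); lia.
  rewrite -pt_rev // 1?ltnW //; have [lt' -> _] := pt_fwd yx lt jk2.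
  rewrite segptE /= dxy ltnNge leqnSn /= seg_fwd // (ksym y).
  by congr (_ + _); lia.
have hend x y : adj x y -> d y = (d x).+1 -> h (pt x y (k x y).+1) = K * d x + K.
  by move=> xy dxy; rewrite pt_end //= dxy mulnS addnC.
have hlt x y j : adj x y -> d y = (d x).+1 -> j <= k x y -> h (pt x y j) < h (pt x y j.+1).
  move=> xy dxy jk; rewrite hpt //; move: jk; rewrite leq_eqVlt => /orP[/eqP ->|jk].
    by rewrite hend // ltn_add2l (ltK x y).
  by rewrite hpt // addnS.
have orient (a b : H) : adj a b -> exists x y j, [/\ adj x y, d y = (d x).+1, j <= k x y &
    (a = pt x y j /\ b = pt x y j.+1) \/ (b = pt x y j /\ a = pt x y j.+1)].
  case/edgeP=> x [y [j [xy jk ea eb]]].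
  case: (tree_dist_step trT r xy) => e; last by exists x, y, j; split => //; left.
  exists y, x, (k x y - j); rewrite adj_sym (ksym y) leq_subr; split => //.
  by right; rewrite ea eb; case: (pt_flip xy jk).
have low (a b : H) : adj a b -> h b < h a -> exists x y j,
    [/\ adj x y, d y = (d x).+1, j <= k x y, b = pt x y j & a = pt x y j.+1].
  case/orient=> x [y [j [xy dxy jk [[-> ->]|[-> ->]]]]] lt; last by exists x, y, j.
  by have := hlt _ _ _ xy dxy jk; lia.
apply: (@acyclic_potential _ h) => [a b|a b c].
  case/orient=> x [y [j [xy dxy jk [[-> ->]|[-> ->]]]]];
  by have := hlt _ _ _ xy dxy jk; lia.
move=> ab ac lb lc.
have [x [y [j [xy dxy jk -> ea]]]] := low _ _ ab lb.
have [x' [y' [j' [xy' dxy' jk' -> ea']]]] := low _ _ ac lc.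
move: ea'; rewrite ea; move: jk; rewrite leq_eqVlt => /orP[/eqP ej|jk].
  move: jk'; rewrite leq_eqVlt => /orP[/eqP ej'|jk']; last first.
    by rewrite ej pt_end // => /esym/pt_neq_inl[].
  rewrite ej ej' !pt_end // => -[ey].
  suff -> : x = x' by rewrite ey.
  apply: (@tree_closer_uniq _ trT y _ _ r); rewrite 1?adj_sym // -/(d _).
  - by rewrite ey.
  - by rewrite -[dist y r]/(d y) dxy.
  by rewrite ey -[dist y' r]/(d y') dxy'.
move: jk'; rewrite leq_eqVlt => /orP[/eqP ej'|jk'].
  by rewrite ej' (pt_end xy') // => /pt_neq_inl[].
case/(pt_eq xy xy') => // [[-> -> [->]] //|[ex ey _]].
by move: dxy'; rewrite ex ey dxy; lia.
Qed.

(** Doubling lets the sum run over ordered pairs, so that the later counts need no orientation of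
    the edges. *)
Lemma card_subdivide :
  2 * #|H| = 2 * #|T| + \sum_(e : T * T | adj e.1 e.2) k e.1 e.2.
Proof.
have -> : #|H| = #|T| + \sum_e seg k e.
  rewrite card_sum card_tagged; congr (_ + _).
  by rewrite sumnE big_map big_enum; apply: eq_bigr => e _; rewrite card_ord.
rewrite mulnDr; congr (_ + _).
rewrite [RHS](bigID (fun e : T * T => enum_rank e.1 < enum_rank e.2)) /=.
have -> : \sum_e seg k e =
    \sum_(e : T * T | adj e.1 e.2 && (enum_rank e.1 < enum_rank e.2)) k e.1 e.2.
  by rewrite [RHS]big_mkcond /=; apply: eq_bigr => e _; rewrite /seg.
rewrite mul2n -addnn; congr (_ + _).
rewrite [RHS](reindex_inj (h := fun e : T * T => (e.2, e.1))) /=; last by move=> [a b] [c d] [-> ->].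
apply: eq_big => [[x y]|[x y] _] /=; last by rewrite ksym.
rewrite (adj_sym y); case: (boolP (adj x y)) => //= xy.
by rewrite (rank_neq xy).
Qed.

End Subdivision.

(** * Suppressing vertices of degree two *)

Section Through.
Variable G : sgraph.
Implicit Types (a b c d : G) (s : seq G).

Definition deg2 a := deg a == 2.

(** The condition is on the vertex being left: a walk from a goes through vertices of degree two but
    may end anywhere. As a reachability statement this passes through subdivisions in both
    directions; [tp] is the actual path. *)
Definition thr_rel a : rel G := fun u v => adj u v && ((u == a) || deg2 u).

Definition thr a b := connect (thr_rel a) a b.

(* s is the interior of a path from a to b all of whose inner vertices have
   degree two. *)
Definition tp a s b := [&& path (@adj G) a (rcons s b), uniq (a :: rcons s b) & all deg2 s].

Lemma tp_rev a s b : tp a s b -> tp b (rev s) a.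
Proof.
case/and3P=> ps us ds; apply/and3P; split; last by rewrite all_rev.
  rewrite -rev_cons -(belast_rcons a s b) -{1}(last_rcons a s b) rev_path.
  by apply: sub_path ps => u v; rewrite adj_sym.
by rewrite -rev_cons -rev_rcons rev_uniq rcons_cons.
Qed.

Lemma thr_tp a b : a != b -> thr a b -> exists s, tp a s b.
Proof.
move=> nab /connectP[p0 ap0]; case/shortenP: ap0 => p ap up _ eb.
case/lastP: p ap up eb => [_ _ e|s b' ap up]; first by rewrite e eqxx in nab.
rewrite last_rcons => ->; exists s; apply/and3P; split => //.
  by apply: sub_path ap => u v /andP[].
apply/allP => u us; move: ap up; case/splitPr: us => s1 s2.
rewrite rcons_cat rcons_cons cat_path /= => /and3P[_ _].
move=> pu /andP[na _]; have : (u == a) || deg2 u.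
  by case: s2 pu {na} => [|w s2] /= /andP[/andP[_ ->]].
by case/orP=> // /eqP e; move: na; rewrite mem_cat e mem_head orbT.
Qed.

Lemma deg2_uniq c a d d' : deg2 c -> adj c a -> adj c d -> adj c d' ->
  d != a -> d' != a -> d = d'.
Proof.
move=> /eqP dc ca cd cd' da da'; apply/eqP; apply/negPn/negP => dd'.
have : #|[set a; d; d']| <= deg c.
  by apply: subset_leq_card; apply/subsetP => z; rewrite !inE -orbA => /or3P[]/eqP->.
rewrite dc setUC cardsU1 cards2 !inE (eq_sym a) da.
by rewrite (negbTE da') eq_sym (negbTE dd').
Qed.

Lemma tp_head a s b : tp a s b -> adj a (head b s) /\ head b s != a.
Proof.
case/and3P => ps us _; have : adj a (head b s) by case: s ps {us} => [|c s] /= /andP[].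
by move=> ah; split => //; rewrite eq_sym adj_neq.
Qed.

Lemma tp_behead a c s b : tp a (c :: s) b -> [/\ tp c s b, adj a c, deg2 c & head b s != a].
Proof.
case/and3P => /= /andP[ac ps] /andP[na us] /andP[dc ds]; split => //; first exact/and3P.
apply: contraNneq na => <-; rewrite inE.
by case: s {ps us ds} => [|d s] /=; rewrite inE eqxx ?orbT.
Qed.

(** At a vertex of degree two the continuation is forced, and both paths must stop at the first
    vertex of another degree. *)
Lemma tp_det a s b s' b' : tp a s b -> tp a s' b' -> ~~ deg2 b -> ~~ deg2 b' ->
  head b s = head b' s' -> s = s' /\ b = b'.
Proof.
elim: s s' a => [|c s IH] [|c' s'] a ts ts' db db' //=.
- by move=> eb; case/tp_behead: ts' => _ _; rewrite -eb (negbTE db).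
- by move=> eb; case/tp_behead: ts => _ _; rewrite eb (negbTE db').
move=> ec; case/tp_behead: ts => ts ac dc ha; case/tp_behead: ts' => ts' _ _ ha'.
rewrite -ec in ts'; have [ch _] := tp_head ts; have [ch' _] := tp_head ts'.
case: (IH _ _ ts ts') => // [|-> ->]; last by rewrite ec.
by apply: (deg2_uniq dc _ ch ch' ha ha'); rewrite adj_sym.
Qed.

Lemma interior_deg a s b v : path (@adj G) a (rcons s b) -> uniq (a :: rcons s b) ->
  v \in s -> 2 <= deg v.
Proof.
move=> ps us vs; move: ps us; case/splitPr: vs => s1 s2.
rewrite rcons_cat rcons_cons cat_path /= => /and3P[_ av pv] /andP[na us].
have vh : adj v (head b s2) by case: s2 pv {us na} => [|d s2] /= /andP[].
have nh : last a s1 != head b s2.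
  have : uniq ((a :: s1) ++ v :: rcons s2 b) by rewrite /= na us.
  rewrite cat_uniq => /and3P[_ /hasPn nh _].
  have : head b s2 \notin a :: s1.
    by apply: nh; case: (s2) => [|d s3] /=; rewrite !inE eqxx ?orbT.
  by apply: contraNneq => <-; exact: mem_last.
apply: (@leq_trans #|[set last a s1; head b s2]|); first by rewrite cards2 nh.
apply: subset_leq_card; apply/subsetP => z; rewrite !inE => /orP[]/eqP-> //.
by rewrite adj_sym.
Qed.

End Through.

(** * Lifting paths to a subdivision *)

Section Expand.
Variables (G : sgraph) (k : G -> G -> nat).
Hypothesis ksym : forall x y, k x y = k y x.
Local Notation H := (subdivide k).
Implicit Types (a b c d u v : G) (s : seq G).

Definition ext a b : seq H := mkseq (fun j => pt k a b j.+1) (k a b).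

Fixpoint expand a s b : seq H :=
  if s is c :: s' then ext a c ++ inl c :: expand c s' b else ext a b.

Lemma mem_ext a b z : z \in ext a b -> exists2 j, 0 < j <= k a b & z = pt k a b j.
Proof. by case/mapP=> j; rewrite mem_iota => /andP[_ jk] ->; exists j.+1. Qed.

Lemma ext_path a b : adj a b -> path (@adj H) (inl a) (rcons (ext a b) (inl b)).
Proof.
move=> ab; apply/(pathP (inl a)) => j; rewrite size_rcons size_mkseq ltnS => jk.
have e i : i <= k a b -> nth (inl a) (rcons (ext a b) (inl b)) i = pt k a b i.+1.
  move=> ik; rewrite nth_rcons size_mkseq; case: ltngtP ik => // [ik _|-> _].
    by rewrite nth_mkseq.
  by rewrite pt_end.
rewrite e //; have := pt_adj ksym ab jk; case: j jk => [|j] jk; first by rewrite pt0.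
by rewrite -[nth _ (_ :: _) _]/(nth (inl a) (rcons (ext a b) (inl b)) j) e // ltnW.
Qed.

Lemma ext_uniq a b : adj a b -> uniq (ext a b).
Proof.
move=> ab; rewrite map_inj_in_uniq ?iota_uniq // => i j.
by rewrite !mem_iota => /andP[_ ik] /andP[_ jk] /(pt_inj ksym ab) e; have := e; lia.
Qed.

Lemma ext_deg2 a b : adj a b -> all (@deg2 H) (ext a b).
Proof.
move=> ab; apply/allP => z /mem_ext[j jk ->]; by rewrite /deg2 deg_pt.
Qed.

Lemma mem_expand a s b z : path (@adj G) a (rcons s b) ->
  z \in inl a :: rcons (expand a s b) (inl b) ->
  (exists2 v, v \in a :: rcons s b & z = inl v) \/
  (exists u v j, [/\ adj u v, 0 < j <= k u v, u \in a :: rcons s b, v \in a :: rcons s b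
     & z = pt k u v j]).
Proof.
elim: s a => [|c s IH] a /= /andP[ac ps]; rewrite inE => /orP[/eqP ->|].
- by left; exists a; rewrite ?mem_head.
- rewrite mem_rcons inE => /orP[/eqP ->|/mem_ext[j jk ->]].
    by left; exists b; rewrite // !inE eqxx orbT.
  by right; exists a, b, j; rewrite !inE !eqxx orbT.
- by left; exists a; rewrite ?mem_head.
rewrite rcons_cat mem_cat => /orP[/mem_ext[j jk ->]|].
  by right; exists a, c, j; rewrite !inE !eqxx orbT.
rewrite rcons_cons => /(IH _ ps)[[v vc ->]|[u [v [j [uv jk uc vc ->]]]]].
  by left; exists v; rewrite // inE vc orbT.
by right; exists u, v, j; rewrite uv jk !(in_cons a) uc vc !orbT.
Qed.

Lemma tp_expand a s b : tp a s b -> tp (inl a : H) (expand a s b) (inl b).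
Proof.
elim: s a => [|c s IH] a ts.
  case/and3P: ts => /= /andP[ab _] _ _; apply/and3P; split; last exact: ext_deg2.
    exact: ext_path.
  have nab := adj_neq ab.
  rewrite /= rcons_uniq ext_uniq // andbT mem_rcons inE negb_or.
  have ni x : inl x \notin ext a b.
    by apply/negP => /mem_ext[j jk] /esym/pt_neq_inl; case.
  by rewrite !ni !andbT; apply: contra nab => /eqP[->].
have /tp_behead[ts' ac dc _] := ts; have /and3P[ps us ds] := IH c ts'.
case/and3P: ts' => ps' us' _; case/and3P: ts => _ /andP[na _] _.
apply/and3P; split.
- rewrite /= rcons_cat cat_path rcons_cons /=.
  have := ext_path ac; rewrite rcons_path => /andP[e1 e2].
  exact/and3P.
- have sep z : z \in inl c :: rcons (expand c s b) (inl b) -> z != inl a /\ z \notin ext a c.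
    case/(mem_expand ps') => [[v vc ->]|[u [v [j [uv jk uc vc ->]]]]]; split.
    + by apply: contra na => /eqP[<-].
    + by apply/negP => /mem_ext[j jk] /esym/pt_neq_inl; case.
    + by apply/eqP => /pt_neq_inl; case.
    apply/negP => /mem_ext[i ik] /(pt_eq ksym uv ac jk ik) [] [e1 e2 _].
      by move: na; rewrite e1 uc.
    by move: na; rewrite e1 vc.
  rewrite -[expand _ _ _]/(ext a c ++ inl c :: expand c s b) rcons_cat rcons_cons.
  rewrite cons_uniq cat_uniq ext_uniq // us andbT mem_cat negb_or -andbA.
  apply/and3P; split.
  + by apply/negP => /mem_ext[j jk] /esym/pt_neq_inl; case.
  + by apply/negP => /sep[]; rewrite eqxx.
  by apply/hasPn => z /sep[].
by rewrite /= all_cat ext_deg2 //= ds andbT /deg2 deg_inl.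
Qed.

Lemma size_expand (q : nat -> G) n :
  size (expand (q 0) (mkseq (fun j => q j.+1) n) (q n.+1)) =
  n + \sum_(j < n.+1) k (q j) (q j.+1).
Proof.
elim: n q => [|n IH] q; first by rewrite /= size_mkseq big_ord_recl big_ord0 addn0.
rewrite /mkseq /= (iotaDl 1 0) -map_comp size_cat size_mkseq /=.
have := IH (fun j => q j.+1); rewrite /mkseq => ->.
rewrite -(big_mkord xpredT (fun j => k (q j.+1) (q j.+2))).
rewrite -(big_mkord xpredT (fun j => k (q j) (q j.+1))) [in RHS]big_nat_recl //=.
by rewrite addnS addSn addnCA.
Qed.

End Expand.

(** * Recognising the subdivisions of an irreducible tree *)

Section Reduct.
Variable T : sgraph.
Hypothesis hirr : homeo_irreducible T.

(* Suppressing the vertices of degree two of G leaves T; unlike the relation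
   insertion, this can be followed in both directions. *)
Definition reduct (G : sgraph) := exists phi : T -> G,
  [/\ injective phi, forall x, deg (phi x) = deg x
    & forall x y, adj x y -> thr (phi x) (phi y)].

Lemma reduct_iso G H : iso G H -> reduct G -> reduct H.
Proof.
case=> f fb fadj [phi [pinj pdeg pthr]]; exists (f \o phi); split.
- exact: inj_comp (bij_inj fb) pinj.
- by move=> x /=; rewrite iso_deg.
move=> x y /pthr /connectP[p px ep]; apply/connectP; exists (map f p).
  rewrite /= path_map; apply: sub_path px => u v /andP[uv h] /=.
  by rewrite /thr_rel fadj uv /deg2 iso_deg // (bij_eq fb).
exact: etrans (congr1 f ep) (esym (last_map f p (phi x))).
Qed.

Lemma thr_subdivide (G : sgraph) (k : G -> G -> nat) a b :
  (forall u v, k u v = k v u) ->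
  thr a b <-> thr (inl a : subdivide k) (inl b).
Proof.
move=> ksym; split.
  have step u v : thr_rel a u v -> connect (@thr_rel (subdivide k) (inl a)) (inl u) (inl v).
    case/andP=> uv du; rewrite -(pt_end ksym uv).
    have : (k u v).+1 <= (k u v).+1 by []; move: {1 3}((k u v).+1) => j.
    elim: j => [|j IH] jk; first by rewrite pt0.
    apply: connect_trans (IH (ltnW jk)) (connect1 _).
    rewrite /thr_rel pt_adj //=; case: (posnP j) => [->|j0].
      by rewrite pt0 // /deg2 deg_inl.
    by rewrite /deg2 deg_pt ?eqxx ?orbT // j0.
  suff walk p u : path (thr_rel a) u p ->
      connect (@thr_rel (subdivide k) (inl a)) (inl u) (inl (last u p)).
    by case/connectP=> p ap ->; exact: walk.
  elim: p u => //= v p IH u /andP[uv pv].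
  exact: connect_trans (step _ _ uv) (IH _ pv).
pose C v := connect (thr_rel a) a v.
(* Invariant of a walk in the subdivision: it stands on a vertex reached in G, or inside an edge
   entered from a reached vertex that may be left. Turning back or going on both end at a reached
   vertex. *)
pose inv (z : subdivide k) := (exists2 v, z = inl v & C v) \/
  exists u v j, [/\ adj u v, 0 < j <= k u v, z = pt k u v j, C u & (u == a) || deg2 u].
have hinv z z' : inv z -> @thr_rel (subdivide k) (inl a) z z' -> inv z'.
  case=> [[v -> cv]|[u [v [j [uv jk -> cu du]]]]] /andP[zz' dz].
    have dv : (v == a) || deg2 v by move: dz; rewrite /deg2 deg_inl.
    case/(adj_inl ksym): zz' => y vy ->; have [k0|k0] := posnP (k v y).
      left; exists y; first by have := pt_end ksym vy; rewrite k0.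
      by apply: connect_trans cv (connect1 _); rewrite /thr_rel vy.
    by right; exists v, y, 1.
  case/(adj_pt ksym uv jk): zz' => ->.
    have [j0|j0] := posnP j.-1; first by left; exists u; rewrite // j0 pt0.
    by right; exists u, v, j.-1; split => //; lia.
  have [ej|nj] := eqVneq j (k u v); last by right; exists u, v, j.+1; split => //; lia.
  left; exists v; first by rewrite ej pt_end.
  by apply: connect_trans cu (connect1 _); rewrite /thr_rel uv.
have walk p z : inv z -> path (@thr_rel (subdivide k) (inl a)) z p -> inv (last z p).
  elim: p z => //= z' p IH z iz /andP[zz' pz'].
  exact: IH (hinv _ _ iz zz') pz'.
case/connectP=> p ap eb; have : inv (last (inl a) p).
  by apply: walk ap; left; exists a => //; exact: connect0.
rewrite -eb; case=> [[v [->]] //|[u [v [j [uv jk]]]]].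
by move/esym/pt_neq_inl; case.
Qed.

Lemma reduct_subdivide (G : sgraph) (k : G -> G -> nat) :
  (forall u v, k u v = k v u) -> reduct G <-> reduct (subdivide k).
Proof.
move=> ksym; split=> [[phi [pinj pdeg pthr]]|[phi [pinj pdeg pthr]]].
  exists (fun x => inl (phi x)); split; first by move=> x y [/pinj].
    by move=> x; rewrite deg_inl.
  by move=> x y /pthr/(thr_subdivide _ _ ksym).
(* Inserted vertices have degree two; [phi] keeps degrees and T has no vertex of degree two, so
   [phi] only meets old vertices. *)
have /fin_all_exists[psi hpsi] x : exists u, phi x = inl u.
  case: (vertexP (phi x)) => // -[u [v [j [uv jk e]]]].
  by case: (@hirr x); rewrite -pdeg e deg_pt.
exists psi; split.
- by move=> x y e; apply: pinj; rewrite !hpsi e.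
- by move=> x; rewrite -pdeg hpsi deg_inl.
by move=> x y /pthr; rewrite !hpsi => /(thr_subdivide _ _ ksym).
Qed.

(** The chain from T to G may insert and delete in any order, through graphs of unknown shape; hence
    each single step is shown to preserve [reduct] in both directions. *)
Lemma homeomorphic_reduct G : homeomorphic T G -> reduct G.
Proof.
have rT : reduct T.
  by exists id; split => // x y xy; apply: connect1; rewrite /thr_rel xy eqxx.
suff E A B : homeomorphic A B -> reduct A <-> reduct B by move/E => [+ _]; apply.
elim=> {A B G} [A B [k [ksym _ iAB]]|A|A B _ [h1 h2]|A B C _ [h1 h2] _ [h3 h4]] //.
  have [h1 h2] := reduct_subdivide ksym; split=> [/h1|rB]; first exact: reduct_iso.
  by apply: h2; apply: reduct_iso rB; exact: iso_sym.
by split; auto.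
Qed.

(** Sending the inserted vertices of xy along the path [S x y] preserves degrees and is locally
    injective, hence an isomorphism by [covering_iso]. That the paths are disjoint and exhaust G
    never has to be checked. *)
Lemma subdivide_of_paths (G : sgraph) (k : T -> T -> nat) (phi : T -> G)
    (S : T -> T -> seq G) (x0 : T) :
  connected T -> tree G -> (forall x y, k x y = k y x) ->
  injective phi -> (forall x, deg (phi x) = deg x) ->
  (forall x y, adj x y -> tp (phi x) (S x y) (phi y) /\ size (S x y) = k x y) ->
  iso (subdivide k) G.
Proof.
move=> conT trG ksym pinj pdeg hS0.
(* The paths given for xy and yx may be unrelated; one of them is used in both directions. *)
pose S' x y := if enum_rank x < enum_rank y then S x y else rev (S y x).
have hS x y : adj x y -> tp (phi x) (S' x y) (phi y) /\ size (S' x y) = k x y.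
  move=> xy; rewrite /S'; case: ifP => _; first exact: hS0.
  have yx : adj y x by rewrite adj_sym.
  by case: (hS0 _ _ yx) => /tp_rev t s; rewrite size_rev s ksym.
have S'rev x y : adj x y -> S' y x = rev (S' x y).
  by move=> xy; rewrite /S' (rank_neq xy); case: (_ < _); rewrite ?revK.
pose q x y j := nth (phi x) (phi x :: rcons (S' x y) (phi y)) j.
have qrev x y j : adj x y -> j <= (k x y).+1 -> q y x ((k x y).+1 - j) = q x y j.
  move=> xy jk; have [_ sz] := hS _ _ xy; rewrite /q S'rev //.
  have -> : phi y :: rcons (rev (S' x y)) (phi x) = rev (phi x :: rcons (S' x y) (phi y)).
    by rewrite rev_cons rev_rcons.
  rewrite nth_rev /= ?size_rcons ?sz; last by rewrite ltnS leq_subr.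
  rewrite -subSn ?leq_subr // subKn; last exact: leqW.
  by apply: set_nth_default; rewrite /= size_rcons sz.
pose f (z : subdivide k) := match z with
  | inl x => phi x
  | inr s => q (tag s).1 (tag s).2 (tagged s).+1 end.
have fpt x y j : adj x y -> j <= (k x y).+1 -> f (pt k x y j) = q x y j.
  move=> xy jk.
  have [->|j0] := posnP j; first by rewrite pt0.
  move: jk; rewrite leq_eqVlt => /orP[/eqP ->|jk].
    rewrite pt_end // /q /= nth_rcons; case: (hS _ _ xy) => _ ->.
    by rewrite ltnn eqxx.
  have jk' : 0 < j <= k x y by rewrite j0.
  have [lt|nlt] := boolP (enum_rank x < enum_rank y).
    have [lt' -> _] := pt_fwd xy lt jk'; rewrite segptE /=.
    by rewrite prednK.
  have yx : adj y x by rewrite adj_sym.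
  have lt : enum_rank y < enum_rank x by rewrite rank_neq.
  have jk2 : 0 < (k x y).+1 - j <= k y x by rewrite (ksym y); lia.
  rewrite -pt_rev // 1?ltnW //; have [lt' -> _] := pt_fwd yx lt jk2.
  rewrite segptE -[LHS]/(q y x _.+1) prednK ?qrev //; last by case/andP: jk2.
  exact: ltnW.
have nd x : ~~ deg2 (phi x) by apply/eqP; rewrite pdeg; exact: hirr.
apply: (@covering_iso _ _ f (inl x0)) => //.
- exact: subdivide_connected.
- move=> a b /(edgeP ksym)[x [y [j [xy jk -> ->]]]].
  rewrite !fpt //; last exact: ltnW.
  have [/and3P[/(pathP (phi x)) ps _ _] sz] := hS _ _ xy.
  by have := ps j; rewrite size_rcons sz; apply.
- move=> a b c ab ac; case: (vertexP a) => [[x ea]|[x [y [j [xy jk ea]]]]].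
    rewrite ea in ab ac; have [y xy ->] := adj_inl ksym ab; have [y' xy' ->] := adj_inl ksym ac.
    rewrite !fpt //.
    have [ts sz] := hS _ _ xy; have [ts' sz'] := hS _ _ xy'.
    have qh u : q x u 1 = head (phi u) (S' x u) by rewrite /q; case: (S' x u).
    rewrite !qh => /(tp_det ts ts' (nd _) (nd _))[_ /pinj ->] //.
  have j12 : j.-1 <= (k x y).+1 /\ j.+1 <= (k x y).+1 by lia.
  have ne : q x y j.-1 <> q x y j.+1.
    have [/and3P[_ us _] sz] := hS _ _ xy.
    have lt1 : j.-1 < size (phi x :: rcons (S' x y) (phi y)) by rewrite /= size_rcons sz; lia.
    have lt2 : j.+1 < size (phi x :: rcons (S' x y) (phi y)) by rewrite /= size_rcons sz; lia.
    by rewrite /q => /eqP; rewrite (nth_uniq _ lt1 lt2 us); lia.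
  rewrite ea in ab ac.
  by case: (adj_pt ksym xy jk ab) => ->; case: (adj_pt ksym xy jk ac) => ->;
    rewrite ?fpt //; case: j12 => // _ _ e; case: ne.
move=> a; case: (vertexP a) => [[x ->]|[x [y [j [xy jk ->]]]]]; first exact: etrans (pdeg x) (esym (deg_inl ksym x)).
rewrite deg_pt // fpt //; last by lia.
have [/and3P[_ _ /allP ds] sz] := hS _ _ xy; apply/eqP/ds; rewrite /q.
case: j jk => // j jk /=; rewrite nth_rcons sz; case/andP: jk => _ jk.
by rewrite jk mem_nth // sz.
Qed.

Lemma reduct_subdivision (G : sgraph) (x0 : T) : connected T -> tree G -> reduct G ->
  exists k : T -> T -> nat, (forall x y, k x y = k y x) /\ iso (subdivide k) G.
Proof.
move=> conT trG [phi [pinj pdeg pthr]].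
have /fin_all_exists[S0 hS0] (e : T * T) :
    exists s, adj e.1 e.2 -> tp (phi e.1) s (phi e.2).
  case: (boolP (adj e.1 e.2)) => [xy|_]; last by exists [::].
  have [|s ts] := thr_tp _ (pthr _ _ xy); last by exists s.
  by rewrite (inj_eq pinj) adj_neq.
pose S x y := if enum_rank x < enum_rank y then S0 (x, y) else rev (S0 (y, x)).
exists (fun x y => if adj x y then size (S x y) else 0); split.
  move=> x y; rewrite (adj_sym x); case: ifP => // yx.
  by rewrite /S (rank_neq yx); case: (_ < _) => /=; rewrite size_rev.
apply: (subdivide_of_paths (phi := phi) (S := S)) => //.
  move=> x y; rewrite (adj_sym x); case: ifP => // yx.
  by rewrite /S (rank_neq yx); case: (_ < _) => /=; rewrite size_rev.
move=> x y xy; rewrite xy; split => //; rewrite /S.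
case: ifP => _; first exact: (hS0 (x, y)).
by apply/tp_rev/(hS0 (y, x)); rewrite adj_sym.
Qed.

End Reduct.

(** * The two stages *)

Section Stages.
Variable T : sgraph.
Hypotheses (trT : tree T) (hirr : homeo_irreducible T) (brT : 0 < #|Vbr T|).
Implicit Types (x y z u v : T).

Let conT : connected T. Proof. by case: trT. Qed.

Lemma br_exists : exists b : T, branch b.
Proof. by case/card_gt0P: brT => b; rewrite inE; exists b. Qed.

Lemma leafE x : leaf x = ~~ branch x.
Proof.
suff : deg x != 0 by have := @hirr x; rewrite /leaf /branch; lia.
have [b bb] := br_exists; have [->|nxb] := eqVneq x b.
  by move: bb; rewrite /branch; lia.
have [y [xy _]] := dist_closer conT nxb.
by rewrite -lt0n; apply/card_gt0P; exists y; rewrite inE.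
Qed.

(** Two adjacent leaves would form a whole component, but T is connected and has a branch vertex. *)
Lemma leaf_nbr x y : adj x y -> leaf x -> branch y.
Proof.
move=> xy lx; have one z : adj x z -> z = y.
  move=> xz; apply/eqP; apply/negPn/negP => zy.
  have : #|[set z; y]| <= deg x.
    by apply: subset_leq_card; apply/subsetP => w; rewrite !inE => /orP[]/eqP->.
  by rewrite cards2 zy (eqP lx).
have [b bb] := br_exists; have [exb|nxb] := eqVneq x b.
  by move: lx; rewrite leafE exb bb.
have [z [xz dz]] := dist_closer conT nxb; rewrite (one _ xz) in dz.
have [-> //|nyb] := eqVneq y b; have [w [yw dw]] := dist_closer conT nyb.
apply: contraT; rewrite -leafE => ly; have : w = x; last by move=> e; move: dw; rewrite e; lia.
apply/eqP; apply/negPn/negP => wx; have : #|[set w; x]| <= deg y.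
  by apply: subset_leq_card; apply/subsetP => u; rewrite !inE => /orP[]/eqP->; rewrite // adj_sym.
by rewrite cards2 wx; move: ly; rewrite /leaf => /eqP ->.
Qed.

Section TwoStages.
Variable k1 : T -> T -> nat.
Hypothesis k1sym : forall x y, k1 x y = k1 y x.
Local Notation H := (subdivide k1).
Local Notation pt := (pt k1).

Lemma leaf_inl x : leaf (inl x : H) = ~~ branch x.
Proof. by rewrite -leafE /leaf deg_inl. Qed.

Lemma branch_inl x : branch (inl x : H) = branch x.
Proof. by rewrite /branch deg_inl. Qed.

Lemma pt_edge_eq x y X Y j i : adj x y -> adj X Y -> j <= k1 x y -> i <= k1 X Y ->
  pt X Y i = pt x y j -> pt X Y i.+1 = pt x y j.+1 -> [/\ X = x, Y = y & i = j].
Proof.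
move=> xy XY jk ik; have [->|j0] := posnP j.
  rewrite pt0 //; have [->|i0] := posnP i; last by move/pt_neq_inl; case=> //; rewrite i0.
  rewrite pt0 // => -[eX]; rewrite eX in XY *; by move/(pt1_inj k1sym XY xy).
have [->|i0] := posnP i; first by rewrite pt0 // => /esym/pt_neq_inl[]//; rewrite j0.
have jk' : 0 < j <= k1 x y by rewrite j0.
have ik' : 0 < i <= k1 X Y by rewrite i0.
case/esym/(pt_eq k1sym xy XY jk' ik') => [[-> -> ->] //|[eX eY ei]].
rewrite eX eY ei -subSn ?leqW // -(@prednK j) // subSS.
rewrite pt_rev //; last by lia.
by move/(pt_inj k1sym xy); lia.
Qed.

Lemma pt_edge_mem x y X Y j i : adj x y -> adj X Y -> j <= k1 x y -> i <= k1 X Y ->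
  ((pt X Y i, pt X Y i.+1) \in [:: (pt x y j, pt x y j.+1); (pt x y j.+1, pt x y j)]) =
  ((X, Y) == (x, y)) && (j == i) || ((X, Y) == (y, x)) && (j == k1 x y - i).
Proof.
move=> xy XY jk ik; rewrite !inE !xpair_eqE.
have yx : adj y x by rewrite adj_sym.
have [f1 f2] := pt_flip k1sym xy jk.
have jk2 : k1 x y - j <= k1 y x by rewrite (k1sym y) leq_subr.
apply/idP/idP.
  case/orP=> /andP[/eqP e1 /eqP e2].
    by case: (pt_edge_eq xy XY jk ik e1 e2) => -> -> ->; rewrite !eqxx.
  rewrite f1 f2 in e1 e2.
  by case: (pt_edge_eq yx XY jk2 ik e1 e2) => -> -> ->; rewrite !eqxx subKn // eqxx orbT.
case/orP=> /andP[/andP[/eqP eX /eqP eY] /eqP ej]; subst X Y j.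
  by rewrite !eqxx.
have [g1 g2] := pt_flip k1sym yx ik; rewrite (k1sym y) in g1 g2 ik.
by rewrite g1 g2 !eqxx orbT.
Qed.

(** Inserting into a piece of a subdivided edge lengthens that edge of T, whichever piece it is. So
    both stages amount to one subdivision of T, in which only the carrying edge [e i] and not the
    piece [J i] is visible. *)
Lemma stage2_iso m (E : pred nat) (wt : nat -> nat) (f : nat -> H * H) (e : nat -> T * T)
    (J : nat -> nat) :
  (forall i, 1 <= i <= m -> E i ->
    [/\ adj (e i).1 (e i).2, J i <= k1 (e i).1 (e i).2 &
        f i \in [:: (pt (e i).1 (e i).2 (J i), pt (e i).1 (e i).2 (J i).+1);
                    (pt (e i).1 (e i).2 (J i).+1, pt (e i).1 (e i).2 (J i))]]) ->
  iso (subdivide (fun x y => k1 x y +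
         \sum_(1 <= i < m.+1 | E i && (e i \in [:: (x, y); (y, x)])) wt i))
      (subdivide (fun u v : H =>
         \sum_(1 <= i < m.+1 | E i && (f i \in [:: (u, v); (v, u)])) wt i)).
Proof.
move=> hf; set k3 := (X in iso (subdivide X)); set k2 := (X in iso _ (subdivide X)).
have swap (A : eqType) (a b : A) p : (p \in [:: (a, b); (b, a)]) = (p \in [:: (b, a); (a, b)]).
  by rewrite !inE orbC.
have k2sym (u v : H) : k2 u v = k2 v u.
  by apply: eq_bigl => i; rewrite swap.
have k3sym x y : k3 x y = k3 y x.
  by rewrite /k3 k1sym; congr (_ + _); apply: eq_bigl => i; rewrite swap.
have trH := subdivide_tree k1sym trT.
have [x0 _] := br_exists.
apply: (@subdivide_of_paths _ hirr (subdivide k2) k3 (fun x => inl (inl x))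
  (fun x y => expand k2 (inl x) (ext k1 x y) (inl y)) x0) => //.
- exact: subdivide_tree.
- by move=> x y [].
- by move=> x; rewrite !deg_inl.
move=> x y xy; split.
  apply: (tp_expand k2sym); apply: (tp_expand k1sym (s := [::])).
  by apply/and3P; split; rewrite //= ?xy // inE adj_neq.
rewrite -(pt0 k1sym xy) -(pt_end k1sym xy) size_expand /k3; congr (_ + _).
have k2E (u v : H) : k2 u v = \sum_(1 <= i < m.+1)
    (if E i && (f i \in [:: (u, v); (v, u)]) then wt i else 0) by exact: big_mkcond.
transitivity (\sum_(j < (k1 x y).+1) \sum_(1 <= i < m.+1)
    (if E i && (f i \in [:: (pt x y j, pt x y j.+1); (pt x y j.+1, pt x y j)])
     then wt i else 0)); first by apply: eq_bigr => j _; exact: k2E.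
rewrite exchange_big [RHS]big_mkcond /=; apply: eq_big_nat => i im.
case: (boolP (E i)) => [Ei|_]; last by rewrite big1.
have [ai Ji fi] := hf i im Ei; case: (e i) ai Ji fi => X Y /= XY Ji fi.
have fE (a b : H) : (f i \in [:: (a, b); (b, a)]) =
    ((pt X Y (J i), pt X Y (J i).+1) \in [:: (a, b); (b, a)]).
  by move: fi; rewrite !inE => /orP[]/eqP->; rewrite // !xpair_eqE orbC
    [in X in _ || X]andbC [in X in X || _]andbC.
have fE2 (j : 'I_(k1 x y).+1) : (f i \in [:: (pt x y j, pt x y j.+1); (pt x y j.+1, pt x y j)]) =
  ((X, Y) == (x, y)) && (j == J i :> nat) || ((X, Y) == (y, x)) && (j == k1 x y - J i :> nat).
  by rewrite fE pt_edge_mem // -ltnS.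
under eq_bigr => j _ do rewrite fE2.
(* An insertion sits on exactly one piece of its edge, so the sum over the pieces counts it once. *)
have one j0 : j0 <= k1 x y -> \sum_(j < (k1 x y).+1) (if j == j0 :> nat then wt i else 0) = wt i.
  by move=> j0k; rewrite -big_mkcond (big_pred1 (Ordinal (j0k : j0 < (k1 x y).+1))).
rewrite !inE; have [[eX eY]|n1] /= := eqVneq (X, Y) (x, y).
  rewrite -[RHS](one (J i)); last by rewrite -eX -eY.
  by apply: eq_bigr => j _; rewrite eX eY xpair_eqE (negbTE (adj_neq xy)) orbF.
have [[eX eY]|n2] /= := eqVneq (X, Y) (y, x); last by rewrite big1.
exact/one/leq_subr.
Qed.

(** Inner vertices have degree at least two and are not branch vertices, so the path is forced after
    its first step and follows one subdivided edge of T. *)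
Lemma simple_path_ends (a : H) p : branch a -> 0 < size p -> simple_path a p ->
    no_branch_between a p -> ~~ deg2 (last a p) ->
  exists X Y, [/\ a = inl X, adj X Y & p = rcons (ext k1 X Y) (inl Y)].
Proof.
move=> ba p0; case/lastP: p p0 => // s b _; rewrite last_rcons.
case/andP=> ps us; rewrite /no_branch_between /interior belast_rcons /= => nb db.
case: (vertexP a) => [[X ea]|[x [y [j [xy jk ea]]]]]; last first.
  by move: ba; rewrite /branch ea deg_pt.
case: (vertexP b) => [[Y eb]|[x [y [j [xy jk eb]]]]]; last first.
  by move: db; rewrite /deg2 eb deg_pt.
have ts : tp a s b.
  apply/and3P; split => //; apply/allP => v vs.
  have := interior_deg ps us vs; have /= := allP nb _ vs.
  by rewrite /branch /deg2; lia.
have [ah _] := tp_head ts; rewrite ea in ah; have [Z XZ eh] := adj_inl k1sym ah.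
have ts' : tp (inl X : H) (ext k1 X Z) (inl Z).
  apply: (tp_expand k1sym (s := [::])).
  by apply/and3P; split; rewrite //= ?XZ // inE adj_neq.
have dZ : ~~ deg2 (inl Z : H).
  by rewrite /deg2 deg_inl //; apply/negP => /eqP; exact: hirr.
rewrite ea in ts; case: (tp_det ts ts' db dZ) => [|-> ->].
- rewrite eh /ext; case: (posnP (k1 X Z)) => [k0|k0].
    by rewrite k0 /=; have := pt_end k1sym XZ; rewrite k0.
  by rewrite -(prednK k0).
by exists X, Z.
Qed.

Lemma zip_ext X Y (u v : H) : adj X Y ->
  ((u, v) \in zip (inl X :: rcons (ext k1 X Y) (inl Y)) (rcons (ext k1 X Y) (inl Y))) =
  [exists j : 'I_(k1 X Y).+1, (u, v) == (pt X Y j, pt X Y j.+1)].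
Proof.
move=> XY; set s := rcons _ _.
have sz : size s = (k1 X Y).+1 by rewrite size_rcons size_mkseq.
have es : s = mkseq (fun j => pt X Y j.+1) (k1 X Y).+1.
  by rewrite mkseqS /s pt_end.
have es0 : inl X :: s = mkseq (pt X Y) (k1 X Y).+2.
  rewrite es /mkseq -[in RHS]addn1 addnC iotaD /= pt0 //; congr (_ :: _).
  by congr (_ :: _); rewrite (iotaDl 1 1) -map_comp.
have ez : zip (inl X :: s) s = mkseq (fun j => (pt X Y j, pt X Y j.+1)) (k1 X Y).+1.
  apply: (@eq_from_nth _ (inl X, inl X)) => [|j].
    by rewrite size_zip size_mkseq /= sz; lia.
  rewrite size_zip /= sz => jk; have {}jk : j < (k1 X Y).+1 by lia.
  rewrite nth_zip_cond size_zip [size (_ :: _)]/= sz ifT; last by lia.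
  by rewrite es0 es !nth_mkseq // ltnW.
rewrite ez; apply/mapP/existsP => [[j]|[j /eqP ->]].
  by rewrite mem_iota => /andP[_ jk] ->; exists (Ordinal jk).
by exists (j : nat); rewrite // mem_iota /= ltn_ord.
Qed.

(** The clause [~~ branch Y || (k1 X Y != 0)] is the exclusion of internal paths of length one: the
    edge is an arm, or the first stage has put a vertex on it. *)
Lemma carrier_edge (a : H) p (u v : H) :
  arm a p || internal_path a p && (size p != 1) -> edge_of a p u v ->
  exists X Y j, [/\ adj X Y, branch X, j <= k1 X Y, ~~ branch Y || (k1 X Y != 0)
    & (u, v) \in [:: (pt X Y j, pt X Y j.+1); (pt X Y j.+1, pt X Y j)]].
Proof.
move=> hp he.
have [ba p0 sp nb db] : [/\ branch a, 0 < size p, simple_path a p, no_branch_between a p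
     & ~~ deg2 (last a p)].
  case/orP: hp => [/and4P[sp ba la nb]|/andP[/and5P[sp p0 ba bl nb] _]]; split => //.
  - by case: (p) la => //= la; move: ba; rewrite /branch (eqP la).
  - by rewrite /deg2 (eqP la).
  by rewrite /deg2; move: bl; rewrite /branch; lia.
have [X [Y [ea XY ep]]] := simple_path_ends ba p0 sp nb db.
have bX : branch X by move: ba; rewrite ea /branch deg_inl.
have : exists j : 'I_(k1 X Y).+1,
    (u, v) \in [:: (pt X Y j, pt X Y j.+1); (pt X Y j.+1, pt X Y j)].
  move: he; rewrite /edge_of ea ep !zip_ext // => /orP[]/existsP[j /eqP[-> ->]]; exists j;
  by rewrite !inE !eqxx ?orbT.
case=> j hj; exists X, Y, j; split => //; first by rewrite -ltnS.
case/orP: hp => [/and4P[_ _ + _]|/andP[_]].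
  by rewrite ep last_rcons leaf_inl => ->.
by rewrite ep size_rcons size_mkseq eqSS => ->; rewrite orbT.
Qed.

Lemma edge_carrier X Y : adj X Y -> branch X -> ~~ branch Y || (k1 X Y != 0) ->
  exists (a : H) p, (arm a p || internal_path a p && (size p != 1)) /\
    edge_of a p (pt X Y 0) (pt X Y 1).
Proof.
move=> XY bX hY; exists (inl X), (rcons (ext k1 X Y) (inl Y)).
have /and3P[ps us ds] : tp (inl X : H) (ext k1 X Y) (inl Y).
  apply: (tp_expand k1sym (s := [::])).
  by apply/and3P; split; rewrite //= ?XY // inE adj_neq.
split; last first.
  by rewrite /edge_of zip_ext //; apply/orP; left; apply/existsP; exists ord0.
have sp : simple_path (inl X : H) (rcons (ext k1 X Y) (inl Y)) by apply/andP.
have nb : no_branch_between (inl X : H) (rcons (ext k1 X Y) (inl Y)).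
  rewrite /no_branch_between /interior belast_rcons /=.
  by apply: sub_all ds => z /eqP; rewrite /= /branch => ->.
have ba : branch (inl X : H) by rewrite /branch deg_inl.
rewrite /arm /internal_path sp nb ba last_rcons size_rcons size_mkseq eqSS /=.
rewrite leaf_inl branch_inl.
by case: (branch Y) hY => //= ->.
Qed.

End TwoStages.

End Stages.

(** * Labellings *)

Section Labelling.
Variable T : sgraph.
Implicit Types (x y z u v : T) (c s : T -> nat) (r : nat -> T).

(* An admissible sequence, seen as a map c from the branch vertices to block
   indices together with the roots r of the nonempty blocks; connectedness of
   the blocks is expressed by stepping towards the root. *)
Record labelling c r : Prop := Labelling {
  lab_pos : forall v, branch v -> 0 < c v;
  lab_rt : forall v, branch v -> branch (r (c v)) /\ c (r (c v)) = c v;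
  lab_up : forall v, branch v -> v <> r (c v) -> exists u,
    [/\ adj v u, branch u, c u = c v & dist v (r (c v)) = (dist u (r (c v))).+1] }.

Definition sg c r v := dist v (r (c v)) + c v.

Definition emp c i := [forall v : T, ~~ (branch v && (c v == i))].

(* xy is a half-edge leaving the block of x, towards a leaf or another block. *)
Definition bd c x y := [&& adj x y, branch x & ~~ branch y || (c x != c y)].

Definition st1 c s m x y :=
  if branch x && branch y then
    if c x == c y then 0 else 2 * m - (s x + s y)
  else if branch x && leaf y then m - s x - 1
  else if leaf x && branch y then m - s y - 1
  else 0.

(** The number of points of a path that a ball of radius [m - i] centred on it can cover. *)
Definition wt m i := 2 * (m - i) + 1.

(* The numbers of vertices inserted into the edges of T by both stages, where e i
   is the edge of T carrying the i-th insertion of the second stage. *)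
Definition lens c s m (E : pred nat) (e : nat -> T * T) x y :=
  st1 c s m x y +
  \sum_(1 <= i < m.+1 | E i && (e i \in [:: (x, y); (y, x)])) wt m i.

Lemma st1_sym c s m x y : st1 c s m x y = st1 c s m y x.
Proof.
rewrite /st1 andbC (eq_sym (c x)) (addnC (s x)).
have lb z : leaf z -> branch z = false by rewrite /leaf /branch => /eqP ->.
case bx: (branch x); case by_: (branch y) => //=; rewrite ?andbF ?andbT /=;
  case lx: (leaf x); case ly: (leaf y) => //=;
  by move: (lb x); move: (lb y); rewrite lx ly bx by_ => h1 h2; rewrite ?h1 ?h2; auto.
Qed.

Lemma lens_sym c s m E e x y : lens c s m E e x y = lens c s m E e y x.
Proof.
by rewrite /lens st1_sym; congr (_ + _); apply: eq_bigl => i; rewrite !inE orbC.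
Qed.

Lemma empP c i : reflect (exists2 v, branch v & c v = i) (~~ emp c i).
Proof.
apply: (iffP forallPn) => [[v]|[v bv cv]].
  by rewrite negbK => /andP[bv /eqP cv]; exists v.
by exists v; rewrite negbK bv cv eqxx.
Qed.

Lemma emp_branch c i v : emp c i -> branch v -> c v != i.
Proof. by move/forallP/(_ v); case: (branch v). Qed.

Hypotheses (trT : tree T) (hirr : homeo_irreducible T) (brT : 0 < #|Vbr T|).

Let conT : connected T. Proof. by case: trT. Qed.

Lemma subdivide_ext (k k' : T -> T -> nat) :
  (forall x y, k x y = k y x) -> (forall x y, k' x y = k' y x) ->
  (forall x y, adj x y -> k x y = k' x y) -> iso (subdivide k) (subdivide k').
Proof.
move=> ksym ksym' kk'.
have [x0 _] := br_exists brT.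
apply: (@subdivide_of_paths _ hirr (subdivide k') k inl (ext k') x0) => //.
- exact: subdivide_tree.
- by move=> x y [].
- by move=> x; rewrite deg_inl.
move=> x y xy; rewrite size_mkseq kk' //; split => //.
apply: (tp_expand ksym' (s := [::])).
by apply/and3P; split; rewrite //= ?xy // inE adj_neq.
Qed.

Lemma lens_ext c s c' s' m (E E' : pred nat) e :
  (forall v, branch v -> c v = c' v) -> (forall v, branch v -> s v = s' v) ->
  (forall i, 0 < i -> E i = E' i) ->
  iso (subdivide (lens c s m E e)) (subdivide (lens c' s' m E' e)).
Proof.
move=> hc hs hE; apply: subdivide_ext; [exact: lens_sym|exact: lens_sym|].
move=> x y _; congr (_ + _).
  rewrite /st1; case bx: (branch x); case by_: (branch y) => /=; last by rewrite !andbF.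
  - by rewrite !hc // !hs.
  - by rewrite andbF (hs x bx).
  by rewrite (hs y by_).
rewrite big_nat_cond [RHS]big_nat_cond; apply: eq_bigl => i.
by case: (posnP i) => [->|i0] //; rewrite hE.
Qed.

Lemma lens_inblk c s m e x y :
  (forall i, 1 <= i <= m -> emp c i -> bd c (e i).1 (e i).2) ->
  branch x -> branch y -> c x = c y -> lens c s m (emp c) e x y = 0.
Proof.
move=> he bx by_ cxy; rewrite /lens /st1 bx by_ cxy eqxx /= big_nat_cond big_pred0 // => i.
case: (boolP (1 <= i < m.+1)) => //= im; case: (boolP (emp c i)) => //= ei.
have := he i im ei; case: (e i) => X Y /= /and3P[_ bX hY]; rewrite !inE !xpair_eqE.
by apply/negP => /orP[]/andP[/eqP eX /eqP eY]; move: hY;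
  rewrite eX eY ?by_ ?bx cxy eqxx.
Qed.

Lemma induced_lens (t : seq (option (rooted_subtree T))) m G :
  induced t m G -> (forall v, branch v -> sig t v < m) /\
  exists2 e, forall i, 1 <= i <= m -> blk t i = None -> bd (block_of t) (e i).1 (e i).2
    & iso (subdivide (lens (block_of t) (sig t) m (fun i => ~~ isSome (blk t i)) e)) G.
Proof.
case=> sigm [f [hf isoG]]; split => //.
have ksym : forall x y, stage1_ext t m x y = stage1_ext t m y x := st1_sym (block_of t) (sig t) m.
have /fin_all_exists[d hd] (i : 'I_m.+1) : exists d : T * T * nat,
    0 < i -> blk t i = None -> [/\ bd (block_of t) d.1.1 d.1.2,
      d.2 <= stage1_ext t m d.1.1 d.1.2 &
      f i \in [:: (pt (stage1_ext t m) d.1.1 d.1.2 d.2, pt (stage1_ext t m) d.1.1 d.1.2 d.2.+1);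
                  (pt (stage1_ext t m) d.1.1 d.1.2 d.2.+1, pt (stage1_ext t m) d.1.1 d.1.2 d.2)]].
  have [x0 _] := br_exists brT.
  have [i0|i0] := posnP i; first by exists (x0, x0, 0).
  case bi: (blk t i) => [R|]; first by exists (x0, x0, 0).
  have im : 1 <= i <= m by rewrite i0 -ltnS ltn_ord.
  have [a [p /andP[hp he]]] := hf i im bi.
  have [X [Y [j [XY bX jk hY hj]]]] := carrier_edge trT hirr brT ksym hp he.
  exists (X, Y, j) => _ _; split => //=.
    (* Between branch vertices of one block the first stage inserts nothing, so a positive length
       means different blocks. *)
    rewrite /bd XY bX /=; case/orP: hY => [->//|]; rewrite /stage1_ext bX /=.
    by case: (branch Y) => //=; case: (block_of t X == _).
exists (fun i => (d (inord i)).1).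
  move=> i /andP[i0 im] bi; case: (hd (inord i)); by rewrite ?inordK.
apply: iso_trans isoG.
apply: (@stage2_iso _ trT hirr brT _ ksym _ _ _ _ _ (fun i => (d (inord i)).2)) => i /andP[i0 im].
case bi: (blk t i) => //= _.
have {}im : i < m.+1 by [].
have := hd (inord i); rewrite inordK // => /(_ i0 bi)[h1 h2 h3]; split => //.
by case/and3P: h1.
Qed.

Lemma lens_induced (t : seq (option (rooted_subtree T))) m G e :
  (forall v, branch v -> sig t v < m) ->
  (forall i, 1 <= i <= m -> blk t i = None -> bd (block_of t) (e i).1 (e i).2) ->
  iso (subdivide (lens (block_of t) (sig t) m (fun i => ~~ isSome (blk t i)) e)) G ->
  induced t m G.
Proof.
move=> sigm he isoG; split => //.
have ksym : forall x y, stage1_ext t m x y = stage1_ext t m y x := st1_sym (block_of t) (sig t) m.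
(* All insertions go into the first piece of their edge; by [stage2_iso] the choice is
   immaterial. *)
exists (fun i => (pt (stage1_ext t m) (e i).1 (e i).2 0, pt (stage1_ext t m) (e i).1 (e i).2 1)).
split=> [i im bi|].
  have /and3P[XY bX hY] := he i im bi.
  (* Signatures below m leave a positive number of new vertices between two blocks, so such a
     carrier is not of length one. *)
  have hc : ~~ branch (e i).2 || (stage1_ext t m (e i).1 (e i).2 != 0); last first.
    have [a [p [h1 h2]]] := edge_carrier trT hirr brT ksym XY bX hc.
    by exists a, p; apply/andP.
  case/orP: hY => [->//|ncXY]; case bY: (branch (e i).2) => //=.
  rewrite /stage1_ext bX bY /= (negbTE ncXY).
  by have := sigm _ bX; have := sigm _ bY; lia.
apply: iso_trans (iso_sym _) isoG.
apply: (@stage2_iso _ trT hirr brT _ ksym _ _ _ _ _ (fun=> 0)) => i im.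
case bi: (blk t i) => //= _; case/and3P: (he i im bi) => XY _ _.
by rewrite mem_head; split.
Qed.

(** * Admissible sequences and labellings *)

Section FromSequence.
Variable t : seq (option (rooted_subtree T)).
Hypothesis adt : admissible t.

Lemma block_ofE v i : v \in overts (blk t i) -> block_of t v = i.
Proof.
case: adt => _ dis vi.
have i0 : 0 < i by case: i vi; rewrite //= inE.
have it : i <= size t.
  by rewrite leqNgt; apply/negP => lt; move: vi; rewrite /blk nth_default ?inE.
have hs : has (fun B => v \in overts B) t.
  by apply/(has_nthP None); case: i i0 it vi => // i _ it vi; exists i.
have hv : v \in overts (blk t (block_of t v)) by exact: (nth_find None hs).
apply/eqP; apply/negPn/negP => /eqP ne.
by have /disjointFl/(_ vi) := dis _ _ ne; rewrite hv.
Qed.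

Lemma branch_block v : branch v ->
  exists2 R, blk t (block_of t v) = Some R & v \in verts R.
Proof.
case: adt => cov _ /cov[i vi]; rewrite (block_ofE vi).
by move: vi; case: (blk t i) => [R|]; [exists R|rewrite /= inE].
Qed.

Lemma verts_branch i R v : blk t i = Some R -> v \in verts R -> branch v /\ block_of t v = i.
Proof.
move=> bi vR; have vi : v \in overts (blk t i) by rewrite bi.
by split; [apply/(proj1 adt); exists i|exact: block_ofE].
Qed.

Lemma admissible_labelling : exists r,
  [/\ labelling (block_of t) r,
      forall v, branch v -> sig t v = sg (block_of t) r v,
      forall i, emp (block_of t) i = ~~ isSome (blk t i) &
      forall i R, blk t i = Some R -> r i = rt R].
Proof.
have [x0 _] := br_exists brT.
exists (fun i => if blk t i is Some R then rt R else x0); split.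
- split=> [v _|v bv|v bv]; first by [].
    have [R bR vR] := branch_block bv; rewrite bR.
    by have := verts_branch bR (rt_in R).
  have [R bR vR] := branch_block bv; rewrite bR => nv.
  have /connectP[p0] := verts_connected vR (rt_in R).
  case/shortenP=> [[|u p] vp Up _ el]; first by case: nv.
  have /= /andP[/and3P[vu _ uR] _] := vp.
  have [bu eu] := verts_branch bR uR; exists u; split => //.
  case: (tree_dist_step trT (rt R) vu) => // far.
  (* A path that began by moving away from the root could never reach it. *)
  pose q j := nth v (v :: u :: p) j.
  have qadj j : j < (size p).+1 -> adj (q j) (q j.+1).
    by move=> lt; have /(pathP v)/(_ j lt)/andP[] := vp.
  have := @nonbacktracking_dist _ trT q (size p).+1 (rt R) qadj _ (fun=> far) _ (leqnn _).
  suff nb j : j.+1 < (size p).+1 -> q j <> q j.+2.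
    have eq : q (size p).+1 = rt R by rewrite el (last_nth v).
    by move/(_ nb); rewrite eq dist_xx //; lia.
  move=> lt; have lt0 : j < size (v :: u :: p) := ltn_trans (ltnSn j) (leqW lt).
  have lt2 : j.+2 < size (v :: u :: p) by rewrite ltnS.
  by rewrite /q => /eqP; rewrite (nth_uniq v lt0 lt2 Up); lia.
- by move=> v bv; rewrite /sig /sg; have [R -> _] := branch_block bv.
- move=> i; apply/idP/idP.
    case bi: (blk t i) => [R|//] /emp_branch h.
    by have [b1 b2] := verts_branch bi (rt_in R); move: (h _ b1); rewrite b2 eqxx.
  move=> bi; apply/forallP => v; apply/negP => /andP[/branch_block[R bR _] /eqP e].
  by move: bi; rewrite -e bR.
by move=> i R ->.
Qed.

End FromSequence.

Lemma labelling_admissible c r m : labelling c r ->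
  (forall v, branch v -> c v <= m) ->
  exists t : seq (option (rooted_subtree T)),
   [/\ admissible t, forall v, branch v -> block_of t v = c v,
       forall v, branch v -> sig t v = sg c r v &
       forall i, ~~ isSome (blk t i) = emp c i].
Proof.
move=> lab cm.
pose B i := [set v : T | branch v && (c v == i)].
pose spec i (O : option (rooted_subtree T)) := [/\ overts O = B i, ~~ isSome O = emp c i
  & forall R, O = Some R -> rt R = r i].
have exO i : exists O, spec i O.
  case: (boolP (emp c i)) => [ei|/empP[v bv cv]].
    exists None; split; rewrite ?ei //.
    by apply/setP => v; rewrite !inE; have /forallP/(_ v)/negbTE -> := ei.
  pose rel_i := (fun u w : T => [&& adj u w, u \in B i & w \in B i]).
  have ri : r i \in B i by rewrite inE -cv; case: (lab_rt lab bv) => -> ->; rewrite eqxx.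
  have sym_i : connect_sym rel_i.
    by apply: sym_connect_sym => u w; rewrite /rel_i adj_sym; case: (adj _ _); rewrite //= andbC.
  have toroot u : u \in B i -> connect rel_i u (r i).
    have [d] := ubnP (dist u (r i)); elim: d u => // d IH u lt uB.
    have [->//|nu] := eqVneq u (r i).
    move: (uB); rewrite inE => /andP[bu /eqP cu].
    have nu' : u <> r (c u) by rewrite cu; apply/eqP.
    have [w [uw bw cw dw]] := lab_up lab bu nu'; rewrite cu in cw dw.
    have wB : w \in B i by rewrite inE bw cw eqxx.
    apply: connect_trans (connect1 _) (IH w _ wB); first by rewrite /rel_i uw uB.
    by rewrite dw in lt.
  have conn u w : u \in B i -> w \in B i -> connect rel_i u w.
    by move=> uB wB; apply: connect_trans (toroot u uB) _; rewrite sym_i toroot.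
  exists (Some (RootedSubtree ri conn)); split => //=; last by move=> R [<-].
  by apply/esym/negbTE/empP; exists v.
have [t [st ht]] : exists t, size t = m /\ forall i, i < m -> spec i.+1 (nth None t i).
  elim: {cm} m => [|n [t [st ht]]]; first by exists [::].
  have [O sO] := exO n.+1; exists (rcons t O); rewrite size_rcons st; split => // i.
  rewrite ltnS leq_eqVlt nth_rcons st => /orP[/eqP ->|lt]; first by rewrite ltnn eqxx.
  by rewrite lt; exact: ht.
have c0 : emp c 0.
  by apply/forallP => v; apply/negP => /andP[bv /eqP cv]; have := lab_pos lab bv; rewrite cv.
have hb i : spec i (blk t i).
  have eE j : emp c j -> spec j None.
    move=> ej; split; rewrite ?ej //.
    by apply/setP => v; rewrite !inE; have /forallP/(_ v)/negbTE -> := ej.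
  case: i => [|i]; first exact: eE.
  case: (ltnP i m) => im; first exact: ht.
  rewrite /blk nth_default; last by rewrite /= st.
  apply: eE; apply/forallP => v; apply/negP => /andP[bv /eqP cv].
  by have := cm v bv; rewrite cv; lia.
have ov v i : (v \in overts (blk t i)) = branch v && (c v == i).
  by case: (hb i) => -> _ _; rewrite inE.
have adt : admissible t.
  split=> [v|i j ij].
    split=> [bv|[i]]; first by exists (c v); rewrite ov bv eqxx.
    by rewrite ov => /andP[].
  rewrite disjoint_subset; apply/subsetP => v; rewrite ov => /andP[bv /eqP cv].
  by rewrite inE ov bv cv; apply/eqP.
have bo v : branch v -> block_of t v = c v.
  by move=> bv; apply: block_ofE; rewrite // ov bv eqxx.
exists t; split => //; last by move=> i; case: (hb i).
move=> v bv; rewrite /sig /sg bo //; case: (hb (c v)) => ovc _.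
case: (blk t (c v)) ovc => [R|] /= ovc; first by move=> ->.
by have : v \in B (c v); [rewrite inE bv eqxx|rewrite -ovc inE].
Qed.

End Labelling.

(** * Counting vertices *)

Section Sums.
Variable T : sgraph.
Implicit Types (x y z u v : T) (c s d : T -> nat) (r : nat -> T).

Lemma sum_pairs (P : rel T) (F : T -> T -> nat) :
  \sum_(p : T * T | P p.1 p.2) F p.1 p.2 = \sum_x \sum_(y | P x y) F x y.
Proof. by rewrite pair_big_dep. Qed.

Lemma sum_pairs_sym (P : rel T) (F : T -> T -> nat) :
  \sum_(p : T * T | P p.1 p.2) F p.1 p.2 = \sum_(p : T * T | P p.2 p.1) F p.2 p.1.
Proof.
by rewrite (reindex_inj (h := fun p : T * T => (p.2, p.1))) //= => -[a b] [c d] [-> ->].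
Qed.

Lemma sum_adj1 d : \sum_(p : T * T | adj p.1 p.2) d p.1 = \sum_x deg x * d x.
Proof.
rewrite (sum_pairs (@adj T) (fun x _ => d x)); apply: eq_bigr => x _.
rewrite sum_nat_const /deg; congr (_ * _); apply: eq_card => y; by rewrite !inE.
Qed.

Definition inblk c x y := [&& adj x y, branch x, branch y & c x == c y].

(* y is the parent of x in the rooted block of x. *)
Definition up c r x y := inblk c x y && (dist y (r (c x)) < dist x (r (c x))).

(* The number of vertices other than branch vertices in an induced tree. *)
Definition lsize c s m :=
  \sum_(p : T * T | bd c p.1 p.2) (m - s p.1) + \sum_(1 <= i < m.+1 | emp c i) wt m i.

Hypotheses (trT : tree T) (hirr : homeo_irreducible T) (brT : 0 < #|Vbr T|).

Lemma adj_split c F :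
  \sum_(p : T * T | adj p.1 p.2 && branch p.1) F p =
  \sum_(p : T * T | bd c p.1 p.2) F p + \sum_(p : T * T | inblk c p.1 p.2) F p.
Proof.
rewrite (bigID (fun p : T * T => bd c p.1 p.2)) /=; congr (_ + _); apply: eq_bigl => -[x y] /=;
rewrite /bd /inblk; case: (adj x y) => //=; case: (branch x) => //=;
by case: (branch y) => //=; rewrite ?negbK.
Qed.

Section Labelled.
Variables (c : T -> nat) (r : nat -> T).
Hypothesis lab : labelling c r.

Lemma up_uniq x y z : up c r x y -> up c r x z -> y = z.
Proof.
case/andP=> /and4P[xy _ _ _] dy /andP[/and4P[xz _ _ _] dz].
exact: (tree_closer_uniq trT xy xz dy dz).
Qed.

Lemma up_exists x : branch x -> (exists y, up c r x y) <-> x <> r (c x).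
Proof.
move=> bx; split=> [[y /andP[_]]|/(lab_up lab bx)[y [xy by_ cy dy]]].
  by move=> lt e; move: lt; rewrite -e dist_xx.
by exists y; rewrite /up /inblk xy bx by_ cy eqxx dy /=.
Qed.

Lemma up_branch x y : up c r x y -> [/\ branch x, branch y & c y = c x].
Proof. by case/andP=> /and4P[_ -> -> /eqP ->]. Qed.

Lemma sum_up1 d : \sum_(p : T * T | up c r p.1 p.2) d p.1 =
  \sum_(x | branch x && (x != r (c x))) d x.
Proof.
rewrite (sum_pairs (up c r) (fun x _ => d x)) [RHS]big_mkcond /=; apply: eq_bigr => x _.
case: (boolP (branch x && _)) => [/andP[bx /eqP/(up_exists bx)[y xy]]|nx].
  rewrite (big_pred1 y) // => z; apply/idP/eqP => [xz|-> //].
  exact: up_uniq xz xy.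
rewrite big_pred0 // => y; apply/negP => xy; move/negP: nx; apply.
have [bx _ _] := up_branch xy; rewrite bx; apply/eqP/(up_exists bx); by exists y.
Qed.

(** The ends of an edge differ by one in their distance to the root, so an edge inside a block is a
    parent edge in exactly one direction. *)
Lemma sum_inblk (F : T -> T -> nat) :
  \sum_(p : T * T | inblk c p.1 p.2) F p.1 p.2 =
  \sum_(p : T * T | up c r p.1 p.2) (F p.1 p.2 + F p.2 p.1).
Proof.
rewrite big_split /= (bigID (fun p : T * T => up c r p.1 p.2)) /=; congr (_ + _).
  by apply: eq_bigl => p; rewrite /up; case: (inblk _ _ _).
rewrite -(sum_pairs_sym (fun x y => up c r y x)); apply: eq_bigl => -[x y] /=.
rewrite /up /inblk (adj_sym y); case: (boolP (adj x y)) => //= xy.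
case: (branch x); rewrite ?andbF //=; case: (branch y) => //=.
rewrite (eq_sym (c y)); case: eqP => //= ->.
by case: (tree_dist_step trT (r (c y)) xy) => ->; lia.
Qed.

(* Handshake lemma inside the blocks: every block is a tree. *)
Lemma sum_deg_blocks d :
  \sum_(x | branch x) deg x * d x =
  \sum_(p : T * T | bd c p.1 p.2) d p.1 + \sum_(p : T * T | up c r p.1 p.2) (d p.1 + d p.2).
Proof.
rewrite -(sum_inblk (fun x _ => d x)) -(adj_split c (fun p => d p.1)).
rewrite (sum_pairs (fun x y => adj x y && branch x) (fun x _ => d x)).
rewrite big_mkcond /=; apply: eq_bigr => x _; case: (branch x); last first.
  by rewrite big_pred0 // => y; rewrite andbF.
rewrite (eq_bigl (adj x)); last by move=> y; rewrite andbT.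
by rewrite sum_nat_const /deg; congr (_ * _); apply: eq_card => y; rewrite inE.
Qed.

(** This is [deg x >= 3] inserted into the handshake identity. For the indicator of a block with b
    vertices it says that at least b + 2 half-edges leave it; general weights are needed for a slack
    that varies inside a block. *)
Lemma weighted_degree d :
  3 * (\sum_(x | branch x && (x == r (c x))) d x) +
  \sum_(p : T * T | up c r p.1 p.2) 2 * d p.1 <=
  \sum_(p : T * T | bd c p.1 p.2) d p.1 + \sum_(p : T * T | up c r p.1 p.2) d p.2.
Proof.
have le3 : 3 * \sum_(x | branch x) d x <= \sum_(x | branch x) deg x * d x.
  by rewrite big_distrr /=; apply: leq_sum => x bx; rewrite leq_mul2r; apply/orP; right.
move: le3; rewrite sum_deg_blocks big_split /=.
rewrite (bigID (fun x => x == r (c x))) /= -(sum_up1 d) -big_distrr /=; lia.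
Qed.

(** Three suffices for enlarging labellings: [wt] changes by 2 per index, so three half-edges that
    each gain 1 per index outweigh it. *)
Lemma bd_ge3 i : ~~ emp c i -> 3 <= \sum_(p : T * T | bd c p.1 p.2) (c p.1 == i).
Proof.
case/empP=> v bv cv.
have := weighted_degree (fun x => c x == i : nat).
have -> : \sum_(p : T * T | up c r p.1 p.2) (c p.2 == i) =
          \sum_(p : T * T | up c r p.1 p.2) (c p.1 == i).
  by apply: eq_bigr => p /up_branch[_ _ ->].
rewrite -big_distrr /=.
suff : 1 <= \sum_(x | branch x && (x == r (c x))) (c x == i) by lia.
have [br cr] := lab_rt lab bv.
rewrite (bigD1 (r (c v))) /=; last by rewrite br cr eqxx.
by rewrite cr cv eqxx.
Qed.

End Labelled.

Lemma card_vertices : #|T| = #|Vbr T| + \sum_(x : T) (~~ branch x).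
Proof.
rewrite -(cardC (mem (Vbr T))); congr (_ + _).
by rewrite -sum1_card big_mkcond; apply: eq_bigr => x _; rewrite !inE; case: (branch x).
Qed.

Lemma sum_leaves : \sum_(p : T * T | adj p.1 p.2) (~~ branch p.1) = \sum_(x : T) (~~ branch x).
Proof.
rewrite (sum_adj1 (fun x => ~~ branch x : nat)); apply: eq_bigr => x _.
by case bx: (branch x); rewrite ?muln0 //= muln1; apply/eqP; rewrite -/(leaf x) (leafE trT) ?bx.
Qed.

(** Each leaf is counted as a point of its arm. This absorbs the -1 in the first stage: every
    half-edge leaving a block then owns exactly [m - s] points. *)
Lemma card_subdivide_cnt (k : T -> T -> nat) : (forall x y, k x y = k y x) ->
  2 * #|subdivide k| = 2 * #|Vbr T| +
    \sum_(p : T * T | adj p.1 p.2) (k p.1 p.2 + (~~ branch p.1) + (~~ branch p.2)).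
Proof.
move=> ksym; rewrite card_subdivide // !big_split /=.
have -> : \sum_(p : T * T | adj p.1 p.2) (~~ branch p.2) =
          \sum_(p : T * T | adj p.1 p.2) (~~ branch p.1).
  rewrite (sum_pairs_sym (@adj T) (fun x y => ~~ branch y : nat)).
  by apply: eq_bigl => p; rewrite adj_sym.
by rewrite sum_leaves card_vertices; lia.
Qed.

Lemma bd_adj c x y : bd c x y -> adj x y.
Proof. by case/and3P. Qed.

Lemma sum_bd_sym c (F : T -> T -> nat) :
  \sum_(p : T * T | adj p.1 p.2)
     (bd c p.1 p.2 * F p.1 p.2 + bd c p.2 p.1 * F p.2 p.1) =
  2 * \sum_(p : T * T | bd c p.1 p.2) F p.1 p.2.
Proof.
have one : \sum_(p : T * T | adj p.1 p.2) bd c p.1 p.2 * F p.1 p.2 =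
    \sum_(p : T * T | bd c p.1 p.2) F p.1 p.2.
  rewrite big_mkcond [RHS]big_mkcond; apply: eq_bigr => -[x y] _ /=.
  by case: (boolP (bd c x y)) => [/bd_adj ->|_]; rewrite ?mul1n // if_same.
rewrite big_split /= one -(sum_pairs_sym (fun x y => adj y x) (fun x y => bd c x y * F x y)).
rewrite (_ : \sum_(p | adj p.2 p.1) _ = \sum_(p | bd c p.1 p.2) F p.1 p.2); last first.
  by rewrite -one; apply: eq_bigl => p; rewrite adj_sym.
by rewrite mul2n addnn.
Qed.

Lemma sum_carriers m (E : pred nat) (e : nat -> T * T) (w : nat -> nat) (P : rel T) :
  (forall x y, P x y = P y x) ->
  (forall i, 1 <= i <= m -> E i -> P (e i).1 (e i).2 /\ (e i).1 != (e i).2) ->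
  \sum_(p : T * T | P p.1 p.2)
    \sum_(1 <= i < m.+1 | E i && (e i \in [:: (p.1, p.2); (p.2, p.1)])) w i =
  2 * \sum_(1 <= i < m.+1 | E i) w i.
Proof.
move=> Psym he.
transitivity (\sum_(p : T * T | P p.1 p.2) \sum_(1 <= i < m.+1)
   (if E i && (e i \in [:: (p.1, p.2); (p.2, p.1)]) then w i else 0)).
  by apply: eq_bigr => p _; exact: big_mkcond.
rewrite exchange_big [X in 2 * X]big_mkcond big_distrr /=; apply: eq_big_nat => i im.
case: (boolP (E i)) => Ei; last by rewrite big1.
have [Pe ne] := he i im Ei; case: (e i) Pe ne => X Y /= PXY nXY.
rewrite (bigD1 (X, Y)) //= (bigD1 (Y, X)) /=; last first.
  by rewrite Psym PXY xpair_eqE eq_sym (negbTE nXY).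
rewrite !inE !eqxx orbT /= big1 ?addn0 ?mul2n ?addnn // => -[x y] /andP[/andP[_ n1] n2].
rewrite !inE ifF //; apply/negbTE; rewrite negb_or eq_sym n1 /=.
by move: n2; apply: contra => /eqP[-> ->].
Qed.

Lemma st1_cnt c s m x y : adj x y ->
  (forall v, branch v -> s v < m) ->
  st1 c s m x y + (~~ branch x) + (~~ branch y) =
  bd c x y * (m - s x) + bd c y x * (m - s y).
Proof.
move=> xy sm; rewrite /st1 /bd xy (adj_sym y) xy !(leafE trT) // (eq_sym (c y)).
case bx: (branch x); case by_: (branch y) => //=.
- have := sm _ bx; have := sm _ by_.
  by case: (c x == c y) => //=; lia.
- by have := sm _ bx; lia.
- by have := sm _ by_; lia.
by have := leaf_nbr trT hirr brT xy; rewrite leafE // bx by_ => /(_ isT).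
Qed.

Lemma card_lens c s m e :
  (forall v, branch v -> s v < m) ->
  (forall i, 1 <= i <= m -> emp c i -> bd c (e i).1 (e i).2) ->
  #|subdivide (lens c s m (emp c) e)| = #|Vbr T| + lsize c s m.
Proof.
move=> sm he; have := card_subdivide_cnt (lens_sym c s m (emp c) e).
have -> : \sum_(p : T * T | adj p.1 p.2)
    (lens c s m (emp c) e p.1 p.2 + (~~ branch p.1) + (~~ branch p.2)) =
  \sum_(p : T * T | adj p.1 p.2)
     (bd c p.1 p.2 * (m - s p.1) + bd c p.2 p.1 * (m - s p.2)) +
  \sum_(p : T * T | adj p.1 p.2)
    \sum_(1 <= i < m.+1 | emp c i && (e i \in [:: (p.1, p.2); (p.2, p.1)])) wt m i.
  rewrite -big_split /=; apply: eq_bigr => -[x y] /= xy.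
  rewrite -(st1_cnt _ xy sm) /lens -!addnA; congr (_ + _).
  by rewrite addnC -addnA.
rewrite (sum_bd_sym c (fun x _ => m - s x)) sum_carriers; last 2 first.
- by move=> x y; rewrite adj_sym.
- move=> i im ei; have := bd_adj (he i im ei).
  by split => //; exact: adj_neq.
rewrite /lsize; lia.
Qed.

End Sums.

(** * Enlarging a labelling *)

Lemma sum_emp_drop (E : pred nat) m j (w : nat -> nat) : 1 <= j <= m -> E j ->
  \sum_(1 <= l < m.+1 | E l) w l = w j + \sum_(1 <= l < m.+1 | E l && (l != j)) w l.
Proof.
move=> jm Ej; rewrite big_mkcond (bigD1_seq j) /= ?iota_uniq ?mem_index_iota //.
by rewrite Ej -big_mkcondr /= ; congr (_ + _); apply: eq_bigl => l; rewrite andbC.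
Qed.

Section Improve.
Variable T : sgraph.
Hypotheses (trT : tree T) (hirr : homeo_irreducible T) (brT : 0 < #|Vbr T|).
Implicit Types (x y z u v : T) (c s d : T -> nat) (r : nat -> T).

Let conT : connected T. Proof. by case: trT. Qed.

Section Swap.
Variables (c : T -> nat) (r : nat -> T) (m i j : nat).
Hypotheses (lab : labelling c r) (sgm : forall v, branch v -> sg c r v <= m).
Hypotheses (j0 : 0 < j) (ji : j < i) (ej : emp c j) (ei : ~~ emp c i).

Let c' v := if c v == i then j else c v.
Let r' l := if l == j then r i else r l.

Let rt' v : branch v -> r' (c' v) = r (c v).
Proof.
move=> bv; rewrite /r' /c'; case: (eqVneq (c v) i) => [->|ni]; first by rewrite eqxx.
by rewrite (negbTE (emp_branch ej bv)).
Qed.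

Let c'_eq u v : branch u -> branch v -> (c' u == c' v) = (c u == c v).
Proof.
move=> bu bv; have := emp_branch ej bu; have := emp_branch ej bv; rewrite /c'.
case: (eqVneq (c u) i) => cu; case: (eqVneq (c v) i) => cv h1 h2;
by apply/eqP/eqP; lia.
Qed.

Let lab' : labelling c' r'.
Proof.
split=> v bv.
- by rewrite /c'; case: eqP => // _; exact: (lab_pos lab).
- rewrite rt' //; have [b e] := lab_rt lab bv; split => //; by apply/eqP; rewrite c'_eq // e.
rewrite rt' // => /(lab_up lab bv)[u [vu bu cu du]]; exists u; split => //.
by apply/eqP; rewrite c'_eq // cu.
Qed.

Let sg' v : branch v -> sg c' r' v = sg c r v - (i - j) * (c v == i).
Proof.
move=> bv; rewrite /sg rt' // /c'; case: eqP => [->|_] /=; lia.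
Qed.

Lemma lab_swap : exists c' r', [/\ labelling c' r',
  forall v, branch v -> sg c' r' v <= m & lsize c (sg c r) m < lsize c' (sg c' r') m].
Proof.
exists c', r'; split => // [v bv|]; first by rewrite sg' //; have := sgm bv; lia.
have im : i <= m.
  by case/empP: ei => v bv cv; have := sgm bv; rewrite /sg cv; lia.
have bd' p : bd c' p.1 p.2 = bd c p.1 p.2.
  rewrite /bd; case: (adj _ _) => //=; case b1: (branch p.1) => //=.
  by case b2: (branch p.2) => //=; rewrite c'_eq.
have emp' l : emp c' l = if l == j then false else (l == i) || emp c l.
  have [->|nj] := eqVneq l j.
    apply/negbTE/empP; case/empP: ei => v bv cv; exists v => //.
    by rewrite /c' cv eqxx.
  have [->|ni] /= := eqVneq l i.
    apply/forallP => v; apply/negP => /andP[bv /eqP]; rewrite /c'.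
    by case: eqP; lia.
  apply: eq_forallb => v; rewrite /c'; case: (branch v) => //=.
  case: (eqVneq (c v) i) => [->|//].
  by rewrite (eq_sym j) (eq_sym i) (negbTE nj) (negbTE ni).
have e1 := @sum_emp_drop (emp c) m j (wt m) (ltac:(lia)) ej.
have e2 := @sum_emp_drop (emp c') m i (wt m) (ltac:(lia)) _.
rewrite emp' eqxx gtn_eqF // in e2; have {}e2 := e2 isT.
have e3 : \sum_(1 <= l < m.+1 | emp c' l && (l != i)) wt m l =
          \sum_(1 <= l < m.+1 | emp c l && (l != j)) wt m l.
  apply: eq_bigl => l; rewrite emp'; case: (eqVneq l j) => [->|nj] /=; first by rewrite andbF.
  by case: (eqVneq l i) => [->|ni] /=; rewrite ?andbF ?andbT // (negbTE ei).
have e4 : \sum_(p : T * T | bd c p.1 p.2) (m - sg c r p.1) +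
    (i - j) * \sum_(p : T * T | bd c p.1 p.2) (c p.1 == i) <=
    \sum_(p : T * T | bd c' p.1 p.2) (m - sg c' r' p.1).
  rewrite big_distrr -big_split (eq_bigl _ _ bd') /=; apply: leq_sum => p /and3P[_ b1 _].
  have := sgm b1; rewrite sg' //; have : (c p.1 == i) -> i <= sg c r p.1.
    by rewrite /sg => /eqP ->; exact: leq_addl.
  by case: (c p.1 == i) => /= [/(_ isT)|_]; lia.
have := bd_ge3 trT brT lab ei; rewrite /lsize e1 e2 e3 /wt.
move: e4; set A := \sum_(_ | _) _; set B := \sum_(_ | _) _; set C := \sum_(_ | _) _.
move=> h1 h2; have : (i - j) * 3 <= (i - j) * B by rewrite leq_mul2l h2 orbT.
lia.
Qed.

End Swap.

Section Merge.
Variables (c : T -> nat) (r : nat -> T) (m i j : nat).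
Hypotheses (lab : labelling c r) (sgm : forall v, branch v -> sg c r v <= m).
Hypotheses (ij : i.+1 < j) (ei : ~~ emp c i) (ej : ~~ emp c j).
Hypothesis adjr : adj (r i) (r j).

Let ri : branch (r i) /\ c (r i) = i.
Proof. by case/empP: ei => v bv <-; exact: lab_rt. Qed.

Let rj : branch (r j) /\ c (r j) = j.
Proof. by case/empP: ej => v bv <-; exact: lab_rt. Qed.

(** The way from v to [r i] passes through [r j]. If the step from v to its parent u led away from
    [r i], then u would have two neighbours closer to [r i]: v, and its own parent or, for
    [u = r j], the root [r i]. *)
Lemma merged_dist v : branch v -> c v = j -> dist v (r i) = (dist v (r j)).+1.
Proof.
have [d] := ubnP (dist v (r j)); elim: d v => // d IH v lt bv cv.
have [->|nv] := eqVneq v (r j).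
  by rewrite dist_xx // dist_adj // adj_sym.
have nv' : v <> r (c v) by rewrite cv; apply/eqP.
have [u [vu bu cu du]] := lab_up lab bv nv'; rewrite cv in cu du.
have IHu : dist u (r i) = (dist u (r j)).+1.
  by apply: IH => //; clear -lt du; lia.
case: (tree_dist_step trT (r i) vu) => [->|back]; first by rewrite IHu du.
have [eu|nu] := eqVneq u (r j).
  have : v = r i; last by move=> e; case: ri => _; rewrite -e cv; clear -ij; lia.
  apply: (@tree_closer_uniq _ trT u _ _ (r i)).
  - by rewrite adj_sym.
  - by rewrite eu adj_sym.
  - by rewrite back.
  by rewrite dist_xx // IHu.
have nu' : u <> r (c u) by rewrite cu; apply/eqP.
have [w [uw bw cw dw]] := lab_up lab bu nu'; rewrite cu in cw dw.
have IHw : dist w (r i) = (dist w (r j)).+1.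
  by apply: IH => //; clear -lt du dw; lia.
have : v = w; last by move=> e; move: du; rewrite e dw; clear; lia.
have uv : adj u v by rewrite adj_sym.
apply: (tree_closer_uniq trT uv uw (x := r i)); first by rewrite back.
by rewrite IHw IHu dw.
Qed.

(* Two disjoint subtrees of a tree are joined by at most one edge. *)
Lemma cross_edge x y : adj x y -> branch x -> branch y -> c x = i -> c y = j ->
  x = r i /\ y = r j.
Proof.
move=> xy bx by_ cx cy; case: (tree_dist_step trT (r i) xy) => e.
  have nx : x <> r (c x) by move=> ex; move: e; rewrite {1}ex cx dist_xx.
  have [u [xu bu cu du]] := lab_up lab bx nx; rewrite cx in cu du.
  have : y = u; last by move=> eu; move: cy; rewrite eu cu; clear -ij; lia.
  by apply: (tree_closer_uniq trT xy xu (x := r i)); [rewrite e|rewrite du].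
have [ey|ny] := eqVneq y (r j).
  split => //; apply: (dist_eq0 conT); move: e; rewrite ey.
  by rewrite (merged_dist (proj1 rj) (proj2 rj)) dist_xx // => -[].
have ny' : y <> r (c y) by rewrite cy; apply/eqP.
have [u [yu bu cu du]] := lab_up lab by_ ny'; rewrite cy in cu du.
have : x = u; last by move=> eu; move: cx; rewrite eu cu; clear -ij; lia.
have yx : adj y x by rewrite adj_sym.
apply: (tree_closer_uniq trT yx yu (x := r i)); first by rewrite e.
by rewrite !merged_dist // du.
Qed.

Let c' v := if c v == j then i else c v.

Let lab' : labelling c' r.
Proof.
have [bri cri] := ri; have [brj crj] := rj.
have c'ri : c' (r i) = i by rewrite /c' cri; case: eqP.
split=> v bv.
- rewrite /c'; case: eqP => [cv|_]; last exact: (lab_pos lab).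
  by have := lab_pos lab bri; rewrite cri.
- case: (eqVneq (c v) j) => [cv|nj].
    have c'v : c' v = i by rewrite /c' cv eqxx.
    by rewrite c'v c'ri.
  have c'v : c' v = c v by rewrite /c' (negbTE nj).
  by have [b e] := lab_rt lab bv; rewrite c'v /c' e (negbTE nj).
case: (eqVneq (c v) j) => [cv|nj] nv.
  have c'v : c' v = i by rewrite /c' cv eqxx.
  rewrite c'v in nv *; have [ev|nvj] := eqVneq v (r j).
    exists (r i); split => //; first by rewrite ev adj_sym.
    by rewrite ev dist_xx // dist_adj // adj_sym.
  have nv' : v <> r (c v) by rewrite cv; apply/eqP.
  have [u [vu bu cu du]] := lab_up lab bv nv'; exists u; rewrite cv in cu du.
  by rewrite /c' cu eqxx !merged_dist // du.
have c'v : c' v = c v by rewrite /c' (negbTE nj).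
rewrite c'v in nv *; have [u [vu bu cu du]] := lab_up lab bv nv; exists u.
by rewrite /c' cu (negbTE nj).
Qed.

Let sg' v : branch v -> sg c r v = sg c' r v + (j - i.+1) * (c v == j).
Proof.
move=> bv; rewrite /sg /c'; case: (eqVneq (c v) j) => [cv|_] /=; last by lia.
by rewrite cv merged_dist //; lia.
Qed.

(** The root [r j] now has signature i + 1, so block j drops by j - i - 1 and at least three
    half-edges gain that much. The edge between the roots gives up [m - i] and [m - i.+1] points in
    the new signatures, the freed index returns [wt m j]; together this costs only 2 (j - i - 1). *)
Lemma lab_merge : exists c' r', [/\ labelling c' r',
  forall v, branch v -> sg c' r' v <= m & lsize c (sg c r) m < lsize c' (sg c' r') m].
Proof.
exists c', r; split => // [v bv|]; first by have := sgm bv; rewrite sg' //; lia.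
have [bri cri] := ri; have [brj crj] := rj.
have jm : 1 <= j <= m by have := sgm brj; rewrite /sg crj; lia.
have adjr' : adj (r j) (r i) by rewrite adj_sym.
have nij : (i == j) = false by lia.
have nrij := adj_neq adjr.
have bd' p : bd c' p.1 p.2 = [&& bd c p.1 p.2, p != (r i, r j) & p != (r j, r i)].
  case: p => x y /=; rewrite /bd; case: (boolP (adj x y)) => //= xy.
  case b1: (branch x) => //=; case b2: (branch y) => //=; last first.
    rewrite !xpair_eqE /=; symmetry; rewrite -negb_or; apply/negP.
    by case/orP => /andP[_ /eqP e]; move: b2; rewrite e ?brj ?bri.
  rewrite /c' !xpair_eqE; case: (eqVneq (c x) j) => cx; case: (eqVneq (c y) j) => cy.
  - by rewrite eqxx cx cy eqxx.
  - case: (eqVneq (c y) i) => cyi.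
      have yx : adj y x by rewrite adj_sym.
      have [-> ->] := cross_edge yx b2 b1 cyi cx.
      by rewrite !eqxx !andbF.
    rewrite cx (eq_sym j) cy /=.
    symmetry; rewrite -negb_or; apply/negP => /orP[]/andP[/eqP ex /eqP ey].
      by move: cy; rewrite ey crj eqxx.
    by move: cyi; rewrite ey cri eqxx.
  - case: (eqVneq (c x) i) => cxi.
      have [-> ->] := cross_edge xy b1 b2 cxi cy.
      by rewrite !eqxx !andbF.
    rewrite cy cx /=.
    symmetry; rewrite -negb_or; apply/negP => /orP[]/andP[/eqP ex /eqP ey].
      by move: cxi; rewrite ex cri eqxx.
    by move: cx; rewrite ex crj eqxx.
  case: (c x == c y) => //=.
  symmetry; rewrite -negb_or; apply/negP => /orP[]/andP[/eqP ex /eqP ey].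
    by move: cy; rewrite ey crj eqxx.
  by move: cx; rewrite ex crj eqxx.
have emp' l : emp c' l = (l == j) || emp c l.
  have [->|nl] /= := eqVneq l j.
    apply/forallP => v; apply/negP => /andP[_ /eqP]; rewrite /c'.
    by case: eqP; lia.
  have [->|ni] := eqVneq l i.
    rewrite (negbTE ei); apply/negbTE/empP; exists (r i) => //.
    by rewrite /c' cri; case: eqP.
  apply: eq_forallb => v; rewrite /c'; case: (branch v) => //=.
  case: (eqVneq (c v) j) => [->|//].
  by rewrite (eq_sym j) (eq_sym i) (negbTE nl) (negbTE ni).
have e1 : \sum_(1 <= l < m.+1 | emp c' l) wt m l =
    wt m j + \sum_(1 <= l < m.+1 | emp c l) wt m l.
  rewrite (@sum_emp_drop _ m j) // ?emp' ?eqxx //; congr (_ + _).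
  apply: eq_bigl => l; rewrite emp'; case: (eqVneq l j) => [->|] /=.
    by rewrite (negbTE ej).
  by rewrite andbT.
have e2 (F : T -> nat) : \sum_(p : T * T | bd c p.1 p.2) F p.1 =
    F (r i) + (F (r j) + \sum_(p : T * T | bd c' p.1 p.2) F p.1).
  have b1 : bd c (r i) (r j) by rewrite /bd adjr bri cri crj nij orbT.
  have b2 : bd c (r j) (r i).
    by rewrite /bd adjr' brj cri crj eq_sym nij orbT.
  rewrite (bigD1 (r i, r j)) //= (bigD1 (r j, r i)) /=; last first.
    by rewrite b2 xpair_eqE eq_sym (negbTE nrij).
  congr (_ + (_ + _)); apply: eq_bigl => p.
  by rewrite bd' andbA.
have e4 : \sum_(p : T * T | bd c p.1 p.2) (m - sg c r p.1) +
    (j - i.+1) * \sum_(p : T * T | bd c p.1 p.2) (c p.1 == j) <=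
    \sum_(p : T * T | bd c p.1 p.2) (m - sg c' r p.1).
  rewrite big_distrr -big_split /=; apply: leq_sum => p /and3P[_ b1 _].
  by have := sgm b1; rewrite sg' //; case: (c p.1 == j) => /=; lia.
have sri : sg c' r (r i) = i.
  by rewrite /sg /c' cri nij dist_xx.
have srj : sg c' r (r j) = i.+1.
  by rewrite /sg /c' crj eqxx dist_adj.
have := bd_ge3 trT brT lab ej; move: e4; rewrite (e2 (fun x => m - sg c' r x)) sri srj.
rewrite /lsize e1 /wt.
set A := \sum_(_ | bd c _ _) _; set B := \sum_(_ | bd c _ _) _; set C := \sum_(_ | bd c' _ _) _.
move=> h1 h2; have : (j - i.+1) * 3 <= (j - i.+1) * B by rewrite leq_mul2l h2 orbT.
lia.
Qed.

End Merge.

(** Pigeonhole: if every index below [c v] were in use, these blocks would supply a branch vertex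
    for each of the values below [c v], and the path from v to its root one for each value from
    [c v] to m. That makes m branch vertices. *)
Lemma gap c r m v : labelling c r -> #|Vbr T| < m -> branch v -> sg c r v = m ->
  exists2 j, 0 < j < c v & emp c j.
Proof.
move=> lab nm bv sv.
case: (boolP [exists j : 'I_(c v), (0 < j) && emp c j]) => [/existsP[j /andP[j0 ej]]|no].
  by exists j; rewrite // j0 ltn_ord.
have full j : 0 < j < c v -> exists2 u, branch u & c u = j.
  case/andP=> j0 jc; apply/empP; apply: contra no => ej.
  by apply/existsP; exists (Ordinal jc); rewrite j0.
have chain (d : nat) : d <= dist v (r (c v)) ->
    exists2 u, branch u & c u = c v /\ dist u (r (c v)) = d.
  move=> le; rewrite -(subKn le); move: (_ - d) (leq_subr d (dist v (r (c v)))).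
  elim=> [|a IH] lea; first by exists v => //; rewrite subn0.
  have [u bu [cu du]] := IH (ltnW lea).
  have nu : u <> r (c u) by move=> e; move: du; rewrite cu in e; rewrite {1}e dist_xx //; lia.
  have [w [uw bw cw dw]] := lab_up lab bu nu; exists w => //.
  by rewrite cw cu; split => //; rewrite cu in dw; lia.
pose g u := if c u == c v then c u + dist u (r (c v)) else c u.
have sub : {subset iota 1 m <= [seq g u | u <- enum (Vbr T)]}.
  move=> l; rewrite mem_iota add1n ltnS => /andP[l0 lm]; apply/mapP.
  have [lt|le] := ltnP l (c v).
    have [u bu cu] := full l (ltac:(lia)); exists u; first by rewrite mem_enum inE.
    by rewrite /g cu; case: eqP; lia.
  have [u bu [cu du]] := chain (l - c v) (ltac:(rewrite /sg in sv; lia)).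
  by exists u; [rewrite mem_enum inE|rewrite /g cu eqxx du; lia].
have := uniq_leq_size (iota_uniq 1 m) sub.
by rewrite size_iota size_map -cardE; lia.
Qed.

Lemma lsize_lt c r m m' : labelling c r -> (forall v, branch v -> sg c r v <= m') ->
  m' < m -> lsize c (sg c r) m' < lsize c (sg c r) m.
Proof.
move=> lab sgm lt; have [b bb] := br_exists brT.
have nb : ~~ emp c (c b) by apply/empP; exists b.
have h := bd_ge3 trT brT lab nb.
have h1 : \sum_(p : T * T | bd c p.1 p.2) (m' - sg c r p.1) +
  \sum_(p : T * T | bd c p.1 p.2) (c p.1 == c b) <=
  \sum_(p : T * T | bd c p.1 p.2) (m - sg c r p.1).
  rewrite -big_split /=; apply: leq_sum => p /and3P[_ b1 _].
  by have := sgm _ b1; case: (_ == _) => /=; lia.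
have h2 : \sum_(1 <= i < m'.+1 | emp c i) wt m' i <= \sum_(1 <= i < m.+1 | emp c i) wt m i.
  rewrite [X in _ <= X](@big_cat_nat _ _ _ m'.+1) //=; last by lia.
  apply: leq_trans (leq_addr _ _); apply: leq_sum => i _; rewrite /wt; lia.
by rewrite /lsize; lia.
Qed.

(** A crude bound, uniform in the labelling, which makes the induction in [lsize_max] terminate. *)
Lemma lsize_bound m : exists B, forall c s, lsize c s m <= B.
Proof.
exists (\sum_(p : T * T) m + \sum_(1 <= i < m.+1) wt m i) => c s.
rewrite /lsize; apply: leq_add.
  rewrite big_mkcond; apply: leq_sum => p _; case: ifP => // _; exact: leq_subr.
by rewrite big_mkcond; apply: leq_sum => p _; case: ifP.
Qed.

End Improve.

(** * Induced trees are burnable *)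

(** Used to find the ball responsible for a position when the segments of the empty indices lie end
    to end on an edge. *)
Lemma prefix_sum (E : pred nat) (w : nat -> nat) m q :
  0 < q <= \sum_(1 <= i < m.+1 | E i) w i ->
  exists i, [/\ 1 <= i <= m, E i,
    \sum_(1 <= l < i | E l) w l < q & q <= \sum_(1 <= l < i | E l) w l + w i].
Proof.
elim: m => [|m IH]; first by rewrite big_geq //; case: q.
rewrite big_mkcond big_nat_recr //= -big_mkcond /=.
case: (leqP q (\sum_(1 <= i < m.+1 | E i) w i)) => [le|gt] /andP[q0 le2].
  case: IH => [|i [im Ei h1 h2]]; first by rewrite q0.
  by exists i; split => //; lia.
exists m.+1; case: (boolP (E m.+1)) le2 => [Em le2|_ le2]; last by lia.
by split => //; lia.
Qed.

Section PtDist.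
Variables (T : sgraph) (k : T -> T -> nat).
Hypotheses (conT : connected T) (ksym : forall x y, k x y = k y x).

Lemma pt_dist x y a b : adj x y -> a <= b -> b <= (k x y).+1 ->
  dist (pt k x y a) (pt k x y b) <= b - a.
Proof.
move=> xy ab; rewrite -{1 2}(subnKC ab); move: (b - a) => d {ab}.
have conH := subdivide_connected ksym conT.
elim: d => [|d IH] le; first by rewrite addn0 dist_xx.
rewrite addnS in le *; have := dist_triangle conH (pt k x y a) (pt k x y (a + d)) (pt k x y (a + d).+1).
have ad : adj (pt k x y (a + d)) (pt k x y (a + d).+1) by apply: pt_adj.
by rewrite (dist_adj conH ad); have := IH (ltnW le); clear; lia.
Qed.

End PtDist.

Section Cover.
Variable T : sgraph.
Hypotheses (trT : tree T) (hirr : homeo_irreducible T) (brT : 0 < #|Vbr T|).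
Variables (c : T -> nat) (r : nat -> T) (m : nat) (e : nat -> T * T).
Hypothesis lab : labelling c r.
Hypothesis sgm : forall v, branch v -> sg c r v < m.
Hypothesis he : forall i, 1 <= i <= m -> emp c i -> bd c (e i).1 (e i).2.
Implicit Types (x y z u v : T).

Let conT : connected T. Proof. by case: trT. Qed.

Let k := lens c (sg c r) m (emp c) e.
Let ksym : forall x y, k x y = k y x := lens_sym c (sg c r) m (emp c) e.
Local Notation H := (subdivide k).
Let conH : connected H := subdivide_connected ksym conT.

Let inblk0 x y : branch x -> branch y -> c x = c y -> k x y = 0.
Proof. exact: lens_inblk. Qed.

(** No vertices are inserted inside a block, so the descent to the root in T is also a path of H. *)
Let dist_block v : branch v -> dist (inl v : H) (inl (r (c v))) <= dist v (r (c v)).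
Proof.
have [d] := ubnP (dist v (r (c v))); elim: d v => // d IH v lt bv.
have [ev|nv] := eqVneq v (r (c v)); first by rewrite -ev dist_xx.
have /(lab_up lab bv)[u [vu bu cu du]] : v <> r (c v) by apply/eqP.
have a1 : adj (inl v : H) (inl u).
  have := pt_adj ksym vu (leq0n _); rewrite pt0 //.
  by have := pt_end ksym vu; rewrite inblk0 // => ->.
have := dist_adj_le conH (inl (r (c v))) a1; have := IH u; rewrite cu => /(_ _ bu).
have lt' : dist u (r (c v)) < d by clear -lt du; lia.
by move/(_ lt'); clear -du; lia.
Qed.

(** Carriers of the same edge may be given in opposite directions; they need a common starting
    point, the branch vertex of an arm or else the end that comes first in the enumeration. *)
Definition orient (p : T * T) := if ~~ branch p.2 || (enum_rank p.1 < enum_rank p.2)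
  then p else (p.2, p.1).

Let on l x y := emp c l && (orient (e l) == (x, y)).

(* Position of the centre i on its edge: first come the m - sg x vertices burned
   from x, then the segments of the smaller indices on the same edge. *)
Definition centre_pos i :=
  let p := orient (e i) in
  m - sg c r p.1 + \sum_(1 <= l < i | on l p.1 p.2) wt m l + (m - i) + 1.

Definition centre i : H :=
  if emp c i then pt k (orient (e i)).1 (orient (e i)).2 (centre_pos i) else inl (r i).

(** The edge, with its leaf if it is an arm, is tiled without remainder by the part burned from x,
    the segments of the empty indices and the part burned from y. *)
Let k_oriented x y : adj x y -> branch x -> ~~ branch y || (enum_rank x < enum_rank y) ->
  ~~ branch y || (c x != c y) ->
  k x y + (~~ branch y) = m - sg c r x + branch y * (m - sg c r y) +
    \sum_(1 <= l < m.+1 | on l x y) wt m l.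
Proof.
move=> xy bx oxy hxy.
have bdxy : bd c x y by rewrite /bd xy bx.
have yx : adj y x by rewrite adj_sym.
have := st1_cnt trT hirr brT c xy sgm; rewrite bx bdxy mul1n addn0 /k /lens.
have -> : bd c y x = branch y.
  by rewrite /bd yx bx /= (eq_sym (c y)); case: (branch y) hxy => //= ->.
have -> : \sum_(1 <= i < m.+1 | emp c i && (e i \in [:: (x, y); (y, x)])) wt m i =
    \sum_(1 <= l < m.+1 | on l x y) wt m l.
  rewrite big_nat_cond [RHS]big_nat_cond; apply: eq_bigl => i.
  case: (boolP (1 <= i < m.+1)) => //= im; rewrite /on; case: (boolP (emp c i)) => //= ei.
  have := he im ei; case: (e i) => X Y /= /and3P[_ bX hY].
  rewrite /orient /= !inE !xpair_eqE; case: ifP => oXY.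
    rewrite orb_idr // => /andP[/eqP eX /eqP eY].
    rewrite eX in bX oXY; rewrite eY bx /= in oXY; rewrite bX /= in oxy.
    by move: (ltn_trans oXY oxy); rewrite ltnn.
  rewrite xpair_eqE [X in _ = X]andbC orb_idl // => /andP[/eqP eX /eqP eY].
  by move: oXY; rewrite eX eY oxy.
by clear; lia.
Qed.

Let cover_oriented x y j : adj x y -> branch x ->
    ~~ branch y || (enum_rank x < enum_rank y) -> ~~ branch y || (c x != c y) ->
    0 < j <= k x y + (~~ branch y) ->
  exists2 i, 1 <= i <= m & dist (pt k x y j) (centre i) <= m - i.
Proof.
move=> xy bx oxy hxy /andP[j0 jk].
have kE := k_oriented xy bx oxy hxy.
have jk' : j <= (k x y).+1 by case: (branch y) jk => /=; clear; lia.
have yx : adj y x by rewrite adj_sym.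
have byroot v : branch v -> dist (pt k x y j) (inl v) <= m - sg c r v ->
    exists2 i, 1 <= i <= m & dist (pt k x y j) (centre i) <= m - i.
  move=> bv dv; exists (c v).
    have := lab_pos lab bv; have := sgm bv; rewrite /sg; clear; lia.
  have -> : centre (c v) = inl (r (c v)).
    by rewrite /centre ifF //; apply/negbTE/empP; exists v.
  have := dist_triangle conH (pt k x y j) (inl v) (inl (r (c v))).
  by have := dist_block bv; have := sgm bv; move: dv; rewrite /sg; clear; lia.
have [le1|gt1] := leqP j (m - sg c r x).
  apply: (byroot x) => //; rewrite dist_sym // -(pt0 ksym xy).
  by apply: leq_trans (pt_dist conT ksym xy (leq0n j) jk') _; rewrite subn0.
set S := \sum_(_ <= _ < _ | _) _ in kE.
have [le2|gt2] := leqP j (m - sg c r x + S); last first.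
  have by_ : branch y by case: (branch y) kE jk => // kE jk; clear -kE jk gt2; lia.
  apply: (byroot y) => //; rewrite -(pt_end ksym xy).
  apply: leq_trans (pt_dist conT ksym xy jk' (leqnn _)) _.
  by rewrite by_ in kE; clear -kE gt2; lia.
have [|i [im /andP[ei /eqP oi] l1 l2]] := @prefix_sum (fun l => on l x y) (wt m) m (j - (m - sg c r x)).
  by rewrite -/S; clear -gt1 le2; lia.
exists i => //; rewrite /centre ei oi /= /centre_pos oi /=.
move: l1 l2; set P := \sum_(_ <= _ < _ | _) _; rewrite /wt => l1 l2.
have PS : P + wt m i <= S.
  rewrite /P /S [X in _ <= X](@big_cat_nat _ _ _ i) /=; [|by case/andP: im|by case/andP: im; lia].
  rewrite leq_add2l big_ltn_cond; last by case/andP: im.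
  by rewrite /on ei oi eqxx leq_addr.
have ak : m - sg c r x + P + (m - i) + 1 <= (k x y).+1.
  by move: kE PS; rewrite /wt; case: (branch y); clear; lia.
case: (leqP j (m - sg c r x + P + (m - i) + 1)) => le.
  by apply: leq_trans (pt_dist conT ksym xy le ak) _; clear -l1 l2 gt1; lia.
rewrite dist_sym //; apply: leq_trans (pt_dist conT ksym xy (ltnW le) jk') _.
by clear -l1 l2 gt1; lia.
Qed.

Lemma covers_lens : covers m centre.
Proof.
have nbr_leaf v : ~~ branch v -> exists2 x, adj x v & branch x.
  move=> nb; have lv : leaf v by rewrite leafE.
  have : 0 < #|[set u | adj v u]| by have := lv; rewrite /leaf /deg => /eqP ->.
  case/card_gt0P=> x; rewrite inE => vx; exists x; first by rewrite adj_sym.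
  exact: leaf_nbr vx lv.
move=> z; case: (vertexP z) => [[v ->]|[x [y [j [xy jk ->]]]]].
  case: (boolP (branch v)) => [bv|nb].
    exists (c v); first by have := lab_pos lab bv; have := sgm bv; rewrite /sg; clear; lia.
    have -> : centre (c v) = inl (r (c v)).
      by rewrite /centre ifF //; apply/negbTE/empP; exists v.
    by have := dist_block bv; have := sgm bv; rewrite /sg; clear; lia.
  have [x xv bx] := nbr_leaf v nb; rewrite -(pt_end ksym xv).
  by apply: cover_oriented; rewrite ?nb //= addn1 leqnn.
wlog : x y j xy jk / branch x && (~~ branch y || (enum_rank x < enum_rank y)).
  move=> hw; case: (boolP (branch x && (~~ branch y || (enum_rank x < enum_rank y)))) => h.
    exact: hw h.
  have yx : adj y x by rewrite adj_sym.
  rewrite -pt_rev //; last by case/andP: jk; clear; lia.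
  apply: hw => //; first by rewrite (ksym y); case/andP: jk; clear; lia.
  move: h; rewrite (rank_neq xy) negb_and negb_or negbK.
  case bx: (branch x); case by_: (branch y) => //=; first by rewrite negbK => ->.
  by have := leaf_nbr trT hirr brT xy; rewrite leafE // bx by_ => /(_ isT).
case/andP=> bx oxy; apply: cover_oriented => //.
  case by_: (branch y) => //=; apply/eqP => cxy.
  by move: jk; rewrite inblk0 //; case: (j).
by case/andP: jk => -> jk /=; apply: leq_trans jk (leq_addr _ _).
Qed.

Lemma lens_burnable : burnable H m.
Proof. exact: (covers_burnable conH covers_lens). Qed.

End Cover.

(** * The labelling of a cover *)

Section Geometry.
Variables (T : sgraph) (k : T -> T -> nat).
Hypotheses (trT : tree T) (hirr : homeo_irreducible T) (brT : 0 < #|Vbr T|).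
Hypothesis ksym : forall x y, k x y = k y x.
Implicit Types (u v x y : T).

Let conT : connected T. Proof. by case: trT. Qed.

Local Notation H := (subdivide k).
Implicit Types z : H.
Let trH : tree H := subdivide_tree ksym trT.
Let conH : connected H := subdivide_connected ksym conT.

(* The leaf at the end of an arm counts as a point of that arm, branch vertices
   lie on no edge. *)
Definition onedge u v z :=
  [|| [exists j : 'I_(k u v), z == pt k u v j.+1], (z == inl u) && ~~ branch u
    | (z == inl v) && ~~ branch v].

Lemma onedgeP u v z : adj u v -> branch u -> onedge u v z ->
  exists2 a, 0 < a <= k u v + (~~ branch v) & z = pt k u v a.
Proof.
move=> uv bu /or3P[/existsP[j /eqP ->]|/andP[_]|/andP[/eqP -> nv]].
- by exists j.+1 => //; have := ltn_ord j; clear; lia.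
- by rewrite bu.
by exists (k u v).+1; rewrite ?pt_end // nv addn1 ltnS leqnn.
Qed.

Lemma onedge_pt u v a : adj u v -> 0 < a <= k u v -> onedge u v (pt k u v a).
Proof.
move=> uv /andP[a0 ak]; apply/or3P; apply: Or31; apply/existsP.
have lt : a.-1 < k u v by rewrite prednK.
by exists (Ordinal lt); rewrite /= prednK.
Qed.

Lemma onedge_sym u v z : adj u v -> onedge u v z = onedge v u z.
Proof.
suff imp x y : adj x y -> onedge x y z -> onedge y x z.
  by move=> uv; apply/idP/idP; apply: imp; rewrite // adj_sym.
move=> xy /or3P[/existsP[j /eqP ->]|h|h]; last 2 first.
- by apply/or3P; apply: Or33.
- by apply/or3P; apply: Or32.
have yx : adj y x by rewrite adj_sym.
have lt := ltn_ord j; rewrite -pt_rev //; last by clear -lt; lia.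
by apply: onedge_pt; rewrite // (ksym y); clear -lt; lia.
Qed.

Lemma onedge_branch u v x : adj u v -> branch x -> ~~ onedge u v (inl x).
Proof.
move=> uv bx; apply/or3P => -[/existsP[j /eqP e]|/andP[/eqP [<-]]|/andP[/eqP [<-]]].
- by case: (@pt_neq_inl _ _ ksym u v x j.+1); rewrite // ltn_ord.
- by rewrite bx.
by rewrite bx.
Qed.

Lemma leaf_nbr_uniq x y y' : ~~ branch x -> adj x y -> adj x y' -> y = y'.
Proof.
rewrite -leafE // => /eqP dx xy xy'; apply/eqP; apply/negPn/negP => ne.
have : #|[set y; y']| <= deg x.
  by apply: subset_leq_card; apply/subsetP => w; rewrite !inE => /orP[]/eqP->.
by rewrite cards2 ne dx.
Qed.

Lemma onedge_uniq u v u' v' z : adj u v -> adj u' v' -> onedge u v z -> onedge u' v' z ->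
  (u', v') = (u, v) \/ (u', v') = (v, u).
Proof.
move=> uv uv'.
have vu : adj v u by rewrite adj_sym.
have vu' : adj v' u' by rewrite adj_sym.
have nei x y x' : adj x y -> adj x' y -> ~~ branch y -> x' = x.
  by move=> xy xy' ny; apply: (leaf_nbr_uniq ny); rewrite adj_sym.
have int x y (j : 'I_(k x y)) w : adj x y -> pt k x y j.+1 = inl w -> False.
  by move=> xy; apply: pt_neq_inl => //=; rewrite ltn_ord.
case/or3P=> [/existsP[j /eqP ->]|/andP[/eqP -> nb]|/andP[/eqP -> nb]];
case/or3P=> [/existsP[j' /eqP e]|/andP[/eqP e nb']|/andP[/eqP e nb']].
- have jk : 0 < j.+1 <= k u v by exact: ltn_ord.
  have jk' : 0 < j'.+1 <= k u' v' by exact: ltn_ord.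
  by case: (pt_eq ksym uv uv' jk jk' e) => -[eu ev _]; [left|right]; rewrite eu ev.
- by case: (int _ _ _ _ uv e).
- by case: (int _ _ _ _ uv e).
- by case: (int _ _ _ _ uv' (esym e)).
- by case: e => e; subst u'; left; rewrite (nei v u v').
- by case: e => e; subst v'; right; rewrite (nei v u u').
- by case: (int _ _ _ _ uv' (esym e)).
- by case: e => e; subst u'; right; rewrite (nei u v v').
by case: e => e; subst v'; left; rewrite (nei u v u').
Qed.

Lemma pt_dist_eq u v i j : adj u v -> i <= j <= (k u v).+1 ->
  dist (pt k u v i) (pt k u v j) = j - i.
Proof.
move=> uv /andP[ij jk]; rewrite dist_sym // -[in LHS](subnKC ij).
have := @nonbacktracking_dist0 _ trH (fun t => pt k u v (i + t)) (j - i) _ _ (j - i) (leqnn _).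
rewrite addn0; apply=> t lt; first by rewrite addnS; apply: pt_adj => //; clear -lt jk; lia.
by move/(pt_inj ksym uv) => e; have : i + t = i + t.+2; [apply: e|]; clear -lt jk; lia.
Qed.

(** A distance that rises at the first step from one end rises along the whole edge. If it falls
    from both ends, it has a local minimum inside the edge, and only z itself has no closer
    neighbour. *)
Lemma edge_dist u v z : adj u v -> ~~ onedge u v z ->
  (forall j, j <= (k u v).+1 -> dist (pt k u v j) z = dist (inl u : H) z + j) \/
  (forall j, j <= (k u v).+1 -> dist (pt k u v j) z = dist (inl v : H) z + ((k u v).+1 - j)).
Proof.
move=> uv nz; have vu : adj v u by rewrite adj_sym.
have nb x y : adj x y -> forall j, j.+1 < (k x y).+1 -> pt k x y j <> pt k x y j.+2.
  by move=> xy j lt /(pt_inj ksym xy) e; have : j = j.+2; [apply: e|]; clear -lt; lia.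
have away x y : adj x y -> dist (pt k x y 1) z = (dist (pt k x y 0) z).+1 ->
    forall j, j <= (k x y).+1 -> dist (pt k x y j) z = dist (inl x : H) z + j.
  move=> xy e j; rewrite -(pt0 ksym xy).
  apply: (nonbacktracking_dist trH) => //; last exact: nb.
  by move=> i lt; exact: pt_adj.
case: (tree_dist_step trH z (pt_adj ksym uv (leq0n _))) => e0; last first.
  by left; apply: away.
case: (tree_dist_step trH z (pt_adj ksym vu (leq0n _))) => e1; last first.
  right=> j jk; rewrite -pt_rev // (away v u vu e1) //.
  by rewrite (ksym v) leq_subr.
exfalso.
have e1' : dist (pt k u v (k u v).+1) z = (dist (pt k u v (k u v)) z).+1.
  have [f1 f2] := pt_flip ksym vu (leq0n _); rewrite subn0 (ksym v) in f1 f2.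
  by rewrite -f1 -f2.
have ex : exists j, (j <= k u v) && (dist (pt k u v j.+1) z == (dist (pt k u v j) z).+1).
  by exists (k u v); rewrite leqnn e1' eqxx.
case: (ex_minnP ex) => j /andP[jk /eqP ej] jmin.
case: j => [|j] in jk ej jmin *; first by move: e0; rewrite ej; clear; lia.
have nzj : pt k u v j.+1 != z.
  by apply: contraNneq nz => <-; exact: onedge_pt.
have [w [aw dw]] := dist_closer conH nzj.
case: (adj_pt ksym uv (_ : 0 < j.+1 <= k u v) aw) => // ew; rewrite ew /= in dw.
  case: (tree_dist_step trH z (pt_adj ksym uv (ltnW jk))) => e2.
    by move: dw; rewrite e2; clear; lia.
  have := jmin j; rewrite (ltnW jk) e2 eqxx => /(_ isT); clear; lia.
by move: ej; rewrite dw; clear; lia.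
Qed.

Lemma edge_dist_leaf u v z : adj u v -> ~~ branch v -> ~~ onedge u v z ->
  forall j, j <= (k u v).+1 -> dist (pt k u v j) z = dist (inl u : H) z + j.
Proof.
move=> uv nv nz; case: (edge_dist uv nz) => // h; exfalso.
have vu : adj v u by rewrite adj_sym.
have nvz : (inl v : H) != z.
  by apply: contraNneq nz => <-; apply/or3P; apply: Or33; rewrite eqxx.
have [w [aw dw]] := dist_closer conH nvz.
have [y vy ew] := adj_inl ksym aw; rewrite (leaf_nbr_uniq nv vy vu) in ew.
have [_ e1] := pt_flip ksym vu (leq0n _); rewrite subn0 (ksym v) in e1.
have := h (k u v) (leqnSn _); rewrite -e1 -ew subSnn dw; clear; lia.
Qed.

End Geometry.

Lemma first_argmin (f : nat -> nat) m : 0 < m -> exists i,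
  [/\ 1 <= i <= m, forall j, 1 <= j <= m -> f i <= f j & forall j, 1 <= j < i -> f i < f j].
Proof.
elim: m => // -[_ _|m IH _].
  by exists 1; split => // [j|j]; [case/andP=> j1 j2; have -> : j = 1 by lia|lia].
have [i [im h1 h2]] := IH isT.
case: (ltnP (f m.+2) (f i)) => lt.
  exists m.+2; split => [|j jm|j jm]; first by rewrite leqnn.
    case: (eqVneq j m.+2) => [->//|nj]; apply: leq_trans (ltnW lt) (h1 j _).
    by clear -jm nj; lia.
  by apply: leq_trans lt (h1 j _); clear -jm; lia.
exists i; split => // [|j jm]; first by clear -im; lia.
case: (eqVneq j m.+2) => [->//|nj]; apply: h1; clear -jm nj; lia.
Qed.

Lemma count_interval (P : pred nat) N lo len :
  (forall j, 1 <= j < N -> P j -> lo <= j < lo + len) -> \sum_(1 <= j < N) P j <= len.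
Proof.
move=> hP; rewrite -[len](size_iota lo).
have -> : \sum_(1 <= j < N) P j = size [seq j <- index_iota 1 N | P j].
  by rewrite size_filter -sum1_count [RHS]big_mkcond; apply: eq_bigr => j _; case: (P j).
apply: uniq_leq_size; first by rewrite filter_uniq ?iota_uniq.
move=> j; rewrite mem_filter mem_index_iota mem_iota => /andP[Pj jN].
exact: hP.
Qed.

(** * The upper bound for a covered tree *)

Section Count.
Variables (T : sgraph) (k : T -> T -> nat).
Hypotheses (trT : tree T) (hirr : homeo_irreducible T) (brT : 0 < #|Vbr T|).
Hypothesis ksym : forall x y, k x y = k y x.
Implicit Types (u v y : T).

Let conT : connected T. Proof. by case: trT. Qed.

Local Notation H := (subdivide k).
Let trH : tree H := subdivide_tree ksym trT.
Let conH : connected H := subdivide_connected ksym conT.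

Variables (m : nat) (x : nat -> H).
Hypothesis cov : covers m x.

Let D v i := dist (inl v : H) (x i) + i.

(* Each branch vertex is assigned to the ball that reaches farthest beyond it;
   ties go to the smallest index. *)
Variable c : T -> nat.
Hypothesis cm : forall v, 1 <= c v <= m.
Hypothesis cmin : forall v j, 1 <= j <= m -> D v (c v) <= D v j.
Hypothesis clt : forall v j, 1 <= j < c v -> D v (c v) < D v j.

Let dd v := dist (inl v : H) (x (c v)).
Let s v := dd v + c v.

Variable r : nat -> T.
Hypothesis rP : forall u, branch u ->
  [/\ branch (r (c u)), c (r (c u)) = c u & dist (inl (r (c u)) : H) (x (c u)) <= dd u].

Let s_le v : s v <= m.
Proof.
have [i im di] := cov (inl v); apply: leq_trans (cmin v im) _.
by rewrite /D; clear -im di; lia.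
Qed.

Let edge_len u y : adj u y -> dist (inl u : H) (inl y) <= (k u y).+1.
Proof.
move=> uy; rewrite -(pt0 ksym uy) -(pt_end ksym uy).
by have := pt_dist conT ksym uy (leq0n _) (leqnn _); rewrite subn0.
Qed.

(** When the centre lies beyond y, a ball reaching farther than it at y would do so at u as well.
    Equality is settled by the tie-breaking: whichever of [c u] and [c y] is larger would violate
    its minimality. *)
Let toward u : branch u -> x (c u) != inl u -> exists2 y, adj u y &
  onedge u y (x (c u)) \/
  [/\ branch y, c y = c u, ~~ onedge u y (x (c u)) & dd u = dd y + (k u y).+1].
Proof.
move=> bu nz; rewrite eq_sym in nz; have [w [uw dw]] := dist_closer conH nz.
have [y uy ew] := adj_inl ksym uw; exists y => //; rewrite ew in dw.
case: (boolP (onedge u y (x (c u)))) => [|ne]; [by left|right].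
have by_ : branch y.
  apply: contraT => ny; have := edge_dist_leaf trT hirr brT ksym uy ny ne (ltn0Sn _).
  by rewrite dw; clear; lia.
have e : dist (inl u : H) (x (c u)) = dist (inl y : H) (x (c u)) + (k u y).+1.
  case: (edge_dist trT ksym uy ne) => h.
    by have := h 1 (ltn0Sn _); rewrite dw; clear; lia.
  by have := h 0 (leq0n _); rewrite pt0 // subn0.
have low j : D u j <= D y j + (k u y).+1.
  by have := dist_triangle conH (inl u) (inl y) (x j); have := edge_len uy; rewrite /D; clear; lia.
have cy : c y = c u.
  have h1 := cmin y (cm u); have h2 := low (c y).
  have h3 : D u (c u) = D y (c u) + (k u y).+1 by rewrite /D e addnAC.
  have h4 := cmin u (cm y).
  case: (ltngtP (c y) (c u)) => // lt.
    have := clt (v := u) (j := c y); rewrite lt andbT; case/andP: (cm y) => -> _ /(_ isT).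
    by clear -h1 h2 h3; lia.
  have := clt (v := y) (j := c u); rewrite lt andbT; case/andP: (cm u) => -> _ /(_ isT).
  by clear -h4 h2 h3; lia.
by split => //; rewrite /dd cy.
Qed.

Let root_edge u : branch u -> u = r (c u) -> x (c u) != inl u ->
  exists2 y, adj u y & onedge u y (x (c u)).
Proof.
move=> bu ru nz; have [y uy [oe|[by_ cy _ e]]] := toward bu nz; first by exists y.
by have [_ _] := rP by_; rewrite cy -ru -/(dd u) e; clear; lia.
Qed.

(** A root that is not the centre has an incident edge carrying the centre, since a step towards the
    centre cannot reach a nearer vertex of the block; and a point lies on only one edge. *)
Let centre_root u v i : adj u v -> ~~ emp c i -> onedge u v (x i) ->
  (branch u /\ u = r i /\ c u = i) \/ (branch v /\ v = r i /\ c v = i).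
Proof.
move=> uv /empP[w bw cw] oe; have [br cr _] := rP bw; rewrite cw in br cr.
have nz : x (c (r i)) != inl (r i).
  by apply/eqP => e; move: oe; rewrite -cr e (negbTE (onedge_branch ksym uv br)).
have rr : r i = r (c (r i)) by rewrite cr.
have [y ry oy] := root_edge br rr nz; rewrite cr in oy.
by case: (onedge_uniq trT hirr brT ksym uv ry oe oy) => -[e _]; [left|right]; rewrite -e.
Qed.

(* The parent of a vertex in its block; the centre lies either beyond the
   parent or, when the parent is the root, possibly on the edge between. *)
Let par u y := [/\ adj u y, branch y, c y = c u &
  (~~ onedge u y (x (c u)) /\ dd u = dd y + (k u y).+1) \/
  [/\ onedge u y (x (c u)), y = r (c u), 0 < dd u, 0 < dd y & dd u + dd y = (k u y).+1]].

Let par_exists u : branch u -> u <> r (c u) -> exists y, par u y.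
Proof.
move=> bu nr; have [br cr mr] := rP bu.
have nz : x (c u) != inl u.
  apply/eqP => e; apply: nr; move: mr; rewrite /dd e dist_xx // leqn0 => /eqP.
  by move/(dist_eq0 conH) => [].
have [y uy [oe|[by_ cy ne e]]] := toward bu nz; last by exists y; split => //; left.
have nemp : ~~ emp c (c u) by apply/empP; exists u.
case: (centre_root uy nemp oe) => [[_ [e _]]|[by_ [ey cy]]]; first by case: nr.
exists y; split => //; right.
have [a ak ez] := onedgeP ksym uy bu oe; rewrite by_ addn0 in ak.
have ak' : 0 <= a <= (k u y).+1 by clear -ak; lia.
have ak2 : a <= (k u y).+1 <= (k u y).+1 by clear -ak; lia.
have d1 : dd u = a by rewrite /dd ez -(pt0 ksym uy) pt_dist_eq // subn0.
have d2 : dd y = (k u y).+1 - a.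
  by rewrite /dd cy ez -(pt_end ksym uy) dist_sym // pt_dist_eq.
by split => //; rewrite ?d1 ?d2; clear -ak; lia.
Qed.

(** Descent to the centre in H is descent to the root in T. If the parent y were farther from the
    root than u, then by induction its own parent, being its closer neighbour, would be u, and u and
    y would be parents of each other. *)
Let par_dist u y : branch u -> u <> r (c u) -> par u y ->
  dist u (r (c u)) = (dist y (r (c u))).+1.
Proof.
have [d] := ubnP (dd u); elim: d u y => // d IH u y lt bu nr [uy by_ cy pr].
case: (tree_dist_step trT (r (c u)) uy) => // far; exfalso.
case: pr => [[_ e]|[_ ey _ _ _]]; last by move: far; rewrite ey dist_xx.
have nry : y <> r (c y) by rewrite cy => ey; move: far; rewrite {1}ey dist_xx.
have [w pw] := par_exists by_ nry; have lt' : dd y < d by clear -lt e; lia.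
have := IH y w lt' by_ nry pw; rewrite cy => dw.
have ew : w = u.
  case: pw => yw _ _ _; apply: (@tree_closer_uniq _ trT y _ _ (r (c u))) => //.
  - by rewrite adj_sym.
  - by rewrite dw.
  by rewrite far.
case: pw => _ _ _ [[_ e2]|[_ ew2 _ _ _]]; first by move: e; rewrite e2 ew; clear; lia.
by case: nr; rewrite -cy -ew2 ew.
Qed.

Let lab : labelling c r.
Proof.
split=> u bu; first by case/andP: (cm u).
  by have [b e _] := rP bu.
move=> nr; have [y py] := par_exists bu nr; exists y.
by have := par_dist bu nr py; case: py.
Qed.

Let dT_le u : branch u -> dist u (r (c u)) <= dd u.
Proof.
have [d] := ubnP (dd u); elim: d u => // d IH u lt bu.
have [er|nr] := eqVneq u (r (c u)); first by rewrite -er dist_xx.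
have nr' : u <> r (c u) by apply/eqP.
have [y py] := par_exists bu nr'; rewrite (par_dist bu nr' py).
case: py => uy by_ cy [[_ e]|[_ -> d0 _ _]]; last by rewrite dist_xx.
have lt' : dd y < d by clear -lt e; lia.
by have := IH y lt' by_; rewrite cy e; clear; lia.
Qed.

(** The slack: each half-edge at u owns [del u] points fewer than the signature would grant. *)
Let del u := dd u - dist u (r (c u)).

Let s_sg u : branch u -> s u = sg c r u + del u.
Proof. by move=> bu; have := dT_le bu; rewrite /s /sg /del; clear; lia. Qed.

Let up_par u y : up c r u y -> par u y.
Proof.
move=> uy; have [bu _ _] := up_branch uy.
have nr : u <> r (c u) by apply/(up_exists lab bu); exists y.
have [w pw] := par_exists bu nr; suff -> : y = w by [].
apply: (up_uniq trT uy); rewrite /up /inblk (par_dist bu nr pw) ltnSn andbT.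
by case: pw => -> -> -> _; rewrite bu eqxx.
Qed.

Let del_root u : branch u -> u = r (c u) -> del u = dd u.
Proof. by move=> bu ru; rewrite /del -ru dist_xx // subn0. Qed.

(** Usually [del u = del y + k u y]. If the centre is on the edge, then y is the root and
    [k u y = del u + del y], which leaves an excess of [3 * del y]; the coefficient 3 of the roots
    in [weighted_degree] pays for it. *)
Let up_weight u y : up c r u y ->
  del y + 2 * k u y <= 2 * del u + 3 * (onedge u y (x (c u)) * del y).
Proof.
move=> uy; have [bu by_ cy] := up_branch uy.
have nr : u <> r (c u) by apply/(up_exists lab bu); exists y.
have py := up_par uy; have dT := par_dist bu nr py.
case: py => _ _ _ [[ne e]|[oe ey d0 d1 e]].
  have := dT_le by_; have := dT_le bu; rewrite /del cy dT e (negbTE ne); clear; lia.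
have ry : y = r (c y) by rewrite cy.
rewrite oe (del_root by_ ry) /del dT -ey dist_xx //; clear -e d0 d1; lia.
Qed.

Let ic u y := onedge u y (x (c u)).

Let bd_root u y : bd c u y -> ic u y -> u = r (c u).
Proof.
case/and3P => uy bu hy oe; have nemp : ~~ emp c (c u) by apply/empP; exists u.
case: (centre_root uy nemp oe) => [[_ [e _]]|[by_ [_ cy]]]; first exact: e.
by move: hy; rewrite by_ cy eqxx.
Qed.

Let eps := \sum_(p : T * T | bd c p.1 p.2) ic p.1 p.2 * del p.1.

(** A centre lies on at most one edge at its root, inside or leaving the block, so the slack of each
    root is charged at most once. *)
Let centre_sum : \sum_(p : T * T | up c r p.1 p.2) ic p.1 p.2 * del p.2 + eps <=
  \sum_(u | branch u && (u == r (c u))) del u.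
Proof.
have le1 : \sum_(p : T * T | up c r p.1 p.2) ic p.1 p.2 * del p.2 <=
    \sum_(p : T * T | inblk c p.1 p.2) ((p.1 == r (c p.1)) && ic p.1 p.2) * del p.1.
  rewrite (sum_pairs_sym (up c r) (fun u y => ic u y * del y)).
  rewrite big_mkcond [X in _ <= X]big_mkcond; apply: leq_sum => -[y u] _ /=.
  case: (boolP (up c r u y)) => // uy; have [bu by_ cy] := up_branch uy.
  have [auy _ _ pr] := up_par uy; have ayu : adj y u by rewrite adj_sym.
  rewrite /inblk ayu by_ bu cy eqxx /=; case: pr => [[ne _]|[oe ey _ _ _]].
    by rewrite /ic (negbTE ne).
  by rewrite {2}/ic cy (onedge_sym ksym _ ayu) oe ey eqxx; case: (ic _ _); rewrite ?mul1n.
have le2 : eps <= \sum_(p : T * T | bd c p.1 p.2) ((p.1 == r (c p.1)) && ic p.1 p.2) * del p.1.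
  apply: leq_sum => p bp; case: (boolP (ic p.1 p.2)) => // ip.
  by rewrite -(bd_root bp ip) eqxx.
apply: leq_trans (leq_add le1 le2) _; rewrite addnC.
rewrite -(adj_split c (fun p => ((p.1 == r (c p.1)) && ic p.1 p.2) * del p.1)).
rewrite (sum_pairs (fun u y => adj u y && branch u)
  (fun u y => ((u == r (c u)) && ic u y) * del u)).
rewrite [X in _ <= X]big_mkcond; apply: leq_sum => u _; rewrite -big_distrl /=.
case: (boolP (branch u)) => bu; last by rewrite big_pred0 // => y; rewrite andbF.
case: (boolP (u == r (c u))) => ru /=; last by rewrite big1_eq.
rewrite -[X in _ <= X]mul1n leq_mul2r; apply/orP; right.
case: (pickP (fun y => adj u y && ic u y)) => [y0 /andP[uy0 iy0]|no]; last first.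
  by rewrite big1 // => y /andP[uy _]; have := no y; rewrite uy /= => ->.
rewrite (bigD1 y0) ?uy0 ?bu //= big1 ?addn0 ?leq_b1 // => y /andP[/andP[uy _] ny].
apply/eqP; rewrite eqb0; apply: contra ny => iy.
case: (onedge_uniq trT hirr brT ksym uy0 uy iy0 iy) => -[]; first by move=> ->.
by move=> _ ey; move: uy; rewrite ey adj_irr.
Qed.

(** The right side is what the half-edges lose. The gain to be compensated is only 2 [eps] plus a
    single sum of [k], so equality of sizes will force the inner edges to be empty and the slack to
    vanish. *)
Let bd_weight : 3 * eps + 2 * \sum_(p : T * T | up c r p.1 p.2) k p.1 p.2 <=
  \sum_(p : T * T | bd c p.1 p.2) del p.1.
Proof.
have h1 := weighted_degree trT brT lab del; have h2 := centre_sum.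
have h3 : \sum_(p : T * T | up c r p.1 p.2) (del p.2 + 2 * k p.1 p.2) <=
   \sum_(p : T * T | up c r p.1 p.2) (2 * del p.1 + 3 * (ic p.1 p.2 * del p.2)).
  by apply: leq_sum => p; exact: up_weight.
have mulS (P : pred (T * T)) a F : \sum_(p | P p) a * F p = a * \sum_(p | P p) F p.
  by rewrite big_distrr.
have {}h3 : \sum_(p : T * T | up c r p.1 p.2) del p.2 +
    2 * \sum_(p : T * T | up c r p.1 p.2) k p.1 p.2 <=
    2 * \sum_(p : T * T | up c r p.1 p.2) del p.1 +
    3 * \sum_(p : T * T | up c r p.1 p.2) ic p.1 p.2 * del p.2.
  rewrite -(mulS _ 2 (fun p => k p.1 p.2)) -(mulS _ 2 (fun p => del p.1)).
  by rewrite -(mulS _ 3 (fun p => ic p.1 p.2 * del p.2)) -!big_split.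
rewrite (mulS _ 2 (fun p => del p.1)) in h1.
have arith a U B Y K W e : 3 * a + 2 * U <= B + Y -> W + e <= a ->
  Y + 2 * K <= 2 * U + 3 * W -> 3 * e + 2 * K <= B by clear; lia.
exact: (arith _ _ _ _ _ _ _ h1 h2 h3).
Qed.


(** The reach into the edge uy, counted from u. With the centre on the edge it is
    [dd u + (m - c u)], while [m - s u] equals [m - c u - dd u]; hence the factor 2. *)
Let A u y := m - s u + 2 * (ic u y * dd u).

(** A ball centred off the edge enters through an end and reaches no farther than the ball assigned
    to that end, by minimality. A ball centred on the edge has an empty index or, by [centre_root],
    is assigned to an end. *)
Let edge_covered u y j : bd c u y -> 0 < j <= k u y + (~~ branch y) ->
  [\/ j <= A u y, branch y /\ (k u y).+1 - j <= A y u |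
    exists2 i, 1 <= i <= m &
      [&& emp c i, onedge u y (x i) & dist (pt k u y j) (x i) <= m - i]].
Proof.
move=> /and3P[uy bu _] /andP[j0 jk].
have jk' : j <= (k u y).+1 by case: (branch y) jk => /=; clear; lia.
have [i im di] := cov (pt k u y j).
have near1 : dist (pt k u y j) (x i) = dist (inl u : H) (x i) + j -> j <= A u y.
  have := cmin u im; rewrite /A /s /dd -/(D u (c u)) => h e; rewrite e in di.
  by move: h; rewrite {2}/D; clear -di im; lia.
have near2 : dist (pt k u y j) (x i) = dist (inl y : H) (x i) + ((k u y).+1 - j) ->
    (k u y).+1 - j <= A y u.
  have := cmin y im; rewrite /A /s /dd -/(D y (c y)) => h e; rewrite e in di.
  by move: h; rewrite {2}/D; clear -di im; lia.
have [oe|ne] := boolP (onedge u y (x i)); last first.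
  have [by_|ny] := boolP (branch y).
    case: (edge_dist trT ksym uy ne) => h; first by apply: Or31; apply: near1; exact: h.
    by apply: Or32; split => //; apply: near2; exact: h.
  by apply: Or31; apply: near1; exact: (edge_dist_leaf trT hirr brT ksym uy ny ne).
have [ei|nei] := boolP (emp c i); first by apply: Or33; exists i => //; rewrite ei oe di.
have yu : adj y u by rewrite adj_sym.
have [a ak ez] := onedgeP ksym uy bu oe.
have ak' : a <= (k u y).+1 by case: (branch y) ak => /=; clear; lia.
have dj : j <= a + (m - i) /\ a <= j + (m - i).
  case: (leqP j a) => le.
    have jak : j <= a <= (k u y).+1 by rewrite le.
    by have := pt_dist_eq trT ksym uy jak; rewrite -ez; clear -di le; lia.
  have ajk : a <= j <= (k u y).+1 by rewrite (ltnW le).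
  by have := pt_dist_eq trT ksym uy ajk; rewrite -ez dist_sym //; clear -di le; lia.
case: (centre_root uy nei oe) => [[_ [_ cu]]|[by_ [_ cy]]].
  apply: Or31; have := s_le u.
  have du : dd u = a.
    by rewrite /dd cu ez -(pt0 ksym uy) pt_dist_eq ?leq0n // subn0.
  by rewrite /A /ic cu oe /s du cu; clear -dj im; lia.
apply: Or32; split => //; have := s_le y.
have dy : dd y = (k u y).+1 - a.
  by rewrite /dd cy ez -(pt_end ksym uy) dist_sym // pt_dist_eq ?ak' ?leqnn.
by rewrite /A /ic cy (onedge_sym ksym _ yu) oe /s dy cy; clear -dj im ak'; lia.
Qed.

Let edge_bound u y : bd c u y -> k u y + (~~ branch y) <=
  A u y + bd c y u * A y u +
  \sum_(1 <= i < m.+1 | emp c i && onedge u y (x i)) wt m i.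
Proof.
move=> buy; have /and3P[uy bu hy] := buy.
have yu : adj y u by rewrite adj_sym.
set N := k u y + _.
have bdyu : bd c y u = branch y.
  by rewrite /bd yu bu /= (eq_sym (c y)); case: (branch y) hy => //= ->.
pose Pi i j := dist (pt k u y j) (x i) <= m - i.
have cnt : \sum_(1 <= j < N.+1) 1 <= \sum_(1 <= j < N.+1)
    ((j <= A u y) + (branch y && ((k u y).+1 - j <= A y u)) +
     \sum_(1 <= i < m.+1 | emp c i && onedge u y (x i)) Pi i j).
  rewrite big_nat_cond [X in _ <= X]big_nat_cond; apply: leq_sum => j; rewrite andbT => jN.
  case: (edge_covered buy jN) => [->|[-> ->]|[i im /and3P[ei oe pi]]].
  - by [].
  - by rewrite andbT addn1 addSn.
  rewrite (big_rem i) ?mem_index_iota //= ei oe /= /Pi pi; clear; lia.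
rewrite sum_nat_const_nat muln1 subSS subn0 !big_split /= in cnt.
apply: leq_trans cnt _; apply: leq_add; first apply: leq_add.
- by apply: (count_interval (lo := 1)) => j jN le; clear -jN le; lia.
- rewrite bdyu; case: (boolP (branch y)) => by_; last by rewrite big1.
  rewrite mul1n /=; apply: (count_interval (lo := (k u y).+1 - A y u)) => j.
  by rewrite /N by_ addn0; clear; lia.
rewrite exchange_big /=; apply: leq_sum => i /andP[_ oe].
have [a ak ez] := onedgeP ksym uy bu oe.
apply: (count_interval (lo := a - (m - i))) => j jN; rewrite /Pi ez /wt.
have ak' : a <= (k u y).+1 by case: (branch y) ak => /=; clear; lia.
have jk' : j <= (k u y).+1 by move: jN; rewrite /N; case: (branch y) => /=; clear; lia.
case: (leqP j a) => le.
  by rewrite pt_dist_eq // ?le //; clear -le; lia.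
by rewrite dist_sym // pt_dist_eq // ?(ltnW le) //; clear -le; lia.
Qed.

(** An empty ball centred elsewhere, at a branch vertex or on an edge inside a block, adds nothing
    to the bound, so its whole weight is lost. *)
Let loc i := [exists p : T * T, bd c p.1 p.2 && onedge p.1 p.2 (x i)].

Variable e : nat -> T * T.
Hypothesis eP : forall i, loc i -> bd c (e i).1 (e i).2 && onedge (e i).1 (e i).2 (x i).

Let Eloc i := emp c i && loc i.

Let onedge_e u y i : bd c u y ->
  emp c i && onedge u y (x i) = Eloc i && (e i \in [:: (u, y); (y, u)]).
Proof.
move=> buy; rewrite /Eloc -andbA; congr (_ && _); have uy := bd_adj buy.
apply/idP/andP => [oe|[li]].
  have li : loc i by apply/existsP; exists (u, y); rewrite buy.
  split => //; case/andP: (eP li) => be oei; rewrite !inE.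
  by case: (onedge_uniq trT hirr brT ksym uy (bd_adj be) oe oei);
    rewrite -surjective_pairing => ->; rewrite eqxx ?orbT.
case/andP: (eP li) => be; rewrite !inE => oei /orP[]/eqP ei; rewrite ei /= in oei => //.
by rewrite onedge_sym.
Qed.

Let Q : rel T := fun u y => adj u y && ~~ inblk c u y.

Let Q_bd u y : Q u y -> bd c u y || bd c y u.
Proof.
case/andP=> uy; rewrite /inblk /bd uy (adj_sym y) uy /= (eq_sym (c y)).
case: (boolP (branch u)) => bu; case: (boolP (branch y)) => by_ //=.
  by move=> ->.
by have := leaf_nbr trT hirr brT uy; rewrite leafE // bu (negbTE by_) => /(_ isT).
Qed.

Let bd_Q u y : bd c u y -> Q u y.
Proof.
case/and3P=> uy bu h; rewrite /Q uy /inblk uy bu /=.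
by case: (branch y) h => //= /negbTE ->.
Qed.

Let bound u y := bd c u y * A u y + bd c y u * A y u +
  \sum_(1 <= i < m.+1 | Eloc i && (e i \in [:: (u, y); (y, u)])) wt m i.

Let cnt u y := k u y + (~~ branch u) + (~~ branch y).

Let cnt_bound u y : Q u y -> cnt u y <= bound u y.
Proof.
have half a b : bd c a b -> cnt a b <= bound a b.
  move=> bab; have := edge_bound bab; rewrite /bound /cnt bab mul1n.
  have /and3P[_ -> _] := bab; rewrite addn0.
  by under eq_bigl => i do rewrite onedge_e //.
case/Q_bd/orP=> [|byu]; first exact: half.
have := half _ _ byu; rewrite /cnt /bound ksym -addnA [(~~ branch y) + _]addnC addnA.
rewrite [bd c y u * _ + _]addnC.
rewrite (eq_bigl (fun i => Eloc i && (e i \in [:: (u, y); (y, u)]))) // => i.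
by rewrite !inE orbC.
Qed.

Let Q_sym u y : Q u y = Q y u.
Proof.
rewrite /Q /inblk (adj_sym y) (eq_sym (c y)); case: (adj u y) => //=.
by case: (branch u); case: (branch y).
Qed.

Let sum_adj_Q (F : T * T -> nat) : \sum_(p : T * T | adj p.1 p.2) F p =
  \sum_(p : T * T | inblk c p.1 p.2) F p + \sum_(p : T * T | Q p.1 p.2) F p.
Proof.
rewrite (bigID (fun p : T * T => inblk c p.1 p.2)) /=; congr (_ + _).
by apply: eq_bigl => p; rewrite /inblk; case: (adj _ _).
Qed.

Let sum_k := \sum_(p : T * T | up c r p.1 p.2) k p.1 p.2.

Let card_H : 2 * #|H| = 2 * #|Vbr T| + (2 * sum_k + \sum_(p : T * T | Q p.1 p.2) cnt p.1 p.2).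
Proof.
rewrite card_subdivide_cnt // sum_adj_Q; congr (_ + (_ + _)).
rewrite (eq_bigr (fun p => k p.1 p.2)); last first.
  by move=> p /and4P[_ -> -> _]; rewrite !addn0.
rewrite (sum_inblk trT brT c r) big_distrr; apply: eq_bigr => p _.
by rewrite (ksym p.2) addnn -mul2n.
Qed.

Let sum_bound : \sum_(p : T * T | Q p.1 p.2) bound p.1 p.2 =
  2 * \sum_(p : T * T | bd c p.1 p.2) A p.1 p.2 + 2 * \sum_(1 <= i < m.+1 | Eloc i) wt m i.
Proof.
rewrite big_split /=; congr (_ + _); last first.
  apply: (@sum_carriers _ _ _ _ _ Q) => [u y|i _ /andP[_ /eP/andP[be _]]]; first exact: Q_sym.
  by split; [exact: bd_Q|exact: adj_neq (bd_adj be)].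
rewrite -(sum_bd_sym c A) sum_adj_Q [X in _ = X + _]big1 // => p /and4P[_ b1 b2 /eqP e12].
by rewrite /bd b1 b2 e12 eqxx !andbF !mul0n.
Qed.

Let sum_A : \sum_(p : T * T | bd c p.1 p.2) A p.1 p.2 =
  \sum_(p : T * T | bd c p.1 p.2) (m - s p.1) + 2 * eps.
Proof.
rewrite /eps big_distrr -big_split; apply: eq_bigr => p bp; rewrite /A /=.
case: (boolP (ic p.1 p.2)) => // ip; have /and3P[_ b1 _] := bp.
by rewrite (del_root b1 (bd_root bp ip)).
Qed.

Let sum_sg : \sum_(p : T * T | bd c p.1 p.2) (m - sg c r p.1) =
  \sum_(p : T * T | bd c p.1 p.2) (m - s p.1) + \sum_(p : T * T | bd c p.1 p.2) del p.1.
Proof.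
rewrite -big_split; apply: eq_bigr => p /and3P[_ b1 _] /=.
by have := s_sg b1; have := s_le p.1; clear; lia.
Qed.

Let sum_emp : \sum_(1 <= i < m.+1 | emp c i) wt m i =
  \sum_(1 <= i < m.+1 | Eloc i) wt m i + \sum_(1 <= i < m.+1 | emp c i && ~~ loc i) wt m i.
Proof. by rewrite (bigID loc). Qed.

Let sum_cnt : \sum_(p : T * T | Q p.1 p.2) cnt p.1 p.2 <= \sum_(p : T * T | Q p.1 p.2) bound p.1 p.2.
Proof. by apply: leq_sum => p; exact: cnt_bound. Qed.

Let sg_m v : branch v -> sg c r v <= m.
Proof. by move=> bv; have := s_le v; rewrite s_sg //; exact: leq_trans (leq_addr _ _). Qed.

Let card_le : #|H| <= #|Vbr T| + lsize c (sg c r) m.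
Proof.
have h1 := card_H; have h2 := sum_cnt; have h3 := bd_weight.
rewrite sum_bound sum_A in h2; rewrite /lsize sum_sg sum_emp.
have arith h n K C B e0 L W U : 2 * h = 2 * n + (2 * K + C) -> C <= 2 * (B + 2 * e0) + 2 * L ->
  3 * e0 + 2 * K <= W -> h <= n + (B + W + (L + U)) by clear; lia.
exact: (arith _ _ _ _ _ _ _ _ _ h1 h2 h3).
Qed.

Let card_eq : #|H| = #|Vbr T| + lsize c (sg c r) m ->
  [/\ sum_k = 0, \sum_(p : T * T | bd c p.1 p.2) del p.1 = 0,
      \sum_(1 <= i < m.+1 | emp c i && ~~ loc i) wt m i = 0 &
      \sum_(p : T * T | Q p.1 p.2) cnt p.1 p.2 = \sum_(p : T * T | Q p.1 p.2) bound p.1 p.2].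
Proof.
have h1 := card_H; have h2 := sum_cnt; have h3 := bd_weight.
rewrite sum_bound sum_A in h2 *; rewrite /lsize sum_sg sum_emp => h4.
have arith h n K C B e0 L W U : 2 * h = 2 * n + (2 * K + C) -> C <= 2 * (B + 2 * e0) + 2 * L ->
  3 * e0 + 2 * K <= W -> h = n + (B + W + (L + U)) ->
  [/\ K = 0, W = 0, U = 0 & C = 2 * (B + 2 * e0) + 2 * L] by clear => *; split; lia.
exact: (arith _ _ _ _ _ _ _ _ _ h1 h2 h3 h4).
Qed.

Let sum0 (P : pred (T * T)) F p : \sum_(p | P p) F p = 0 -> P p -> F p = 0.
Proof. by move/eqP; rewrite sum_nat_eq0 => /forallP/(_ p)/implyP h /h /eqP. Qed.

Lemma count_labelling : [/\ labelling c r, forall v, branch v -> sg c r v <= m,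
  #|H| <= #|Vbr T| + lsize c (sg c r) m &
  #|H| = #|Vbr T| + lsize c (sg c r) m -> (forall v, branch v -> sg c r v < m) ->
    (forall i, 1 <= i <= m -> emp c i -> bd c (e i).1 (e i).2) /\
    forall u y, adj u y -> k u y = lens c (sg c r) m (emp c) e u y].
Proof.
split=> // /card_eq[k0 d0 u0 cb] sgm.
have locE i : 1 <= i <= m -> emp c i -> loc i.
  move=> im ei; apply: contraT => nl; move: u0.
  by rewrite (big_rem i) ?mem_index_iota //= ei nl /wt addn1 addSn.
have he i : 1 <= i <= m -> emp c i -> bd c (e i).1 (e i).2.
  by move=> im ei; case/andP: (eP (locE i im ei)).
split=> // u y uy; case: (boolP (inblk c u y)) => [iuy|nuy].
  have /and4P[_ bu by_ /eqP cuy] := iuy; rewrite lens_inblk //.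
  have kup a b : up c r a b -> k a b = 0 by move=> ab; exact: (sum0 (p := (a, b)) k0 ab).
  case: (boolP (up c r u y)) => [/kup //|nup]; rewrite ksym; apply: kup.
  move: nup; rewrite /up iuy /= -leqNgt => le.
  rewrite /inblk adj_sym uy by_ bu cuy eqxx /=.
  by have := tree_dist_neq trT (r (c y)) uy; rewrite cuy in le; rewrite ltn_neqAle => ->.
have Quy : Q u y by rewrite /Q uy.
have del0 a b : bd c a b -> del a = 0 by move=> ab; exact: (sum0 (p := (a, b)) d0 ab).
have A0 a b : bd c a b -> A a b = m - sg c r a.
  move=> ab; have /and3P[_ ba _] := ab; rewrite /A s_sg // (del0 _ _ ab) addn0.
  case: (boolP (ic a b)) => [ia|_]; last by rewrite addn0.
  by rewrite -(del_root ba (bd_root ab ia)) (del0 _ _ ab) muln0 addn0.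
(* The two sums agree and are ordered term by term, so the terms agree. *)
have cbuy : cnt u y = bound u y.
  have := leqif_sum (P := fun p : T * T => Q p.1 p.2)
    (fun p Qp => leqif_eq (cnt_bound Qp)).
  by case=> _; rewrite cb eqxx => /esym/forallP/(_ (u, y))/implyP/(_ Quy)/eqP.
have h := st1_cnt trT hirr brT c uy sgm.
move: cbuy; rewrite /cnt /bound.
have -> : bd c u y * A u y = bd c u y * (m - sg c r u).
  by case: (boolP (bd c u y)) => // /A0 ->.
have -> : bd c y u * A y u = bd c y u * (m - sg c r y).
  by case: (boolP (bd c y u)) => // /A0 ->.
rewrite -h /lens.
have -> : \sum_(1 <= i < m.+1 | Eloc i && (e i \in [:: (u, y); (y, u)])) wt m i =
   \sum_(1 <= i < m.+1 | emp c i && (e i \in [:: (u, y); (y, u)])) wt m i.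
  rewrite big_nat_cond [RHS]big_nat_cond; apply: eq_bigl => i.
  case: (boolP (1 <= i < m.+1)) => //= im; rewrite /Eloc; case: (boolP (emp c i)) => //= ei.
  by rewrite locE.
by clear; lia.
Qed.

End Count.

Section CountMain.
Variables (T : sgraph) (k : T -> T -> nat).
Hypotheses (trT : tree T) (hirr : homeo_irreducible T) (brT : 0 < #|Vbr T|).
Hypothesis ksym : forall x y, k x y = k y x.

Lemma covered_labelling m (x : nat -> subdivide k) : covers m x -> exists c r,
  [/\ labelling c r, forall v, branch v -> sg c r v <= m,
  #|subdivide k| <= #|Vbr T| + lsize c (sg c r) m &
  #|subdivide k| = #|Vbr T| + lsize c (sg c r) m -> (forall v, branch v -> sg c r v < m) ->
  exists2 e, forall i, 1 <= i <= m -> emp c i -> bd c (e i).1 (e i).2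
    & forall u y, adj u y -> k u y = lens c (sg c r) m (emp c) e u y].
Proof.
move=> cov; have [b _] := br_exists brT.
have m0 : 0 < m by have [i im _] := cov (inl b); clear -im; lia.
have /fin_all_exists[c hc] (v : T) := first_argmin (fun i => dist (inl v : subdivide k) (x i) + i) m0.
pose r i := if [pick u : T | branch u && (c u == i)] is Some u0
  then [arg min_(u < u0 | branch u && (c u == i)) dist (inl u : subdivide k) (x i)] else b.
have hr u : branch u -> [/\ branch (r (c u)), c (r (c u)) = c u
    & dist (inl (r (c u)) : subdivide k) (x (c u)) <= dist (inl u : subdivide k) (x (c u))].
  move=> bu; rewrite /r; case: pickP => [u0 hu0|/(_ u)]; last by rewrite bu eqxx.
  case: arg_minnP => // v /andP[bv /eqP cv] vmin; split => //.
  by apply: vmin; rewrite bu eqxx.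
have [e he] : exists e : nat -> T * T, forall i,
    [exists p : T * T, bd c p.1 p.2 && onedge p.1 p.2 (x i)] ->
    bd c (e i).1 (e i).2 && onedge (e i).1 (e i).2 (x i).
  exists (fun i => if [pick p : T * T | bd c p.1 p.2 && onedge p.1 p.2 (x i)] is Some p
                   then p else (b, b)).
  by move=> i /existsP[p hp]; case: pickP => [//|/(_ p)]; rewrite hp.
have [h1 h2 h3 h4] := count_labelling trT hirr brT ksym cov
  (fun v => let: And3 h _ _ := hc v in h) (fun v => let: And3 _ h _ := hc v in h)
  (fun v => let: And3 _ _ h := hc v in h) hr he.
exists c, r; split => // eH sgm; have [h5 h6] := h4 eH sgm; by exists e.
Qed.

End CountMain.

(** * Trees of maximal order *)

Lemma covers_iso (G H : sgraph) m x : connected G -> iso G H -> covers (G := G) m x ->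
  exists y, covers (G := H) m y.
Proof.
move=> conG [f fb fadj] cov; have [g fK gK] := fb.
have dle u v : dist (f u) (f v) <= dist u v.
  have [p [up <- <-]] := dist_path conG u v.
  rewrite -(last_map f) -(size_map f); apply: dist_le_path.
  by rewrite path_map; apply: sub_path up => a b /=; rewrite fadj.
exists (f \o x) => z; have [i im di] := cov (g z); exists i => //=.
by rewrite -[z]gK; apply: leq_trans (dle _ _) di.
Qed.

Lemma iso_connected (G H : sgraph) : iso G H -> connected G -> connected H.
Proof.
case=> f [g fK gK] fadj conG u v; have /connectP[p up ep] := conG (g u) (g v).
apply/connectP; exists (map f p); last by rewrite -[u]gK last_map -ep gK.
by rewrite -[u]gK path_map; apply: sub_path up => a b /=; rewrite fadj.
Qed.

Lemma burning_number_covers (G : sgraph) b (z0 : G) : burning_number G b ->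
  exists x, covers (G := G) b x.
Proof. by case=> [[s bs] _]; exact: burning_seq_covers z0 bs. Qed.

Lemma burnable_iso (G H : sgraph) m : connected G -> 0 < #|G| -> iso G H ->
  burnable G m -> burnable H m.
Proof.
move=> conG /card_gt0P[z0 _] isoGH [b bn bm].
have [x cov] := burning_number_covers z0 bn.
have [y covy] := covers_iso conG isoGH cov.
have [b' bn' bb'] := covers_burnable (iso_connected isoGH conG) covy.
by exists b'; rewrite // (leq_trans bb').
Qed.

Section Main.
Variables (m : nat) (T : sgraph).
Hypotheses (trT : tree T) (hirr : homeo_irreducible T) (brT : 0 < #|Vbr T|).
Hypothesis nm : #|Vbr T| < m.

Let conT : connected T. Proof. by case: trT. Qed.

Lemma subdivide_homeomorphic (k : T -> T -> nat) : (forall x y, k x y = k y x) ->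
  homeomorphic T (subdivide k).
Proof.
move=> ksym; apply: rst_step; exists k; split => //; last exact: iso_refl.
move=> u v uv _.
have half (a b : T) : adj a b -> branch a ->
    exists x p, (arm x p || internal_path x p) && edge_of x p a b /\ edge_of x p b a.
  move=> ab ba; exists a, [:: b].
  rewrite /edge_of /= !inE !eqxx orbT /= andbT; split => //.
  rewrite /arm /internal_path /simple_path /no_branch_between /= ab ba inE adj_neq //=.
  by rewrite leafE // !andbT orNb.
case: (boolP (branch u)) => [bu|nb].
  by have [x [p [h _]]] := half u v uv bu; exists x, p.
have bv : branch v by apply: leaf_nbr uv _; rewrite // leafE.
have vu : adj v u by rewrite adj_sym.
by have [x [p [/andP[h _] h']]] := half v u vu bv; exists x, p; rewrite h.
Qed.

Lemma bd_exists (c : T -> nat) r : labelling c r -> exists p : T * T, bd c p.1 p.2.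
Proof.
move=> lab; have [b bb] := br_exists brT.
have nb : ~~ emp c (c b) by apply/empP; exists b.
have := bd_ge3 trT brT lab nb; case: (pickP (fun p : T * T => bd c p.1 p.2)) => [p hp _|no].
  by exists p.
by rewrite big_pred0.
Qed.

Lemma induced_labelling (t : seq (option (rooted_subtree T))) G :
  admissible t -> induced t m G -> exists r,
  [/\ labelling (block_of t) r, forall v, branch v -> sg (block_of t) r v < m,
      forall i, emp (block_of t) i = ~~ isSome (blk t i),
      forall i R, blk t i = Some R -> r i = rt R &
      #|G| = #|Vbr T| + lsize (block_of t) (sg (block_of t) r) m /\ burnable G m].
Proof.
move=> adt ind; have [r [lab sigE empE rE]] := admissible_labelling trT brT adt.
have [sigm [e he isoG]] := induced_lens trT hirr brT ind.
have sgm v : branch v -> sg (block_of t) r v < m by move=> bv; rewrite -sigE // sigm.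
have he' i : 1 <= i <= m -> emp (block_of t) i -> bd (block_of t) (e i).1 (e i).2.
  by move=> im ei; apply: he => //; move: ei; rewrite empE; case: (blk t i).
have isoG' : iso (subdivide (lens (block_of t) (sg (block_of t) r) m (emp (block_of t)) e)) G.
  apply: iso_trans isoG; apply: (lens_ext trT hirr brT) => // v bv; by rewrite sigE.
have trH := subdivide_tree (lens_sym (block_of t) (sg (block_of t) r) m (emp (block_of t)) e) trT.
exists r; split => //; split.
  by rewrite -(iso_card isoG') card_lens.
case: trH => H0 conH _.
exact: burnable_iso conH H0 isoG' (lens_burnable trT hirr brT lab sgm he').
Qed.

Section Maximal.
Variable N : nat.
Hypothesis maxN : forall T' : sgraph, tree T' -> homeomorphic T T' ->
  burning_number T' m -> #|T'| <= N.

(* If the tree induced by a labelling has burning number less than m, then the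
   labelling of one of its shorter covers induces a larger tree of degree m. *)
Lemma lsize_max (c : T -> nat) r : labelling c r -> (forall v, branch v -> sg c r v <= m) ->
  #|Vbr T| + lsize c (sg c r) m <= N.
Proof.
have [B hB] := lsize_bound T m.
have [d] := ubnP (B - lsize c (sg c r) m); elim: d c r => // d IH c r lt lab sgm.
have next (c' : T -> nat) r' : labelling c' r' -> (forall v, branch v -> sg c' r' v <= m) ->
    lsize c (sg c r) m < lsize c' (sg c' r') m -> #|Vbr T| + lsize c (sg c r) m <= N.
  move=> lab' sgm' lt'; apply: leq_trans (IH c' r' _ lab' sgm').
    by rewrite leq_add2l ltnW.
  by have := hB c' (sg c' r'); clear -lt lt'; lia.
case: (boolP [exists v : T, branch v && (sg c r v == m)]) => [/existsP[v /andP[bv /eqP sv]]|no].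
  have [j /andP[j0 jc] ej] := gap brT lab nm bv sv.
  have nev : ~~ emp c (c v) by apply/empP; exists v.
  by have [c' [r' [lab' sgm' lt']]] := lab_swap trT brT lab sgm j0 jc ej nev; exact: next lt'.
have sgm' v : branch v -> sg c r v < m.
  move=> bv; rewrite ltn_neqAle sgm // andbT; apply: contra no => sv.
  by apply/existsP; exists v; rewrite bv.
(* The number of vertices does not depend on the carriers, so all empty indices may be put on one
   half-edge p. *)
have [p bp] := bd_exists lab.
have he i : 1 <= i <= m -> emp c i -> bd c ((fun _ : nat => p) i).1 ((fun _ : nat => p) i).2.
  by [].
have ksym := lens_sym c (sg c r) m (emp c) (fun=> p).
have trH := subdivide_tree ksym trT.
have [b bn bm] := lens_burnable trT hirr brT lab sgm' he.
have cardS := card_lens trT hirr brT sgm' he.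
move: bm; rewrite leq_eqVlt => /orP[/eqP eb|bm].
  rewrite -cardS; apply: maxN => //; first exact: subdivide_homeomorphic.
  by move: bn; rewrite eb.
have /card_gt0P[z0 _] : 0 < #|subdivide (lens c (sg c r) m (emp c) (fun=> p))| by case: trH.
have [x cov] := burning_number_covers z0 bn.
have [c' [r' [lab' sgb le _]]] := covered_labelling trT hirr brT ksym cov.
have lt' := lsize_lt trT brT lab' sgb bm.
apply: (next c' r') => // [v bv|]; first by apply: leq_trans (sgb v bv) (ltnW bm).
by move: le; rewrite cardS; clear -lt'; lia.
Qed.

Lemma max_induced (Tmax : sgraph) : tree Tmax -> homeomorphic T Tmax ->
  burning_number Tmax m -> #|Tmax| = N ->
  exists2 t : seq (option (rooted_subtree T)), admissible t & induced t m Tmax.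
Proof.
move=> trM homM bnM cardM; have [x0 _] := br_exists brT.
have [k [ksym isoM]] := reduct_subdivision hirr x0 conT trM (homeomorphic_reduct hirr homM).
have [/card_gt0P[z0 _] conM _] := trM.
have [x0' cov'] := burning_number_covers z0 bnM.
have [x cov] := covers_iso conM (iso_sym isoM) cov'.
have [c [r [lab sgm le eqk]]] := covered_labelling trT hirr brT ksym cov.
have cardk : #|subdivide k| = N by rewrite (iso_card isoM).
have eqN : #|subdivide k| = #|Vbr T| + lsize c (sg c r) m.
  by apply/eqP; rewrite eqn_leq le cardk lsize_max.
have sgm' v : branch v -> sg c r v < m.
  move=> bv; rewrite ltn_neqAle sgm // andbT; apply/eqP => sv.
  have [j /andP[j0 jc] ej] := gap brT lab nm bv sv.
  have nev : ~~ emp c (c v) by apply/empP; exists v.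
  have [c' [r' [lab' sgm' lt']]] := lab_swap trT brT lab sgm j0 jc ej nev.
  by have := lsize_max lab' sgm'; rewrite -cardk eqN leq_add2l leqNgt lt'.
have [e he klens] := eqk eqN sgm'.
have cm v : branch v -> c v <= m.
  by move=> bv; apply: leq_trans (sgm v bv); rewrite /sg leq_addl.
have [t [adt bo so eo]] := labelling_admissible brT lab cm; exists t => //.
apply: (lens_induced trT hirr brT (e := e)).
- by move=> v bv; rewrite so // sgm'.
- move=> i im bi; have ei : emp c i by rewrite -eo bi.
  have /and3P[aXY bX hY] := he i im ei; apply/and3P; split => //.
  by rewrite bo //; case: (boolP (branch _)) hY => //= bY; rewrite bo.
apply: iso_trans isoM; apply: iso_trans (subdivide_ext trT hirr brT _ ksym _); last first.
- by move=> u v uv; rewrite klens.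
- exact: lens_sym.
by apply: (lens_ext trT hirr brT) => [v bv|v bv|i _]; rewrite ?bo ?so ?eo.
Qed.

End Maximal.
End Main.

Theorem theorem3p13 (m n : nat) (T : sgraph)
  (hn : 1 <= n) (hnm : n < m)
  (hT : tree T) (hirr : homeo_irreducible T) (hbr : #|Vbr T| = n) :
  (forall t : seq (option (rooted_subtree T)), admissible t ->
     forall G : sgraph, induced t m G -> burnable G m) /\
  (forall Tmax : sgraph,
     tree Tmax -> homeomorphic T Tmax -> burning_number Tmax m ->
     (forall T' : sgraph, tree T' -> homeomorphic T T' ->
        burning_number T' m -> #|T'| <= #|Tmax|) ->
     [/\ exists2 t : seq (option (rooted_subtree T)),
           admissible t & induced t m Tmax,
         forall t : seq (option (rooted_subtree T)), admissible t ->
           (exists i, [/\ 1 <= i < size t, blk t i = None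
                        & blk t i.+1 <> None]) ->
           ~ induced t m Tmax
       & forall t : seq (option (rooted_subtree T)), admissible t ->
           (exists i j (Ti Tj : rooted_subtree T),
              [/\ 1 <= i, i < j <= size t, blk t i = Some Ti, blk t j = Some Tj
                & adj (rt Ti) (rt Tj) /\ j - i <> 1]) ->
           ~ induced t m Tmax]).
Proof.
rewrite -hbr in hn hnm; split=> [t adt G ind|Tmax trM homM bnM maxM].
  by have [r [_ _ _ _ []]] := induced_labelling hT hirr hn adt ind.
split; first exact: (max_induced hT hirr hn hnm maxM trM homM bnM).
  move=> t adt [i [/andP[i0 _] bi bi1]] ind.
  have [r [lab sgm empE _ [cardM _]]] := induced_labelling hT hirr hn adt ind.
  have ei : emp (block_of t) i by rewrite empE bi.
  have ei1 : ~~ emp (block_of t) i.+1 by rewrite empE negbK; case: (blk t i.+1) bi1.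
  have sgm' v : branch v -> sg (block_of t) r v <= m by move=> /sgm/ltnW.
  have [c' [r' [lab' sgc' lt]]] := lab_swap hT hn lab sgm' i0 (ltnSn i) ei ei1.
  have := lsize_max hT hirr hn hnm maxM lab' sgc'.
  by rewrite cardM leq_add2l leqNgt lt.
move=> t adt [i [j [Ti [Tj [i0 /andP[ij _] bi bj [aij nij]]]]]] ind.
have [r [lab sgm empE rE [cardM _]]] := induced_labelling hT hirr hn adt ind.
have ei : ~~ emp (block_of t) i by rewrite empE bi.
have ej : ~~ emp (block_of t) j by rewrite empE bj.
have sgm' v : branch v -> sg (block_of t) r v <= m by move=> /sgm/ltnW.
have ij' : i.+1 < j by clear -ij nij; lia.
have arij : adj (r i) (r j) by rewrite (rE i Ti) // (rE j Tj).
have [c' [r' [lab' sgc' lt]]] := lab_merge hT hn lab sgm' ij' ei ej arij.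
have := lsize_max hT hirr hn hnm maxM lab' sgc'.
by rewrite cardM leq_add2l leqNgt lt.
Qed.
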